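(* Let $\nu:\mathcal O(X)\to\mathcal B(\mathcal H)$ be a POVM for which the Radon-Nikodým derivative $\frac{d\nu}{d\nu_\rho}$ exists, where $\rho\in S(\mathcal H)$ is a full-rank density operator, and let $f:X\to\mathcal B(\mathcal H)$ be a $\nu$-integrable quantum random variable. Let $\{e_i\}$ be the fixed orthonormal basis of $\mathcal H$ with matrix units $e_{ij}$, and put $s_{ij}=e_{ji}$. Then the formula $$\int_X f\,d\nu := \sum_{i,j\ge 1}\left(\int_X f_{s_{ij}}\,d\nu_\rho\right)\otimes e_{ij}$$ (that is, the operator whose $(i,j)$ matrix entry $\langle (\int_X f\,d\nu)e_j,e_i\rangle$ is $\int_X f_{s_{ij}}\,d\nu_\rho$) defines the unique operator in $\mathcal B(\mathcal H)$ that satisfies $$\mathrm{Tr}\left(s\int_X f\,d\nu\right)=\int_X f_s\,d\nu_\rho \quad\text{for all } s\in\mathcal T(\mathcal H).$$ Moreover, $\int_X f\,d\nu$ is independent of the choice of the full-rank density operator $\rho$ and of the orthonormal basis $\{e_i\}$.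
   Context: $X$ is a locally compact Hausdorff space with Borel $\sigma$-algebra $\mathcal O(X)$; $\mathcal H$ is a separable Hilbert space with orthonormal basis $\{e_i\}$, inner product linear in the first variable, and $e_{ij}$ is the rank-one operator with $e_{ij}e_j=e_i$ and $e_{ij}e_k=0$ for $k\ne j$, so $\mathrm{Tr}(e_{ji}A)=\langle Ae_j,e_i\rangle$. $\mathcal T(\mathcal H)$ is the space of trace class operators, $S(\mathcal H)\subset\mathcal T(\mathcal H)$ the positive operators of trace one (states, density operators); full-rank means injective. A POVM $\nu:\mathcal O(X)\to\mathcal B(\mathcal H)$ is a map with positive operator values that is countably additive on pairwise disjoint countable families, with convergence in the ultraweak topology. Put $\nu_\rho(E)=\mathrm{Tr}(\rho\nu(E))$ and $\nu_{ij}(E)=\langle\nu(E)e_j,e_i\rangle$. For full-rank $\rho$, $\nu$ and $\nu_\rho$ have the same null sets, so $\nu_{ij}\ll\nu_\rho$. The Radon-Nikodým derivative $\frac{d\nu}{d\nu_\rho}(x)$ is defined by $\langle\frac{d\nu}{d\nu_\rho}(x)e_j,e_i\rangle=\frac{d\nu_{ij}}{d\nu_\rho}(x)$; it is said to exist if (for suitable representatives) this is the matrix of a bounded operator for every $x$. It is then positive $\nu_\rho$-almost everywhere, so its positive square root is defined almost everywhere. A quantum random variable is a Borel measurable map $f:X\to\mathcal B(\mathcal H)$; the paper uses this in the form that $x\mapsto\mathrm{Tr}(\rho f(x))$ is Borel for every state $\rho$. For $s\in\mathcal T(\mathcal H)$ put $f_s(x)=\mathrm{Tr}\big(s(\frac{d\nu}{d\nu_\rho}(x))^{1/2}f(x)(\frac{d\nu}{d\nu_\rho}(x))^{1/2}\big)$.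 A positive ($f(x)\ge 0$ for all $x$) quantum random variable $f$ is $\nu$-integrable if $f_s$ is $\nu_\rho$-integrable for every $s\in S(\mathcal H)$; an arbitrary quantum random variable $f$ is $\nu$-integrable if the pointwise positive and negative parts $(\mathrm{Re} f)_+,(\mathrm{Re} f)_-,(\mathrm{Im} f)_+,(\mathrm{Im} f)_-$ are all $\nu$-integrable. *)

(* Defs.v *)
(* Complex scalars are R[i] for R : realType. *)
From HB Require Import structures.
From mathcomp Require Import all_boot all_order all_algebra.
From mathcomp Require Import sesquilinear complex.
From mathcomp Require Import all_classical all_reals all_analysis.

Set Implicit Arguments.
Unset Strict Implicit.
Unset Printing Implicit Defensive.
Import Order.TTheory GRing.Theory Num.Theory.
Import numFieldNormedType.Exports.
Local Open Scope classical_set_scope.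
Local Open Scope complex_scope.
Local Open Scope ring_scope.

(* A {dot H for conj} form is positive definite, linear in its first variable
   and conjugate-linear in the second. *)
HB.mixin Record isHilbert (R : realType) H & CompleteNormedModule R[i] H := {
  inner : {dot H for (@Num.conj R[i])} ;
  inner_norm : forall x : H, inner x x = `|x| ^+ 2 }.

#[short(type="hilbertType")]
HB.structure Definition Hilbert (R : realType) :=
  {H of CompleteNormedModule R[i] H & isHilbert R H}.

Notation "''[' u , v ]" := (inner u v)
  : ring_scope.

(* R[i] carries its norm topology as R[i]^o. *)
Definition ccvg (R : realType) (u : nat -> R[i]) (l : R[i]) :=
  (u : nat -> R[i]^o) @ \oo --> (l : R[i]^o).

Section Operators.
Context {R : realType} {H : hilbertType R}.
Implicit Types (A P T s : H -> H) (I : set nat) (e : nat -> H).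

(* Operators are functions H -> H, with their pointwise vector-space structure
   and the composition \o; B(H) is a set of functions. *)
Definition bounded_operator : set (H -> H) :=
  [set A | linear A /\ exists M : R[i], forall x, `|A x| <= M * `|x|].

Definition positive A := bounded_operator A /\ forall x, 0 <= '[A x, x].

Definition adjoint A : H -> H :=
  xget (cst 0) [set B | bounded_operator B /\ forall x y, '[A x, y] = '[x, B y]].

(* the positive square root; 0 if A is not positive *)
Definition opsqrt A : H -> H := xget (cst 0) [set P | positive P /\ P \o P = A].

Definition opabs A : H -> H := opsqrt (adjoint A \o A).

Definition Reop A : H -> H := 2^-1 *: (A + adjoint A).
Definition Imop A : H -> H := (2 * 'i)^-1 *: (A - adjoint A).

(* positive and negative parts of a self-adjoint operator *)
Definition pos_part A : H -> H := 2^-1 *: (opabs A + A).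
Definition neg_part A : H -> H := 2^-1 *: (opabs A - A).

(* Orthonormal bases are indexed by a set I of natural numbers, so that both
   finite- and infinite-dimensional separable spaces are covered. *)
Definition orthonormal_basis I e :=
  (forall i j, I i -> I j -> '[e i, e j] = (i == j)%:R) /\
  forall x, (\sum_(k < n | (k : nat) \in I) '[x, e k] *: e k) @[n --> \oo] --> x.

(* rank_one u v is x |-> <x, v> u; the matrix unit e_ij is rank_one e_i e_j *)
Definition rank_one (u v : H) : H -> H := fun x => '[x, v] *: u.

(* Tr |T| < +oo, computed in some (equivalently, any) orthonormal basis *)
Definition trace_class : set (H -> H) := [set T | bounded_operator T /\
  exists I e, orthonormal_basis I e /\
    (\sum_(k <oo | k \in I) (complex.Re '[opabs T (e k), e k])%:E < +oo)%E].

(* For T of trace class the series has the same sum in every orthonormal basis;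
   the value at other operators is irrelevant. *)
Definition Tr T : R[i] :=
  xget 0 [set t | forall I e, orthonormal_basis I e ->
    ccvg (fun n => \sum_(k < n | (k : nat) \in I) '[T (e k), e k]) t].

Definition state : set (H -> H) :=
  [set s | trace_class s /\ positive s /\ Tr s = 1].

Definition full_rank T := injective T.

Definition ultraweak_cvg (u : nat -> H -> H) A :=
  forall s, trace_class s -> ccvg (fun n => Tr (s \o u n)) (Tr (s \o A)).

End Operators.

Section ComplexIntegral.
Context d {T : measurableType d} {R : realType}.
Implicit Types (mu : set T -> \bar R) (E : set T) (g : T -> R[i]).

Definition cintegrable mu E g :=
  mu.-integrable E (fun x => (complex.Re (g x))%:E) /\
  mu.-integrable E (fun x => (complex.Im (g x))%:E).

Definition cintegral mu E g : R[i] :=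
  fine (\int[mu]_(x in E) (complex.Re (g x))%:E)%E +i*
  fine (\int[mu]_(x in E) (complex.Im (g x))%:E)%E.

End ComplexIntegral.

(* X with its Borel sigma-algebra *)
Definition borel (X : ptopologicalType) := g_sigma_algebraType (@open X).
HB.instance Definition _ (X : ptopologicalType) := Measurable.on (borel X).

Section QuantumIntegral.
Context {R : realType} {H : hilbertType R} {X : ptopologicalType}.
Implicit Types (nu : set (borel X) -> H -> H) (rho s : H -> H).
Implicit Types (D f g : borel X -> H -> H) (I : set nat) (e : nat -> H).

Definition POVM nu :=
  (forall E, measurable E -> positive (nu E)) /\
  forall F : nat -> set (borel X), (forall n, measurable (F n)) ->
    trivIset setT F ->
    ultraweak_cvg (fun n => \sum_(k < n) nu (F k)) (nu (\bigcup_k F k)).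

(* Tr (rho nu(E)) is real and nonnegative for a state rho and a POVM nu. *)
Definition nu_ nu rho (E : set (borel X)) : \bar R :=
  (complex.Re (Tr (rho \o nu E)))%:E.

(* D is (a representative of) the Radon-Nikodym derivative d nu / d nu_rho *)
Definition RN_derivative nu rho I e D :=
  (forall x, bounded_operator (D x)) /\
  forall i j, I i -> I j ->
    let Dij x := '[D x (e j), e i] in
    cintegrable (nu_ nu rho) setT Dij /\
    forall E, measurable E ->
      '[nu E (e j), e i] = cintegral (nu_ nu rho) E Dij.

Definition quantum_random_variable f :=
  (forall x, bounded_operator (f x)) /\
  forall s, state s ->
    measurable_fun setT (fun x => complex.Re (Tr (s \o f x))) /\
    measurable_fun setT (fun x => complex.Im (Tr (s \o f x))).

(* f_s; where D x is not positive (a nu_rho-null set) opsqrt (D x), hence the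
   value, is 0 *)
Definition weighted D f s (x : borel X) : R[i] :=
  Tr (s \o (opsqrt (D x) \o f x \o opsqrt (D x))).

Definition pos_nu_integrable nu rho D g :=
  forall s, state s -> cintegrable (nu_ nu rho) setT (weighted D g s).

Definition nu_integrable nu rho D f :=
  [/\ pos_nu_integrable nu rho D (fun x => pos_part (Reop (f x))),
      pos_nu_integrable nu rho D (fun x => neg_part (Reop (f x))),
      pos_nu_integrable nu rho D (fun x => pos_part (Imop (f x))) &
      pos_nu_integrable nu rho D (fun x => neg_part (Imop (f x)))].

(* A = sum_ij (int f_(s_ij) d nu_rho) (x) e_ij, where s_ij = e_ji *)
Definition integral_matrix nu rho D I e f : set (H -> H) :=
  [set A | bounded_operator A /\ forall i j, I i -> I j ->
    '[A (e j), e i] =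
      cintegral (nu_ nu rho) setT (weighted D f (rank_one (e j) (e i)))].

Definition qintegral nu rho D I e f : H -> H :=
  xget (cst 0) (integral_matrix nu rho D I e f).

End QuantumIntegral.

(* Main.v *)
Require Import Defs.
From HB Require Import structures.
From mathcomp Require Import all_boot all_order all_algebra.
From mathcomp Require Import sesquilinear complex.
From mathcomp Require Import all_classical all_reals all_analysis.
From mathcomp Require Import measurable_realfun.
From mathcomp Require Import ring lra.
Set Implicit Arguments.
Unset Strict Implicit.
Unset Printing Implicit Defensive.
Import Order.TTheory GRing.Theory Num.Theory.
Import numFieldNormedType.Exports.
Local Open Scope classical_set_scope.
Local Open Scope complex_scope.
Local Open Scope ring_scope.

(** The four positive and negative parts p of f are treated one at a time. For a
    positive operator function G = D^(1/2) p D^(1/2) such that Tr (s G) is integrable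
    for every state s, the form B(u, v) = int <G u, v> is well defined, since
    rank-one operators are combinations of multiples of states. It is bounded: if
    there were unit vectors w_n with B(w_n, w_n) > n 2^(n+1), the integral of Tr (s G)
    for s = sum_n 2^-(n+1) |w_n><w_n| would exceed every n (int_form_bounded). The
    Riesz representation then gives an operator Q with <Q u, v> = B(u, v). A positive
    trace class operator has the form s = c^* c with c Hilbert-Schmidt, and
    Tr (s A) = sum_k <A c^* b_k, c^* b_k> for any basis b; exchanging this sum of
    nonnegative terms with the integral gives Tr (s Q) = int Tr (s G), and every trace
    class operator is a combination of four positive ones (positive_integral).
    Since Tr (e_ji A) = <A e_j, e_i>, an operator with the trace property has the
    matrix of the formula, and it is unique because a bounded operator is determined
    by its matrix.

    For a second full-rank state rho' and basis e', let m and m' be the measures nu_rho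
    and nu_rho'. As rho' is injective, m'-null sets are nu-null, so m << m'; let
    h = dm/dm'. The relation defining D extends from basis vectors to all
    pairs of vectors: by Fatou the defect <nu(E) u, u> - int_E <D u, u> is a positive
    form, it is dominated by the form of nu(E) and vanishes on finite combinations of
    basis vectors, hence vanishes by Cauchy-Schwarz (RN_extension). So h D is a
    derivative with respect to rho' and e', and every derivative D' is equal to it
    almost everywhere (RN_chain). Then D'^(1/2) f D'^(1/2) = h D^(1/2) f D^(1/2) almost
    everywhere, and the integrals of Tr (s .) against m' and m agree
    (weighted_change). The trace property thus holds for rho', D', e' with the same
    operator. Measurability of D'^(1/2) f D'^(1/2), needed to pass from almost
    everywhere equality to equality of integrals, follows because the square root of a
    positive operator is a limit of polynomials in it (wmeas_opsqrt).

    The operator theory that supports this is developed from the definitions: square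
    roots by the iteration Y := (B + Y^2) / 2, dominated by the same iteration on
    scalars (sqrt_exists, sqrt_unique), positivity of (|h| + h) / 2 (pos_part_positive), and the
    factorisation s = V |s|^(1/2) of a trace class operator into Hilbert-Schmidt
    factors (polar_factor, tc_factor), on which traces rest. *)

(** * Complex numbers and inner products *)

Section ComplexModulus.
Context {R : realType}.
Implicit Types z w : R[i].

(** The modulus as an element of R; `|z| itself lives in R[i]. *)
Definition cmod z : R := complex.Re `|z|.

Lemma cmodE z : `|z| = (cmod z)%:C.
Proof. by rewrite /cmod normc_def. Qed.

Lemma cmod_ge0 z : 0 <= cmod z.
Proof. by rewrite -lecR -cmodE normr_ge0. Qed.

Lemma sqr_cmod z : cmod z ^+ 2 = complex.Re z ^+ 2 + complex.Im z ^+ 2.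
Proof. by rewrite /cmod normc_def /= sqr_sqrtr// addr_ge0// sqr_ge0. Qed.

Lemma cmodM z w : cmod (z * w) = cmod z * cmod w.
Proof. by apply: complexI; rewrite rmorphM -!cmodE normrM. Qed.

Lemma cmodD z w : cmod (z + w) <= cmod z + cmod w.
Proof. by rewrite -lecR rmorphD -!cmodE ler_normD. Qed.

Lemma cmodN z : cmod (- z) = cmod z.
Proof. by apply: complexI; rewrite -!cmodE normrN. Qed.

Lemma cmodJ z : cmod z^* = cmod z.
Proof. by apply: complexI; rewrite -!cmodE normcJ. Qed.

Lemma cmod1 : cmod 1 = 1.
Proof. by apply: complexI; rewrite -!cmodE normr1. Qed.

Lemma cmod_real (r : R) : 0 <= r -> cmod r%:C = r.
Proof. by move=> r0; rewrite /cmod ger0_norm// lecR. Qed.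

Lemma cmod_eq0 z : cmod z = 0 -> z = 0.
Proof. by move=> z0; apply/eqP; rewrite -normr_eq0 cmodE z0. Qed.

Lemma Re_le_cmod z : `|complex.Re z| <= cmod z.
Proof. by rewrite -lecR -cmodE normc_ge_Re. Qed.

Lemma ImRe z : complex.Im z = complex.Re (z * (- 'i)).
Proof. by case: z => a b /=; ring. Qed.

Lemma Im_le_cmod z : `|complex.Im z| <= cmod z.
Proof.
rewrite ImRe (le_trans (Re_le_cmod _))// cmodM cmodN.
by rewrite [cmod 'i]/cmod normc_def /= expr0n /= add0r expr1n sqrtr1 mulr1.
Qed.

Lemma cmod_le z : cmod z <= `|complex.Re z| + `|complex.Im z|.
Proof.
rewrite -(@ler_pXn2r _ 2)// ?nnegrE ?cmod_ge0 ?addr_ge0//.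
by rewrite sqr_cmod sqrrD !real_normK ?num_real// addrAC lerDl mulrn_wge0// mulr_ge0.
Qed.

Lemma cReD z w : complex.Re (z + w) = complex.Re z + complex.Re w.
Proof. by case: z w => a b []. Qed.
Lemma cImD z w : complex.Im (z + w) = complex.Im z + complex.Im w.
Proof. by case: z w => a b []. Qed.
Lemma cReN z : complex.Re (- z) = - complex.Re z. Proof. by case: z. Qed.
Lemma cImN z : complex.Im (- z) = - complex.Im z. Proof. by case: z. Qed.
Lemma cReJ z : complex.Re z^* = complex.Re z. Proof. by case: z. Qed.
Lemma cImJ z : complex.Im z^* = - complex.Im z. Proof. by case: z. Qed.
Lemma cReM z w : complex.Re (z * w) =
  complex.Re z * complex.Re w - complex.Im z * complex.Im w.
Proof. by case: z w => a b []. Qed.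
Lemma cImM z w : complex.Im (z * w) =
  complex.Re z * complex.Im w + complex.Im z * complex.Re w.
Proof. by case: z w => a b []. Qed.
Lemma cReZ (r : R) z : complex.Re (r%:C * z) = r * complex.Re z.
Proof. by rewrite cReM /= mul0r subr0. Qed.
Lemma cImZ (r : R) z : complex.Im (r%:C * z) = r * complex.Im z.
Proof. by rewrite cImM /= mul0r addr0. Qed.

Lemma complex_eq z w : complex.Re z = complex.Re w ->
  complex.Im z = complex.Im w -> z = w.
Proof. by case: z w => a b [c d] /= <- <-. Qed.

Lemma mulcJ z : z * z^* = (cmod z ^+ 2)%:C.
Proof. by rewrite -sqr_normc cmodE rmorphXn. Qed.

Lemma ge0_ReE z : 0 <= z -> z = (complex.Re z)%:C.
Proof. by move=> /ger0_Im z0; apply: complex_eq. Qed.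

Lemma ge0_complexP z : (0 <= z) <-> complex.Im z = 0 /\ 0 <= complex.Re z.
Proof.
rewrite lecE /=; split; first by move=> /andP[/eqP].
by case=> -> ->; rewrite eqxx.
Qed.

End ComplexModulus.

Section InnerProduct.
Context {R : realType} {H : hilbertType R}.
Implicit Types x y u v : H.

Lemma ipDl x y v : '[x + y, v] = '[x, v] + '[y, v].
Proof. by rewrite linearDl. Qed.
Lemma ipDr x y v : '[v, x + y] = '[v, x] + '[v, y].
Proof. by rewrite linearDr. Qed.
Lemma ipBl x y v : '[x - y, v] = '[x, v] - '[y, v].
Proof. by rewrite linearBl. Qed.
Lemma ipBr x y v : '[v, x - y] = '[v, x] - '[v, y].
Proof. by rewrite linearBr. Qed.
Lemma ipNl x v : '[- x, v] = - '[x, v].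
Proof. by rewrite linearNl. Qed.
Lemma ipNr x v : '[v, - x] = - '[v, x].
Proof. by rewrite linearNr. Qed.
Lemma ip0l v : '[0, v] = 0 :> R[i].
Proof. by rewrite linear0l. Qed.
Lemma ip0r v : '[v, 0] = 0 :> R[i].
Proof. by rewrite linear0r. Qed.
Lemma ipZl a x v : '[a *: x, v] = a * '[x, v].
Proof. by rewrite linearZl_LR. Qed.
Lemma ipZr a x v : '[v, a *: x] = a^* * '[v, x].
Proof. by rewrite linearZr_LR. Qed.
Lemma ipC x y : '[x, y] = '[y, x]^*.
Proof. by rewrite hermC /= expr0 mul1r. Qed.

Lemma ip_suml (J : Type) (r : seq J) (P : pred J) (F : J -> H) v :
  '[\sum_(j <- r | P j) F j, v] = \sum_(j <- r | P j) '[F j, v].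
Proof. by rewrite (big_morph (fun x => '[x, v]) (fun x y => ipDl x y v) (ip0l v)). Qed.
Lemma ip_sumr (J : Type) (r : seq J) (P : pred J) (F : J -> H) v :
  '[v, \sum_(j <- r | P j) F j] = \sum_(j <- r | P j) '[v, F j].
Proof. by rewrite (big_morph (fun x => '[v, x]) (fun x y => ipDr x y v) (ip0r v)). Qed.

(** `|x| lives in R[i]; all estimates are run in R. *)
Definition hnm x : R := complex.Re `|x|.

Lemma hnmE x : `|x| = (hnm x)%:C.
Proof. by rewrite /hnm; apply: ge0_ReE. Qed.

Lemma hnm_ge0 x : 0 <= hnm x.
Proof. by rewrite -lecR -hnmE normr_ge0. Qed.

Lemma hnm0 : hnm 0 = 0.
Proof. by apply: complexI; rewrite -hnmE normr0. Qed.

Lemma hnm_eq0 x : hnm x = 0 -> x = 0.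
Proof. by move=> x0; apply/eqP; rewrite -normr_eq0 hnmE x0. Qed.

Lemma hnmD x y : hnm (x + y) <= hnm x + hnm y.
Proof. by rewrite -lecR rmorphD /= -!hnmE ler_normD. Qed.

Lemma hnmB x y : hnm (x - y) <= hnm x + hnm y.
Proof. by rewrite -lecR rmorphD /= -!hnmE ler_normB. Qed.

Lemma hnmN x : hnm (- x) = hnm x.
Proof. by rewrite /hnm normrN. Qed.

Lemma hnm_distC x y : hnm (x - y) = hnm (y - x).
Proof. by rewrite -hnmN opprB. Qed.

Lemma hnmZ a x : hnm (a *: x) = cmod a * hnm x.
Proof. by apply: complexI; rewrite rmorphM /= -hnmE -cmodE -hnmE normrZ. Qed.

Lemma hnm_sum n (F : nat -> H) :
  hnm (\sum_(k < n) F k) <= \sum_(k < n) hnm (F k).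
Proof.
elim: n => [|n IH]; first by rewrite !big_ord0 hnm0.
by rewrite !big_ord_recr /= (le_trans (hnmD _ _))// lerD2r.
Qed.

Lemma ipxx x : '[x, x] = (hnm x ^+ 2)%:C.
Proof. by rewrite inner_norm hnmE rmorphXn. Qed.

Lemma Re_ipxx x : complex.Re '[x, x] = hnm x ^+ 2.
Proof. by rewrite ipxx. Qed.

Lemma ip_ext x y : (forall v, '[x, v] = '[y, v]) -> x = y.
Proof.
move=> xy; apply/eqP; rewrite -subr_eq0; apply/eqP/hnm_eq0/eqP.
by rewrite -sqrf_eq0 -Re_ipxx ipBl xy subrr.
Qed.

(** Positive sesquilinear forms: besides the inner product, the forms
    x y |-> <P x, y> for a positive operator P and their integrals. *)
Definition pos_form (B : H -> H -> R[i]) :=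
  [/\ forall a x y z, B (a *: x + y) z = a * B x z + B y z,
      forall a x y z, B z (a *: x + y) = a^* * B z x + B z y &
      forall x, 0 <= B x x].

Section PosForm.
Variable B : H -> H -> R[i].
Hypothesis Bpos : pos_form B.

Lemma pos_formDl x y z : B (x + y) z = B x z + B y z.
Proof. by case: Bpos => /(_ 1 x y z); rewrite scale1r mul1r. Qed.
Lemma pos_formDr x y z : B z (x + y) = B z x + B z y.
Proof. by case: Bpos => _ /(_ 1 x y z); rewrite scale1r conjC1 mul1r. Qed.
Lemma pos_form0l z : B 0 z = 0.
Proof. by have /eqP := pos_formDl 0 0 z; rewrite addr0 -subr_eq subrr eq_sym => /eqP. Qed.
Lemma pos_form0r z : B z 0 = 0.
Proof. by have /eqP := pos_formDr 0 0 z; rewrite addr0 -subr_eq subrr eq_sym => /eqP. Qed.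
Lemma pos_formZl a x z : B (a *: x) z = a * B x z.
Proof. by case: Bpos => /(_ a x 0 z); rewrite !addr0 pos_form0l addr0. Qed.
Lemma pos_formZr a x z : B z (a *: x) = a^* * B z x.
Proof. by case: Bpos => _ /(_ a x 0 z); rewrite !addr0 pos_form0r addr0. Qed.
Lemma pos_form_ge0 x : 0 <= B x x. Proof. by case: Bpos. Qed.

Lemma pos_formC x y : B x y = (B y x)^*.
Proof.
have := pos_form_ge0 (x + y); have := pos_form_ge0 (x + 'i *: y).
rewrite !(pos_formDl, pos_formDr) !(pos_formZl, pos_formZr).
move: (pos_form_ge0 x) (pos_form_ge0 y).
move=> /ge0_complexP[x1 x2] /ge0_complexP[y1 y2] /ge0_complexP[+ _] /ge0_complexP[+ _].
rewrite !(cReD, cImD, cReM, cImM, cReJ, cImJ, cReN, cImN) /= x1 y1 => h1 h2.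
by apply: complex_eq; rewrite ?cReJ ?cImJ; lra.
Qed.

Lemma pos_form_CS x y :
  cmod (B x y) ^+ 2 <= complex.Re (B x x) * complex.Re (B y y).
Proof.
pose z := B x y; set a := complex.Re (B x x); set b := complex.Re (B y y).
pose m := cmod z ^+ 2.
have q (t : R) : 0 <= a - 2 * t * m + t ^+ 2 * m * b.
  have /ge0_complexP[_] := pos_form_ge0 (x + (- t%:C * z) *: y).
  rewrite !(pos_formDl, pos_formDr) !(pos_formZl, pos_formZr).
  rewrite (pos_formC y x) -/z (ge0_ReE (pos_form_ge0 x)) (ge0_ReE (pos_form_ge0 y)).
  rewrite -/a -/b /m sqr_cmod; congr (0 <= _).
  by case: (z) => z1 z2 /=; ring.
have b0 : 0 <= b by have /ge0_complexP[] := pos_form_ge0 y.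
have m0 : 0 <= m by exact: sqr_ge0.
rewrite -/z -/m; have [b_eq0|bn0] := eqVneq b 0.
  rewrite b_eq0 mulr0 leNgt; apply/negP => mgt0.
  have := q ((a + 1) / (2 * m)); rewrite b_eq0.
  have -> : 2 * ((a + 1) / (2 * m)) * m = a + 1 by field; rewrite gt_eqF.
  by rewrite mulr0; lra.
have bgt0 : 0 < b by rewrite lt_def bn0.
have := q b^-1.
have -> : a - 2 * b^-1 * m + b^-1 ^+ 2 * m * b = a - m / b by field.
by rewrite subr_ge0 ler_pdivrMr.
Qed.

End PosForm.

Lemma ip_pos_form : pos_form (fun x y => '[x, y]).
Proof.
split=> [a x y z|a x y z|x]; first by rewrite ipDl ipZl.
  by rewrite ipDr ipZr.
by rewrite ipxx lecR sqr_ge0.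
Qed.

Lemma ip_CS x y : cmod '[x, y] <= hnm x * hnm y.
Proof.
rewrite -(@ler_pXn2r _ 2)// ?nnegrE ?mulr_ge0 ?cmod_ge0 ?hnm_ge0//.
by rewrite exprMn -!Re_ipxx; exact: pos_form_CS ip_pos_form x y.
Qed.

Lemma hnmD_sqr x y :
  hnm (x + y) ^+ 2 = hnm x ^+ 2 + hnm y ^+ 2 + 2 * complex.Re '[x, y].
Proof.
rewrite -!Re_ipxx ipDl !ipDr [in X in _ + X](ipC y x) !cReD cReJ; ring.
Qed.

End InnerProduct.

(** * Convergence *)

Section Convergence.
Context {R : realType}.

Lemma null_le (u v : nat -> R) : (forall n, 0 <= u n <= v n) ->
  v @ \oo --> (0 : R) -> u @ \oo --> (0 : R).
Proof.
move=> uv v0; apply: (squeeze_cvgr _ (cvg_cst 0) v0).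
by apply: nearW => n; exact: uv.
Qed.

Lemma nullD (u v : nat -> R) : u @ \oo --> (0 : R) -> v @ \oo --> (0 : R) ->
  (fun n => u n + v n) @ \oo --> (0 : R).
Proof. by move=> a b; rewrite -[0]addr0; exact: cvgD. Qed.

Lemma nullZ (c : R) (u : nat -> R) : u @ \oo --> (0 : R) ->
  (fun n => c * u n) @ \oo --> (0 : R).
Proof. by move=> a; rewrite -[0](mulr0 c); apply: cvgM => //; exact: cvg_cst. Qed.

Lemma rcvgD (u v : nat -> R) (l m : R) : u @ \oo --> l -> v @ \oo --> m ->
  (fun n => u n + v n) @ \oo --> l + m.
Proof. by move=> a b; exact: cvgD. Qed.

Lemma rcvgB (u v : nat -> R) (l m : R) : u @ \oo --> l -> v @ \oo --> m ->
  (fun n => u n - v n) @ \oo --> l - m.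
Proof. by move=> a b; exact: cvgB. Qed.

Lemma rcvgZ (c : R) (u : nat -> R) (l : R) : u @ \oo --> l ->
  (fun n => c * u n) @ \oo --> c * l.
Proof. by move=> a; apply: cvgM a; exact: cvg_cst. Qed.

Lemma rcvg_cst (l : R) : (fun _ : nat => l) @ \oo --> l.
Proof. exact: cvg_cst. Qed.

Lemma rcvg_le (u v : nat -> R) (l m : R) : (forall n, u n <= v n) ->
  u @ \oo --> l -> v @ \oo --> m -> l <= m.
Proof. by move=> uv a b; apply: ler_cvg_to a b _; exact: nearW. Qed.

Lemma eq_rcvg (u v : nat -> R) (l : R) : (forall n, u n = v n) ->
  u @ \oo --> l -> v @ \oo --> l.
Proof. by move=> /funext ->. Qed.

Lemma null_leP (u : nat -> R) : (forall n, 0 <= u n) ->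
  u @ \oo --> (0 : R) <->
  forall e : R, 0 < e -> exists N, forall n, (N <= n)%N -> u n < e.
Proof.
move=> u0; split=> [/cvgrPdist_lt h e e0|h].
  have [N _ hN] := h _ e0; exists N => n Nn.
  by have := hN n Nn; rewrite /= sub0r normrN ger0_norm.
apply/cvgrPdist_lt => e e0; have [N hN] := h _ e0; exists N => // n /= Nn.
by rewrite sub0r normrN ger0_norm// hN.
Qed.

Lemma cvg_complexE (V : normedModType R[i]) (u : nat -> V) (l : V) :
  u @ \oo --> l <-> (fun n => complex.Re `|u n - l|) @ \oo --> (0 : R).
Proof.
have nE (x : V) : `|x| = (complex.Re `|x|)%:C by apply: ge0_ReE.
rewrite null_leP; last by move=> n; rewrite -lecR -nE normr_ge0.
split=> [/cvgrPdist_lt h e e0|h].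
  have [|N _ hN] := h e%:C; first by rewrite ltcR.
  by exists N => n Nn; have := hN n Nn; rewrite /= distrC nE ltcR.
apply/cvgrPdist_lt => e e0.
have eE : e = (complex.Re e)%:C by apply: ge0_ReE; exact: ltW.
have [|N hN] := h (complex.Re e); first by rewrite -ltcR -eE.
by exists N => // n /= Nn; rewrite distrC nE eE ltcR hN.
Qed.

Lemma ccvgP (u : nat -> R[i]) l :
  ccvg u l <-> (fun n => cmod (u n - l)) @ \oo --> (0 : R).
Proof. exact: cvg_complexE. Qed.

Lemma null_sub_cvg (u : nat -> R) (l : R) :
  (fun n => `|u n - l|) @ \oo --> (0 : R) -> u @ \oo --> l.
Proof.
by move=> h; apply/subr_cvg0; apply/norm_cvg0P.
Qed.

Lemma cvg_sub_null (u : nat -> R) (l : R) :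
  u @ \oo --> l -> (fun n => `|u n - l|) @ \oo --> (0 : R).
Proof.
by move=> h; apply/norm_cvg0P; apply/subr_cvg0.
Qed.

Lemma ccvg_ReIm (u : nat -> R[i]) l : ccvg u l <->
  (fun n => complex.Re (u n)) @ \oo --> complex.Re l /\
  (fun n => complex.Im (u n)) @ \oo --> complex.Im l.
Proof.
rewrite ccvgP; split=> [h|[hR hI]].
  split; apply: null_sub_cvg; apply: null_le h => n.
    by rewrite normr_ge0 -cReN -cReD Re_le_cmod.
  by rewrite normr_ge0 -cImN -cImD Im_le_cmod.
apply: null_le (nullD (cvg_sub_null hR) (cvg_sub_null hI)) => n; rewrite cmod_ge0 /= (le_trans (cmod_le _))//.
by rewrite cReD cReN cImD cImN.
Qed.

Lemma ccvg_unique (u : nat -> R[i]) l l' : ccvg u l -> ccvg u l' -> l = l'.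
Proof.
move=> /ccvg_ReIm[a b] /ccvg_ReIm[a' b'].
by apply: complex_eq; [exact: cvg_unique a a'|exact: cvg_unique b b'].
Qed.

Lemma ccvg_cst (l : R[i]) : ccvg (fun=> l) l.
Proof. by apply/ccvg_ReIm; split; exact: cvg_cst. Qed.

Lemma ccvgD (u v : nat -> R[i]) l m :
  ccvg u l -> ccvg v m -> ccvg (fun n => u n + v n) (l + m).
Proof.
move=> /ccvg_ReIm[a b] /ccvg_ReIm[a' b']; apply/ccvg_ReIm.
rewrite cReD cImD; split.
  by under eq_fun do rewrite cReD; exact: cvgD.
by under eq_fun do rewrite cImD; exact: cvgD.
Qed.

Lemma ccvgM (u v : nat -> R[i]) l m :
  ccvg u l -> ccvg v m -> ccvg (fun n => u n * v n) (l * m).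
Proof.
move=> /ccvg_ReIm[a b] /ccvg_ReIm[a' b']; apply/ccvg_ReIm.
rewrite cReM cImM; split.
  by under eq_fun do rewrite cReM; apply: cvgB; exact: cvgM.
by under eq_fun do rewrite cImM; apply: cvgD; exact: cvgM.
Qed.

Lemma ccvgZ a (u : nat -> R[i]) l :
  ccvg u l -> ccvg (fun n => a * u n) (a * l).
Proof. by apply: ccvgM; exact: ccvg_cst. Qed.

Context {H : hilbertType R}.
Implicit Types (x y l : H).

Definition hcvg (u : nat -> H) l := (fun n => hnm (u n - l)) @ \oo --> (0 : R).

Lemma hcvgP (u : nat -> H) l : u @ \oo --> l <-> hcvg u l.
Proof. exact: cvg_complexE. Qed.

Lemma hcvg_cst l : hcvg (fun=> l) l.
Proof. by rewrite /hcvg subrr hnm0; exact: cvg_cst. Qed.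

Lemma hcvgD (u v : nat -> H) l m :
  hcvg u l -> hcvg v m -> hcvg (fun n => u n + v n) (l + m).
Proof.
move=> a b; apply: null_le (nullD a b) => n.
by rewrite hnm_ge0 opprD addrACA hnmD.
Qed.

Lemma hcvgZ a (u : nat -> H) l :
  hcvg u l -> hcvg (fun n => a *: u n) (a *: l).
Proof.
move=> h; apply: null_le (nullZ (cmod a) h) => n.
by rewrite hnm_ge0 -scalerBr hnmZ /=.
Qed.

Lemma hcvgN (u : nat -> H) l : hcvg u l -> hcvg (fun n => - u n) (- l).
Proof.
by move=> h; have := @hcvgZ (-1) _ _ h; rewrite scaleN1r; under eq_fun do rewrite scaleN1r.
Qed.

Lemma hcvgB (u v : nat -> H) l m :
  hcvg u l -> hcvg v m -> hcvg (fun n => u n - v n) (l - m).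
Proof. by move=> a /hcvgN; exact: hcvgD. Qed.

Lemma hcvg_hnm (u : nat -> H) l : hcvg u l ->
  (fun n => hnm (u n)) @ \oo --> hnm l.
Proof.
move=> h; apply: null_sub_cvg; apply: null_le h => n.
rewrite normr_ge0 /= ler_norml lerBlDr.
have := hnmD (u n - l) l; rewrite subrK => ->; rewrite andbT.
have := hnmD (l - u n) (u n); rewrite subrK hnm_distC; lra.
Qed.

Lemma hcvg_le (u : nat -> H) l (M : R) :
  hcvg u l -> (forall n, hnm (u n) <= M) -> hnm l <= M.
Proof.
move=> /hcvg_hnm ul uM; rewrite -(cvg_lim _ ul)//; apply: limr_le.
  by apply/cvg_ex; eexists; exact: ul.
by apply: nearW => n; exact: uM.
Qed.

Lemma hcvg_unique (u : nat -> H) l m : hcvg u l -> hcvg u m -> l = m.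
Proof.
move=> a b; apply/eqP; rewrite -subr_eq0; apply/eqP/hnm_eq0.
have := hcvg_hnm (hcvgB a b); under eq_fun do rewrite subrr hnm0.
by move=> c; apply: (cvg_unique _ c (cvg_cst 0)).
Qed.

Lemma ip_cvg (u v : nat -> H) x y :
  hcvg u x -> hcvg v y -> ccvg (fun n => '[u n, v n]) '[x, y].
Proof.
move=> a b; apply/ccvgP.
have ab : (fun n => hnm (u n - x) * hnm (v n)) @ \oo --> (0 : R).
  by rewrite -[0](mul0r (hnm y)); apply: cvgM a _; exact: hcvg_hnm.
apply: null_le (nullD ab (nullZ (hnm x) b)) => n; rewrite cmod_ge0 /=.
have -> : '[u n, v n] - '[x, y] = '[u n - x, v n] + '[x, v n - y].
  by rewrite ipBl ipBr addrA subrK.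
by rewrite (le_trans (cmodD _ _))// lerD// ip_CS.
Qed.

Lemma hcvg_cauchy (u : nat -> H) :
  (forall e : R, 0 < e -> exists N, forall m n, (N <= m)%N -> (N <= n)%N ->
    hnm (u n - u m) < e) -> exists l, hcvg u l.
Proof.
move=> h; suff /cauchy_cvgP/cvg_ex[l /hcvgP ul] : cauchy (u @ \oo) by exists l.
apply/cauchyP => e e0.
have eE : e = (complex.Re e)%:C by apply: ge0_ReE; exact: ltW.
have [|N hN] := h (complex.Re e); first by rewrite -ltcR -eE.
exists (u N), N => // n /= Nn.
by rewrite -ball_normE /= hnmE eE ltcR hN.
Qed.

End Convergence.

Arguments rcvg_cst {R} l.
Arguments rcvgZ {R} c {u l} _.
Arguments ccvgZ {R} a {u l} _.
Arguments hcvgZ {R H} a {u l} _.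
Arguments nullZ {R} c {u} _.

(** * Bounded operators *)

Section BoundedOperators.
Context {R : realType} {H : hilbertType R}.
Implicit Types (A B C : H -> H) (x y : H).

Lemma addopE A B x : (A + B) x = A x + B x. Proof. by []. Qed.
Lemma subopE A B x : (A - B) x = A x - B x. Proof. by []. Qed.
Lemma scaleopE a A x : (a *: A) x = a *: A x. Proof. by []. Qed.

Definition opbound (M : R) A := forall x, hnm (A x) <= M * hnm x.

Lemma bopP A : bounded_operator A <->
  linear A /\ exists2 M : R, 0 <= M & opbound M A.
Proof.
split=> [[lA [M hM]]|[lA [M M0 hM]]]; split=> //; last first.
  by exists M%:C => x; rewrite !hnmE -rmorphM lecR.
exists (cmod M) => [|x]; first exact: cmod_ge0.
have := hM x; rewrite !hnmE lecE cReM /= mulr0 subr0 => /andP[_].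
move=> /le_trans; apply; apply: ler_wpM2r; first exact: hnm_ge0.
by rewrite (le_trans (ler_norm _))// Re_le_cmod.
Qed.

Lemma bop_lin A : bounded_operator A -> linear A. Proof. by case. Qed.

Section Linear.
Variable A : H -> H.
Hypothesis lA : linear A.
Lemma opD x y : A (x + y) = A x + A y.
Proof. by have := lA 1 x y; rewrite !scale1r. Qed.
Lemma op0 : A 0 = 0.
Proof. by have /eqP := opD 0 0; rewrite addr0 -subr_eq subrr eq_sym => /eqP. Qed.
Lemma opZ a x : A (a *: x) = a *: A x.
Proof. by have := lA a x 0; rewrite !addr0 op0 addr0. Qed.
Lemma opN x : A (- x) = - A x.
Proof. by rewrite -scaleN1r opZ scaleN1r. Qed.
Lemma opB x y : A (x - y) = A x - A y.
Proof. by rewrite opD opN. Qed.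
Lemma op_sum (J : Type) (r : seq J) (P : pred J) (F : J -> H) :
  A (\sum_(j <- r | P j) F j) = \sum_(j <- r | P j) A (F j).
Proof. exact: (big_morph A opD op0). Qed.
End Linear.

Lemma opbound_le M N A : M <= N -> opbound M A -> opbound N A.
Proof.
by move=> MN hA x; rewrite (le_trans (hA x))// ler_wpM2r// hnm_ge0.
Qed.

Lemma opbound_comp M N A B : 0 <= M ->
  opbound M A -> opbound N B -> opbound (M * N) (A \o B).
Proof.
move=> M0 hA hB x /=; rewrite (le_trans (hA _))// -mulrA.
by rewrite ler_wpM2l.
Qed.

Lemma opboundD M N A B : opbound M A -> opbound N B -> opbound (M + N) (A + B).
Proof.
by move=> hA hB x; rewrite (le_trans (hnmD _ _))// mulrDl lerD.
Qed.

Lemma opboundZ M a A : opbound M A -> opbound (cmod a * M) (a *: A).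
Proof.
by move=> hA x; rewrite hnmZ -mulrA ler_wpM2l// cmod_ge0.
Qed.

Lemma bop0 : bounded_operator (0 : H -> H).
Proof.
apply/bopP; split=> [a x y|]; first by rewrite scaler0 addr0.
by exists 0 => // x; rewrite mul0r hnm0.
Qed.

Lemma bop_id : bounded_operator (@id H).
Proof. by apply/bopP; split=> //; exists 1 => // x; rewrite mul1r. Qed.

Lemma bopD A B : bounded_operator A -> bounded_operator B ->
  bounded_operator (A + B).
Proof.
move=> /bopP[lA [M M0 hA]] /bopP[lB [N N0 hB]]; apply/bopP; split.
  by move=> a x y; rewrite !addopE lA lB scalerDr addrACA.
by exists (M + N); [exact: addr_ge0|exact: opboundD].
Qed.

Lemma bopZ a A : bounded_operator A -> bounded_operator (a *: A).
Proof.
move=> /bopP[lA [M M0 hA]]; apply/bopP; split.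
  by move=> b x y; rewrite !scaleopE lA scalerDr !scalerA mulrC.
by exists (cmod a * M); [exact: mulr_ge0 (cmod_ge0 _) _|exact: opboundZ].
Qed.

Lemma bopN A : bounded_operator A -> bounded_operator (- A).
Proof. by rewrite -scaleN1r; exact: bopZ. Qed.

Lemma bopB A B : bounded_operator A -> bounded_operator B ->
  bounded_operator (A - B).
Proof. by move=> hA /bopN; exact: bopD. Qed.

Lemma bop_comp A B : bounded_operator A -> bounded_operator B ->
  bounded_operator (A \o B).
Proof.
move=> /bopP[lA [M M0 hA]] /bopP[lB [N N0 hB]]; apply/bopP; split.
  by move=> a x y /=; rewrite lB lA.
by exists (M * N); [exact: mulr_ge0|exact: opbound_comp].
Qed.

Lemma bop_sum n (F : nat -> H -> H) : (forall k, bounded_operator (F k)) ->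
  bounded_operator (\sum_(k < n) F k).
Proof.
move=> hF; elim: n => [|n IH]; first by rewrite big_ord0; exact: bop0.
by rewrite big_ord_recr /=; exact: bopD.
Qed.

Lemma op_cvg A (u : nat -> H) l : bounded_operator A -> hcvg u l ->
  hcvg (fun n => A (u n)) (A l).
Proof.
move=> /bopP[lA [M M0 hA]] h; apply: null_le (nullZ M h) => n.
by rewrite hnm_ge0 -opB//=.
Qed.

(** Square roots, polar factors and the dyadic operator below are all built as
    limits of explicit uniformly bounded sequences. *)
Lemma op_limit (A : nat -> H -> H) (M : R) : 0 <= M ->
  (forall n, linear (A n)) -> (forall n, opbound M (A n)) ->
  (forall x, exists l, hcvg (fun n => A n x) l) ->
  exists B, [/\ bounded_operator B, opbound M B &
    forall x, hcvg (fun n => A n x) (B x)].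
Proof.
move=> M0 lA hA /choice[B hB]; exists B.
have bB : opbound M B.
  by move=> x; apply: hcvg_le (hB x) _ => n; exact: hA.
split=> //; apply/bopP; split; last by exists M.
move=> a x y; apply: (hcvg_unique (hB _)).
under eq_fun do rewrite lA.
by apply: hcvgD; [apply: hcvgZ|]; exact: hB.
Qed.

Definition selfadj A := forall x y, '[A x, y] = '[x, A y].

Lemma positive_bop A : positive A -> bounded_operator A.
Proof. by case. Qed.

Lemma positive_form A : positive A -> pos_form (fun x y => '[A x, y]).
Proof.
move=> [[lA _] pA]; split=> [a x y z|a x y z|//].
  by rewrite lA ipDl ipZl.
by rewrite ipDr ipZr.
Qed.

Lemma positive_selfadj A : positive A -> selfadj A.
Proof.
by move=> /positive_form pA x y; rewrite (pos_formC pA) [RHS]ipC.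
Qed.

Lemma selfadj_real A x : selfadj A -> complex.Im '[A x, x] = 0.
Proof.
move=> sA; have : '[A x, x] = '[A x, x]^* by rewrite {1}sA ipC.
by case: '[A x, x] => a b [] /=; lra.
Qed.

Lemma positive_ge0 A x : positive A -> 0 <= complex.Re '[A x, x].
Proof. by case=> _ /(_ x) /ge0_complexP[]. Qed.

Lemma selfadj_positive A : bounded_operator A -> selfadj A ->
  (forall x, 0 <= complex.Re '[A x, x]) -> positive A.
Proof.
by move=> bA sA pA; split=> // x; apply/ge0_complexP; rewrite selfadj_real.
Qed.

Lemma positive_sqr_le A M x : positive A -> 0 <= M -> opbound M A ->
  hnm (A x) ^+ 2 <= M * complex.Re '[A x, x].
Proof.
move=> pA M0 hA; have := pos_form_CS (positive_form pA) x (A x).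
rewrite ipxx cmod_real ?sqr_ge0//.
set a := hnm (A x); set q := complex.Re '[A x, x] => h.
have a0 : 0 <= a := hnm_ge0 _; have q0 : 0 <= q := positive_ge0 x pA.
have h1 : complex.Re '[A (A x), A x] <= M * a ^+ 2.
  rewrite (le_trans (ler_norm _))// (le_trans (Re_le_cmod _))//.
  rewrite (le_trans (ip_CS _ _))// expr2 mulrA.
  by apply: ler_wpM2r; [exact: hnm_ge0|exact: hA].
have {}h : (a ^+ 2) ^+ 2 <= q * (M * a ^+ 2).
  by rewrite (le_trans h)// ler_wpM2l.
have [a_eq0|an0] := eqVneq a 0; first by rewrite a_eq0 expr0n mulr_ge0.
have a2 : 0 < a ^+ 2 by rewrite exprn_gt0// lt_def an0.
by rewrite -(ler_pM2r a2); nra.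
Qed.

Lemma positive_eq0 A x : positive A -> complex.Re '[A x, x] = 0 -> A x = 0.
Proof.
move=> pA x0; have /bopP[_ [M M0 hM]] := positive_bop pA.
apply: hnm_eq0; apply/eqP; rewrite -sqrf_eq0; apply/eqP/le_anti.
by rewrite sqr_ge0 andbT (le_trans (positive_sqr_le x pA M0 hM))// x0 mulr0.
Qed.

Lemma positive0 : positive (0 : H -> H).
Proof. by split=> [|x]; [exact: bop0|rewrite ip0l]. Qed.

Lemma positiveD A B : positive A -> positive B -> positive (A + B).
Proof.
move=> [bA pA] [bB pB]; split=> [|x]; first exact: bopD.
by rewrite ipDl addr_ge0.
Qed.

Lemma positiveZ (r : R) A : 0 <= r -> positive A -> positive (r%:C *: A).
Proof.
move=> r0 [bA pA]; split=> [|x]; first exact: bopZ.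
by rewrite ipZl mulr_ge0// lecR.
Qed.

Lemma selfadj_comp_positive A P : bounded_operator A -> selfadj A ->
  positive P -> positive (A \o P \o A).
Proof.
move=> bA sA [bP pP]; split=> [|x /=]; first by do 2!apply: bop_comp => //.
by rewrite sA.
Qed.

Lemma selfadj_sqr_positive A : bounded_operator A -> selfadj A ->
  positive (A \o A).
Proof.
move=> bA sA; split=> [|x /=]; first exact: bop_comp.
by rewrite sA ipxx lecR sqr_ge0.
Qed.

Lemma selfadj_sqr0 A : selfadj A -> (forall x, A (A x) = 0) -> A = 0.
Proof.
move=> sA A2; apply/funext => x; apply: hnm_eq0; apply/eqP.
by rewrite -sqrf_eq0 -Re_ipxx sA A2 ip0r.
Qed.

End BoundedOperators.

(** * The positive square root *)

Section SquareRoot.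
Context {R : realType} {H : hilbertType R}.
Implicit Types (A B C P : H -> H) (x y : H).

(** The iteration Y := (B + Y^2) / 2, whose limit satisfies
    (1 - Y)^2 = 1 - B. *)
Fixpoint sqrt_iter B n : H -> H :=
  if n is m.+1 then 2^-1 *: (B + (sqrt_iter B m \o sqrt_iter B m)) else 0.

Lemma sqrt_iterS B n x : sqrt_iter B n.+1 x =
  2^-1 *: (B x + sqrt_iter B n (sqrt_iter B n x)).
Proof. by []. Qed.

(** The same iteration for the scalar B = 1. *)
Fixpoint sqrt_rate n : R :=
  if n is m.+1 then 2^-1 * (1 + sqrt_rate m ^+ 2) else 0.

Lemma sqrt_rate_itv n : 0 <= sqrt_rate n <= 1.
Proof.
elim: n => [|n /andP[h0 h1]] /=; first by rewrite lexx ler01.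
by apply/andP; split; nra.
Qed.

Lemma sqrt_rate_incr n : sqrt_rate n <= sqrt_rate n.+1.
Proof. by have /andP[h0 h1] := sqrt_rate_itv n; rewrite /=; nra. Qed.

Lemma sqrt_rate_nd : nondecreasing_seq sqrt_rate.
Proof. by apply/nondecreasing_seqP => n; exact: sqrt_rate_incr. Qed.

Lemma sqrt_iter_lin B n : linear B -> linear (sqrt_iter B n).
Proof.
move=> lB; elim: n => [|n IH] a x y; first by rewrite scaler0 addr0.
rewrite !sqrt_iterS lB !IH !scalerDr !scalerA (mulrC a) -!scalerA -!scalerDr.
by congr (_ *: _); rewrite addrACA scalerDr.
Qed.

Lemma sqrt_iter_bound B n : opbound 1 B -> opbound (sqrt_rate n) (sqrt_iter B n).
Proof.
have half : cmod 2^-1 = 2^-1 :> R.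
  by rewrite -(@cmod_real _ 2^-1) ?invr_ge0// fmorphV rmorph_nat.
move=> hB; elim: n => [|n IH] /=; first by move=> x; rewrite mul0r hnm0.
rewrite -half; apply/opboundZ/opboundD => //.
have /andP[h0 _] := sqrt_rate_itv n.
by rewrite expr2; exact: opbound_comp.
Qed.

(** The iteration is dominated by the scalar one, so the monotone convergence of
    sqrt_rate makes it Cauchy. *)
Lemma sqrt_iter_dist B m n x : linear B -> opbound 1 B -> (m <= n)%N ->
  hnm (sqrt_iter B n x - sqrt_iter B m x) <=
  (sqrt_rate n - sqrt_rate m) * hnm x.
Proof.
have half : cmod 2^-1 = 2^-1 :> R.
  by rewrite -(@cmod_real _ 2^-1) ?invr_ge0// fmorphV rmorph_nat.
move=> lB hB; elim: m n x => [|m IH] n x mn.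
  by rewrite /= !subr0; exact: sqrt_iter_bound.
case: n mn => // n; rewrite ltnS => mn; rewrite !sqrt_iterS /=.
set Yn := sqrt_iter B n; set Ym := sqrt_iter B m.
set rn := sqrt_rate n; set rm := sqrt_rate m.
have lYn : linear Yn by exact: sqrt_iter_lin.
rewrite -scalerBr hnmZ half opprD addrACA subrr add0r.
have -> : Yn (Yn x) - Ym (Ym x) = Yn (Yn x - Ym x) + (Yn (Ym x) - Ym (Ym x)).
  by rewrite (opB lYn) addrA subrK.
have /andP[rn0 _] := sqrt_rate_itv n; have /andP[rm0 _] := sqrt_rate_itv m.
have rmn : rm <= rn by exact: sqrt_rate_nd.
have h1 := IH n x mn; have h2 := IH n (Ym x) mn.
have h3 := sqrt_iter_bound m hB x.
have h4 := sqrt_iter_bound n hB (Yn x - Ym x).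
have := hnmD (Yn (Yn x - Ym x)) (Yn (Ym x) - Ym (Ym x)).
have x0 := hnm_ge0 x.
move: h1 h2 h3 h4; rewrite -/Yn -/Ym -/rn -/rm.
move: (hnm (Yn x - Ym x)) (hnm (Yn (Ym x) - Ym (Ym x))) (hnm (Ym x))
  (hnm (Yn (Yn x - Ym x))) (hnm x) x0 => a b c d z z0 h1 h2 h3 h4 h5.
rewrite (@le_trans _ _ (2^-1 * (rn * ((rn - rm) * z) + (rn - rm) * (rm * z))))//.
  rewrite ler_wpM2l ?invr_ge0// (le_trans h5)// lerD//.
    by rewrite (le_trans h4)// ler_wpM2l.
  by rewrite (le_trans h2)// ler_wpM2l// subr_ge0.
rewrite le_eqVlt; apply/orP; left; apply/eqP; by field.
Qed.

Lemma sqrt_iter_selfadj B n : selfadj B -> selfadj (sqrt_iter B n).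
Proof.
move=> sB; elim: n => [|n IH] x y; first by rewrite ip0l ip0r.
rewrite !sqrt_iterS ipZl ipZr !ipDl !ipDr sB !IH.
by rewrite fmorphV /= conjC_nat.
Qed.

Lemma sqrt_iter_comm B C n x : linear C -> (forall x, C (B x) = B (C x)) ->
  C (sqrt_iter B n x) = sqrt_iter B n (C x).
Proof.
move=> lC CB; elim: n x => [|n IH] x; first by rewrite op0.
by rewrite !sqrt_iterS opZ // opD// CB !IH.
Qed.

(** For 0 <= A, |<Ax, y>|^2 <= <Ax, x><Ay, y>, hence a form bound on a
    positive operator is a norm bound. *)
Lemma positive_opbound A M : 0 <= M -> positive A ->
  (forall x, complex.Re '[A x, x] <= M * hnm x ^+ 2) -> opbound M A.
Proof.
move=> M0 pA h x; have := pos_form_CS (positive_form pA) x (A x).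
rewrite ipxx cmod_real ?sqr_ge0//.
have hx := h x; have hAx := h (A x).
have qx := positive_ge0 x pA; have qAx := positive_ge0 (A x) pA.
move: hx hAx qx qAx (hnm_ge0 x) (hnm_ge0 (A x)).
move: (complex.Re _) (complex.Re _) (hnm x) (hnm (A x)) => q1 q2 z a.
move=> h1 h2 p1 p2 z0 a0 h3.
have h4 : (a ^+ 2) ^+ 2 <= (M * z ^+ 2) * (M * a ^+ 2).
  by rewrite (le_trans h3)// ler_pM.
have [->|an0] := eqVneq a 0; first exact: mulr_ge0.
have a2 : 0 < a ^+ 2 by rewrite exprn_gt0// lt_def an0.
rewrite -(@ler_pXn2r _ 2) ?nnegrE ?mulr_ge0// -(ler_pM2r a2).
by rewrite (le_trans _ (le_trans h4 _))// ?expr2// le_eqVlt; apply/orP; left;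
  apply/eqP; ring.
Qed.

(** P = 1 - Y, where Y is the limit of the iteration for B = 1 - A. *)
Lemma sqrt_unit A : positive A -> opbound 1 A ->
  exists P, [/\ positive P, P \o P = A &
    forall x, hcvg (fun n => x - sqrt_iter (id - A) n x) (P x)].
Proof.
move=> pA hA; set B : H -> H := id - A.
have bA := positive_bop pA; have bB : bounded_operator B by exact: bopB bop_id bA.
have lB := bop_lin bB; have sA := positive_selfadj pA.
have sB : selfadj B by move=> x y; rewrite ipBl ipBr sA.
have pB : positive B.
  apply: selfadj_positive => // x; rewrite ipBl cReD cReN Re_ipxx subr_ge0.
  rewrite (le_trans (ler_norm _))// (le_trans (Re_le_cmod _))//.
  rewrite (le_trans (ip_CS _ _))// expr2 ler_wpM2r ?hnm_ge0//.
  by have := hA x; rewrite mul1r.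
have hB : opbound 1 B.
  apply: positive_opbound => // x; rewrite ipBl cReD cReN Re_ipxx mul1r.
  by rewrite gerBl positive_ge0.
have Yc x : exists l, hcvg (fun n => sqrt_iter B n x) l.
  apply: hcvg_cauchy => e e0.
  have : cvgn sqrt_rate.
    apply: nondecreasing_is_cvgn sqrt_rate_nd _.
    by exists 1 => _ [n _ <-]; have /andP[] := sqrt_rate_itv n.
  move=> /cvgrPdist_lt h.
  have e1 : 0 < e / 2 / (hnm x + 1).
    by rewrite !divr_gt0// ltr_wpDl// hnm_ge0.
  have [N _ hN] := h _ e1; exists N.
  suff aux m n : (N <= m)%N -> (m <= n)%N ->
      hnm (sqrt_iter B n x - sqrt_iter B m x) < e.
    move=> m n Nm Nn; have [mn|/ltnW nm] := leqP m n; first exact: aux.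
    by rewrite hnm_distC; exact: aux.
  move=> Nm mn; rewrite (le_lt_trans (sqrt_iter_dist _ lB hB mn))//.
  have := hN m Nm; have := hN n (leq_trans Nm mn); rewrite /=.
  rewrite !ltr_norml => /andP[a1 a2] /andP[b1 b2].
  have x0 := hnm_ge0 x.
  have : sqrt_rate n - sqrt_rate m < e / (hnm x + 1).
    by move: a1 a2 b1 b2; rewrite [e / 2 / _]mulrAC; lra.
  rewrite ltr_pdivlMr ?ltr_wpDl// => h1.
  have := sqrt_rate_nd mn; move: h1; nra.
have [Y [bY hY Yl]] := @op_limit _ _ (sqrt_iter B) 1 ler01
  (fun n => sqrt_iter_lin n lB)
  (fun n => opbound_le (proj2 (andP (sqrt_rate_itv n))) (sqrt_iter_bound n hB)) Yc.
have sY : selfadj Y.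
  move=> x y; apply: (ccvg_unique (ip_cvg (Yl x) (hcvg_cst y))).
  have := ip_cvg (hcvg_cst x) (Yl y).
  by under eq_fun do rewrite -(sqrt_iter_selfadj _ sB).
have YE x : Y x = 2^-1 *: (B x + Y (Y x)).
  have h1 : hcvg (fun n => sqrt_iter B n.+1 x) (Y x).
    have := Yl x; rewrite /hcvg => h.
    by have := h; rewrite -(cvg_shiftS (fun n => hnm (sqrt_iter B n x - Y x))).
  apply: (hcvg_unique h1); apply: hcvgZ; apply: hcvgD; first exact: hcvg_cst.
  have h2 : hcvg (fun n => sqrt_iter B n (Y x)) (Y (Y x)) by exact: Yl.
  have h3 : hcvg (fun n => sqrt_iter B n (sqrt_iter B n x - Y x)) 0.
    apply: null_le (Yl x) => n; rewrite hnm_ge0 subr0 /=.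
    have := sqrt_iter_bound n hB (sqrt_iter B n x - Y x).
    move=> /le_trans; apply; rewrite -[leRHS]mul1r ler_wpM2r ?hnm_ge0//.
    by have /andP[] := sqrt_rate_itv n.
  have := hcvgD h3 h2; rewrite add0r.
  under eq_fun do rewrite -(opD (sqrt_iter_lin _ lB)) subrK.
  by [].
exists (id - Y); split.
- apply: selfadj_positive.
  + exact: bopB bop_id bY.
  + by move=> x y; rewrite ipBl ipBr sY.
  + move=> x; rewrite ipBl cReD cReN Re_ipxx subr_ge0.
    rewrite (le_trans (ler_norm _))// (le_trans (Re_le_cmod _))//.
    rewrite (le_trans (ip_CS _ _))// expr2 ler_wpM2r ?hnm_ge0//.
    by have := hY x; rewrite mul1r.
- apply/funext => x /=; rewrite !fctE /= (opB (bop_lin bY)).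
  have : 2 *: Y x = B x + Y (Y x).
    by rewrite {1}YE scalerA divff ?scale1r// pnatr_eq0.
  rewrite /B scaler_nat mulr2n !fctE => h.
  have -> : Y (Y x) = Y x + Y x - (x - A x) by rewrite h addrAC subrr add0r.
  have -> : Y x - (Y x + Y x - (x - A x)) = x - A x - Y x.
    by rewrite opprB addrC opprD addrA subrK.
  by rewrite opprB addrA subrK opprB addrC subrK.
- by move=> x; apply: hcvgB; [exact: hcvg_cst|exact: Yl].
Qed.

End SquareRoot.

Section SquareRootTheory.
Context {R : realType} {H : hilbertType R}.
Implicit Types (A B C P : H -> H) (x y : H).

Lemma opbound_gt0 A : bounded_operator A ->
  exists2 M : R, 0 < M & opbound M A.
Proof.
move=> /bopP[_ [M M0 hM]]; exists (M + 1); first by rewrite ltr_wpDl.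
by apply: opbound_le hM; rewrite lerDl.
Qed.

(** For 0 <= A <= M these tend to the square root of A. *)
Definition sqrt_approx (M : R) A n x :=
  (Num.sqrt M)%:C *: (x - sqrt_iter (id - (M^-1)%:C *: A) n x).

Lemma sqrt_approx_comm M A C n x : linear C ->
  (forall x, C (A x) = A (C x)) ->
  C (sqrt_approx M A n x) = sqrt_approx M A n (C x).
Proof.
move=> lC CA; rewrite /sqrt_approx (opZ lC) (opB lC) (sqrt_iter_comm n x lC)//.
by move=> z; rewrite !subopE !scaleopE (opB lC) (opZ lC) CA.
Qed.

Lemma sqrt_exists A (M : R) : positive A -> 0 < M -> opbound M A ->
  exists P, [/\ positive P, P \o P = A &
    forall x, hcvg (fun n => sqrt_approx M A n x) (P x)].
Proof.
move=> pA M0 hA; pose A1 := (M^-1)%:C *: A.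
have pA1 : positive A1 by apply: positiveZ pA; rewrite invr_ge0 ltW.
have hA1 : opbound 1 A1.
  rewrite -[1](@mulVf _ M) ?gt_eqF// -[X in X * M]cmod_real ?invr_ge0 ?ltW//.
  exact: opboundZ.
have [P [pP PP hP]] := sqrt_unit pA1 hA1.
exists ((Num.sqrt M)%:C *: P); split.
- exact: positiveZ (sqrtr_ge0 _) pP.
- apply/funext => x; rewrite /= !scaleopE (opZ (bop_lin (positive_bop pP))).
  have -> : P (P x) = A1 x by rewrite -PP.
  rewrite /A1 scaleopE !scalerA -!rmorphM /= -expr2 sqr_sqrtr ?ltW//.
  by rewrite mulfV ?gt_eqF// scale1r.
- by move=> x; apply: hcvgZ; exact: hP.
Qed.

(** The limit above is a limit of polynomials in A, so it commutes with the
    commutant of A; two positive square roots therefore commute. *)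
Lemma sqrt_unique P Q A : positive P -> positive Q ->
  P \o P = A -> Q \o Q = A -> P = Q.
Proof.
suff aux P' Q' : positive P' -> positive Q' -> P' \o P' = Q' \o Q' ->
    (forall x, P' (Q' x) = Q' (P' x)) -> P' = Q'.
  move=> pP pQ PA QA.
  have pA : positive A.
    rewrite -PA; apply: selfadj_sqr_positive (positive_bop pP) _.
    exact: positive_selfadj.
  have [M M0 hM] := opbound_gt0 (positive_bop pA).
  have [S [pS SA Sl]] := sqrt_exists pA M0 hM.
  have comm B : positive B -> B \o B = A -> forall x, S (B x) = B (S x).
    move=> pB BA x.
    have bB := positive_bop pB; have lB := bop_lin bB.
    apply: (hcvg_unique (Sl (B x))).
    have := op_cvg bB (Sl x); congr (hcvg _ _); apply/funext => n.
    by apply: sqrt_approx_comm => // z; rewrite -BA.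
  have SP : S = P by apply: aux => //; [rewrite SA PA|exact: comm].
  have SQ : S = Q by apply: aux => //; [rewrite SA QA|exact: comm].
  by rewrite -SP.
move=> pP pQ PQ comm.
have lP := bop_lin (positive_bop pP); have lQ := bop_lin (positive_bop pQ).
have sP := positive_selfadj pP; have sQ := positive_selfadj pQ.
have PQ2 x : P' (P' x) = Q' (Q' x) by have := congr1 (@^~ x) PQ.
apply/eqP; rewrite -subr_eq0; apply/eqP.
apply: selfadj_sqr0 => [x y|x]; first by rewrite !subopE ipBl ipBr sP sQ.
set y := (P' - Q') x.
have y0 : P' y + Q' y = 0.
  by rewrite /y subopE (opB lP) (opB lQ) comm PQ2 addrA subrK subrr.
have {}y0 : complex.Re '[P' y, y] + complex.Re '[Q' y, y] = 0.
  by rewrite -cReD -ipDl y0 ip0l.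
have := positive_ge0 y pP; have := positive_ge0 y pQ => q0 p0.
have P0 : P' y = 0 by apply: positive_eq0 pP _; lra.
have Q0 : Q' y = 0 by apply: positive_eq0 pQ _; lra.
by rewrite subopE P0 Q0 subrr.
Qed.

Lemma opsqrt_unique P A : positive P -> P \o P = A -> opsqrt A = P.
Proof.
move=> pP PA; rewrite /opsqrt.
case: xgetP => [Q _ [pQ QA]|/(_ P)[]//]; exact: sqrt_unique pQ pP QA PA.
Qed.

Lemma opsqrt_spec A : positive A -> positive (opsqrt A) /\
  opsqrt A \o opsqrt A = A.
Proof.
move=> pA; have [M M0 hM] := opbound_gt0 (positive_bop pA).
have [P [pP PA _]] := sqrt_exists pA M0 hM.
by rewrite (opsqrt_unique pP PA).
Qed.

Lemma opsqrtK A x : positive A -> opsqrt A (opsqrt A x) = A x.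
Proof. by move=> /opsqrt_spec[_ hA]; rewrite -[in RHS]hA. Qed.

Lemma opsqrt_lim A (M : R) x : positive A -> 0 < M -> opbound M A ->
  hcvg (fun n => sqrt_approx M A n x) (opsqrt A x).
Proof.
move=> pA M0 hM; have [P [pP PA hP]] := sqrt_exists pA M0 hM.
by rewrite (opsqrt_unique pP PA).
Qed.

Lemma opsqrt_comm A C x : positive A -> bounded_operator C ->
  (forall x, C (A x) = A (C x)) -> C (opsqrt A x) = opsqrt A (C x).
Proof.
move=> pA bC CA; have lC := bop_lin bC.
have [M M0 hM] := opbound_gt0 (positive_bop pA).
apply/esym/(hcvg_unique (opsqrt_lim (C x) pA M0 hM)).
have := op_cvg bC (opsqrt_lim x pA M0 hM).
by congr (hcvg _ _); apply/funext => n; exact: sqrt_approx_comm.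
Qed.

Lemma opsqrt0_nonpos A : ~ positive A -> opsqrt A = 0.
Proof.
move=> nA; rewrite /opsqrt; case: xgetP => [Q _ [pQ QA]|//].
exfalso; apply: nA; rewrite -QA.
exact: selfadj_sqr_positive (positive_bop pQ) (positive_selfadj pQ).
Qed.

Lemma opsqrt_positive A : positive (opsqrt A).
Proof.
have [/opsqrt_spec[]//|nA] := pselect (positive A).
by rewrite opsqrt0_nonpos//; exact: positive0.
Qed.

Lemma positiveZ_inv (c : R) A : 0 < c -> positive (c%:C *: A) -> positive A.
Proof.
move=> c0 pcA; have ci0 : 0 <= c^-1 by rewrite invr_ge0 ltW.
have := positiveZ ci0 pcA.
by rewrite scalerA -rmorphM /= mulVf ?gt_eqF// scale1r.
Qed.

Lemma opsqrtZ (c : R) A : 0 <= c ->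
  opsqrt (c%:C *: A) = (Num.sqrt c)%:C *: opsqrt A.
Proof.
move=> c0; have [->|cn0] := eqVneq c 0.
  rewrite sqrtr0 !scale0r; apply: opsqrt_unique positive0 _.
  by apply/funext.
have cgt0 : 0 < c by rewrite lt_def cn0.
have [pA|nA] := pselect (positive A).
  have [pS SA] := opsqrt_spec pA; apply: opsqrt_unique.
    exact: positiveZ (sqrtr_ge0 _) pS.
  apply/funext => x; rewrite /= !scaleopE (opZ (bop_lin (positive_bop pS))).
  by rewrite opsqrtK// scalerA -rmorphM /= -expr2 sqr_sqrtr.
rewrite !opsqrt0_nonpos ?scaler0//.
by move=> h; apply: nA; exact: positiveZ_inv cgt0 h.
Qed.

End SquareRootTheory.

(** * Orthonormal bases, the Riesz representation and adjoints *)

Section Bases.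
Context {R : realType} {H : hilbertType R}.
Implicit Types (A B : H -> H) (x y : H) (I : set nat) (e b : nat -> H).

(** Padding a basis indexed by I with zero vectors turns sums over I into
    sums over all of nat. *)
Definition pad I e k : H := if k \in I then e k else 0.

(** The expansion property, all that traces and Hilbert-Schmidt sums use of a
    padded basis. *)
Definition frame b := forall x, hcvg (fun n => \sum_(k < n) '[x, b k] *: b k) x.

Lemma pad_sum (V : zmodType) I e n (F : H -> V) : F 0 = 0 ->
  \sum_(k < n | (k : nat) \in I) F (e k) = \sum_(k < n) F (pad I e k).
Proof.
move=> F0; rewrite big_mkcond; apply: eq_bigr => k _; rewrite /pad.
by case: ifPn.
Qed.

Lemma pad_frame I e : orthonormal_basis I e -> frame (pad I e).
Proof.
move=> [_ he] x; apply/hcvgP; have := he x.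
under eq_fun do rewrite (pad_sum _ _ _ (F := fun v => '[x, v] *: v)) ?scaler0//.
by [].
Qed.

Lemma pad_orthogonal I e : orthonormal_basis I e ->
  forall i j, '[pad I e i, pad I e j] = ((i == j) && (i \in I))%:R.
Proof.
move=> [he _] i j; rewrite /pad; case: ifPn => [iI|]; last by rewrite ip0l andbF.
case: ifPn => [jI|jI]; last first.
  rewrite ip0r; case: eqP => //= ij; by rewrite -ij iI in jI.
by rewrite andbT he//; apply/set_mem.
Qed.

Lemma frame_ip b : frame b -> forall x y,
  ccvg (fun n => \sum_(k < n) '[x, b k] * '[b k, y]) '[x, y].
Proof.
move=> hb x y; have := ip_cvg (hb x) (hcvg_cst y).
by under eq_fun do rewrite ip_suml; under eq_fun do under eq_bigr do rewrite ipZl.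
Qed.

Lemma frame_parseval b : frame b -> forall x,
  (fun n => \sum_(k < n) cmod '[x, b k] ^+ 2) @ \oo --> hnm x ^+ 2.
Proof.
move=> hb x; have /ccvg_ReIm[+ _] := @frame_ip b hb x x; rewrite Re_ipxx.
under eq_fun => n.
  rewrite (_ : complex.Re _ = \sum_(k < n) cmod '[x, b k] ^+ 2); first by over.
  rewrite (big_morph (@complex.Re R) cReD (erefl _)); apply: eq_bigr => k _.
  by rewrite [X in _ * X]ipC mulcJ.
by [].
Qed.

End Bases.

Section Riesz.
Context {R : realType} {H : hilbertType R}.
Variables (I : set nat) (e : nat -> H).
Hypothesis He : orthonormal_basis I e.
Implicit Types (A B : H -> H) (x y : H).

(** The representing vector is sum_k conj(phi(b_k)) b_k; it converges because phi
    maps its partial sums to sum_k |phi(b_k)|^2, the square of their norm. *)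
Lemma riesz (phi : H -> R[i]) (M : R) : 0 <= M ->
  (forall a x y, phi (a *: x + y) = a * phi x + phi y) ->
  (forall x, cmod (phi x) <= M * hnm x) ->
  exists w, forall x, phi x = '[x, w].
Proof.
move=> M0 lphi hphi; pose b := pad I e.
have phi0 : phi 0 = 0.
  by have := hphi 0; rewrite hnm0 mulr0 => h; apply/cmod_eq0/le_anti; rewrite h cmod_ge0.
have phiD x y : phi (x + y) = phi x + phi y.
  by have := lphi 1 x y; rewrite scale1r mul1r.
have phiZ a x : phi (a *: x) = a * phi x.
  by have := lphi a x 0; rewrite !addr0 phi0 addr0.
have phi_sum n (F : nat -> H) : phi (\sum_(k < n) F k) = \sum_(k < n) phi (F k).
  by rewrite (big_morph phi phiD phi0).
have phi_cvg (u : nat -> H) l : hcvg u l -> ccvg (fun n => phi (u n)) (phi l).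
  move=> h; apply/ccvgP; apply: null_le (nullZ M h) => n; rewrite cmod_ge0 /=.
  by rewrite -[- phi l]mulN1r -phiZ scaleN1r -phiD hphi.
pose w n := \sum_(k < n) (phi (b k))^* *: b k.
pose S n : R := \sum_(k < n) cmod (phi (b k)) ^+ 2.
have S_nd : nondecreasing_seq S.
  by apply/nondecreasing_seqP => n; rewrite /S big_ord_recr lerDl sqr_ge0.
have phiw n : phi (w n) = (S n)%:C.
  rewrite /w (phi_sum n (fun k => (phi (b k))^* *: b k)) rmorph_sum; apply: eq_bigr => k _.
  by rewrite phiZ mulrC mulcJ.
have wip k n : '[w n, b k] = if (k < n)%N then (phi (b k))^* else 0.
  rewrite ip_suml; under eq_bigr do rewrite ipZl (pad_orthogonal He).
  case: ifPn => [kn|]; last first.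
    rewrite -leqNgt => nk; apply: big1 => j _; rewrite ltn_eqF ?mulr0//.
    exact: leq_trans (ltn_ord j) nk.
  rewrite (bigD1 (Ordinal kn))//= eqxx big1 ?addr0 => [|j jk]; last first.
    by rewrite (_ : (_ == _) = false) ?mulr0//; apply: contra_neqF jk => /eqP jk; exact: val_inj.
  rewrite /b /pad; case: ifPn; rewrite ?mulr1// => _.
  by rewrite phi0 rmorph0 mul0r.
have wdist m n : (m <= n)%N -> hnm (w n - w m) ^+ 2 = S n - S m.
  move=> mn; rewrite -Re_ipxx; rewrite [X in '[_, X]](_ : _ = \sum_(m <= k < n) (phi (b k))^* *: b k); last first.
    rewrite /w -!(big_mkord xpredT (fun k => (phi (b k))^* *: b k)).
    by rewrite (big_cat_nat (leq0n m) mn) /= [X in X - _]addrC addrK.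
  rewrite ip_sumr (_ : S n - S m = \sum_(m <= k < n) cmod (phi (b k)) ^+ 2); last first.
    rewrite /S -!(big_mkord xpredT (fun k => cmod (phi (b k)) ^+ 2)).
    by rewrite (big_cat_nat (leq0n m) mn) /= [X in X - _]addrC addrK.
  rewrite (big_morph (@complex.Re R) cReD (erefl _)); apply: eq_big_nat => k /andP[mk kn].
  rewrite ipZr ipBl !wip kn ltnNge mk /= subr0 conjCK mulcJ//.
have Sle n : S n <= M ^+ 2.
  have := hphi (w n); rewrite phiw cmod_real; last by apply: sumr_ge0 => k _; exact: sqr_ge0.
  have := wdist 0 n (leq0n n); rewrite {2}/w {2}/S !big_ord0 !subr0 => <-.
  move: (hnm_ge0 (w n)); move: (hnm _) => z z0 h.
  have [->|zn0] := eqVneq z 0; first by rewrite expr0n sqr_ge0.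
  have zgt0 : 0 < z by rewrite lt_def zn0.
  by rewrite ler_pXn2r ?nnegrE//; move: h; rewrite expr2 ler_pM2r.
have cS : cvgn S.
  by apply: nondecreasing_is_cvgn S_nd _; exists (M ^+ 2) => _ [n _ <-].
have [l wl] : exists l, hcvg w l.
  apply: hcvg_cauchy => eps eps0; move: cS => /cvgrPdist_lt h.
  have eps1 : 0 < eps ^+ 2 / 2 by rewrite divr_gt0// exprn_gt0.
  have [N _ hN] := h _ eps1; exists N.
  suff aux m n : (N <= m)%N -> (m <= n)%N -> hnm (w n - w m) < eps.
    move=> m n Nm Nn; have [mn|/ltnW nm] := leqP m n; first exact: aux.
    by rewrite hnm_distC; exact: aux.
  move=> Nm mn; rewrite -(@ltr_pXn2r _ 2) ?nnegrE ?hnm_ge0 ?(ltW eps0)//.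
  rewrite wdist//; have := hN m Nm; have := hN n (leq_trans Nm mn) => /=.
  by rewrite !ltr_norml => /andP[a1 a2] /andP[b1 b2]; lra.
exists l => x; apply: (ccvg_unique (phi_cvg _ _ (pad_frame He x))).
have := ip_cvg (hcvg_cst x) wl; congr (ccvg _ _); apply/funext => n.
rewrite ip_sumr (phi_sum n (fun k => '[x, pad I e k] *: pad I e k)); apply: eq_bigr => k _.
by rewrite ipZr phiZ conjCK mulrC.
Qed.

(** Riesz, applied to y |-> conj(B x y) for each x. *)
Lemma riesz_form (B : H -> H -> R[i]) (M : R) : 0 <= M ->
  (forall a x y z, B (a *: x + y) z = a * B x z + B y z) ->
  (forall a x y z, B z (a *: x + y) = a^* * B z x + B z y) ->
  (forall x y, cmod (B x y) <= M * hnm x * hnm y) ->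
  exists A, bounded_operator A /\ forall x y, '[A x, y] = B x y.
Proof.
move=> M0 Bl Br hB.
have /choice[A hA] x : exists w, forall y, '[w, y] = B x y.
  have [|||w hw] := @riesz (fun y => (B x y)^*) (M * hnm x).
  - by rewrite mulr_ge0// hnm_ge0.
  - by move=> a y z; rewrite Br rmorphD rmorphM /= conjCK.
  - by move=> y; rewrite cmodJ.
  by exists w => y; rewrite ipC -hw conjCK.
exists A; split=> //; apply/bopP; split.
  by move=> a x y; apply: ip_ext => v; rewrite hA Bl ipDl ipZl !hA.
exists M => // x; have := hB x (A x); rewrite -hA ipxx cmod_real ?sqr_ge0//.
have [->|zn0] := eqVneq (hnm (A x)) 0; first by rewrite mulr_ge0// hnm_ge0.
by rewrite expr2 ler_pM2r// lt_def zn0 hnm_ge0.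
Qed.

Lemma adjoint_spec A : bounded_operator A ->
  bounded_operator (adjoint A) /\ forall x y, '[A x, y] = '[x, adjoint A y].
Proof.
move=> bA; rewrite /adjoint; case: xgetP => [B _ //|/= noadj].
exfalso; have /bopP[lA [M M0 hM]] := bA.
have [|||B [bB hB]] := @riesz_form (fun x y => '[x, A y]) M M0.
- by move=> a x y z; rewrite ipDl ipZl.
- by move=> a x y z; rewrite lA ipDr ipZr.
- move=> x y; rewrite (le_trans (ip_CS _ _))// mulrAC mulrC.
  by apply: ler_wpM2r; [exact: hnm_ge0|exact: hM].
by apply: (noadj B); split=> // x y; rewrite ipC -hB -ipC.
Qed.

Lemma bop_adjoint A : bounded_operator A -> bounded_operator (adjoint A).
Proof. by move=> /adjoint_spec[]. Qed.

Lemma adjointE A x y : bounded_operator A -> '[A x, y] = '[x, adjoint A y].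
Proof. by move=> /adjoint_spec[_ ->]. Qed.

Lemma adjointEl A x y : bounded_operator A -> '[adjoint A x, y] = '[x, A y].
Proof. by move=> bA; rewrite ipC -adjointE// -ipC. Qed.

Lemma adjoint_unique A B : bounded_operator A -> 
  (forall x y, '[A x, y] = '[x, B y]) -> adjoint A = B.
Proof.
move=> bA AB; apply/funext => y; apply: ip_ext => x.
by rewrite adjointEl// [RHS]ipC -AB -ipC.
Qed.

Lemma selfadj_adjoint A : bounded_operator A -> selfadj A -> adjoint A = A.
Proof. by move=> bA; exact: adjoint_unique. Qed.

Lemma adjointK A : bounded_operator A -> adjoint (adjoint A) = A.
Proof.
move=> bA; apply: adjoint_unique => [|x y]; first exact: bop_adjoint.
exact: adjointEl.
Qed.

Lemma gram_positive A : bounded_operator A -> positive (adjoint A \o A).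
Proof.
move=> bA; split=> [|x /=]; first by apply: bop_comp => //; exact: bop_adjoint.
by rewrite adjointEl// ipxx lecR sqr_ge0.
Qed.

Lemma half_double x : 2^-1 *: (x + x) = x.
Proof.
by rewrite -mulr2n -[X in _ *: X]scaler_nat scalerA mulVf ?scale1r// pnatr_eq0.
Qed.

Lemma pos_partE (h : H -> H) x : pos_part h x = 2^-1 *: (opabs h x + h x).
Proof. by []. Qed.
Lemma neg_partE (h : H -> H) x : neg_part h x = 2^-1 *: (opabs h x - h x).
Proof. by []. Qed.
Lemma ReopE A x : Reop A x = 2^-1 *: (A x + adjoint A x).
Proof. by []. Qed.
Lemma ImopE A x : Imop A x = (2 * 'i)^-1 *: (A x - adjoint A x).
Proof. by []. Qed.

Lemma opabs_positive (A : H -> H) : positive (opabs A).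
Proof. exact: opsqrt_positive. Qed.

Lemma opabsK A x : bounded_operator A ->
  opabs A (opabs A x) = adjoint A (A x).
Proof. by move=> bA; rewrite /opabs opsqrtK//; exact: gram_positive. Qed.

Lemma opabs_pos (P : H -> H) : positive P -> opabs P = P.
Proof.
move=> pP; apply: opsqrt_unique => //; rewrite selfadj_adjoint//.
  exact: positive_bop.
exact: positive_selfadj.
Qed.

Lemma hnm_opabs A x : bounded_operator A -> hnm (opabs A x) = hnm (A x).
Proof.
move=> bA; have sA := positive_selfadj (opabs_positive A).
apply/eqP; rewrite -(@eqrXn2 _ 2)// ?hnm_ge0// -!Re_ipxx.
by rewrite sA opabsK// -adjointE.
Qed.

(** With M = (|h| + h)/2 and N = (|h| - h)/2 one has M N = 0, so
    (|M| + |N|)^2 = M^2 + N^2 = |h|^2 and |M| + |N| = M + N by uniqueness of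
    the square root; then Z = |M| - M = N - |N| has square zero. *)
Lemma pos_part_positive (h : H -> H) : bounded_operator h -> selfadj h ->
  positive (pos_part h).
Proof.
move=> bh sh; set P := opabs h.
have pP : positive P := opabs_positive h; have bP := positive_bop pP.
have sP := positive_selfadj pP; have lP := bop_lin bP; have lh := bop_lin bh.
have PP x : P (P x) = h (h x) by rewrite /P opabsK// selfadj_adjoint.
have hP x : h (P x) = P (h x).
  apply: opsqrt_comm => //; first exact: gram_positive.
  by move=> z; rewrite /= selfadj_adjoint.
pose M := pos_part h; pose N := neg_part h.
have bM : bounded_operator M by apply/bopZ/bopD.
have bN : bounded_operator N by apply/bopZ/bopB.
have lM := bop_lin bM; have lN := bop_lin bN.
have half : (2^-1 : R[i])^* = 2^-1 by rewrite fmorphV /= conjC_nat.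
have sM : selfadj M.
  by move=> x y; rewrite /M !pos_partE ipZl ipZr half ipDl ipDr sP sh.
have sN : selfadj N.
  by move=> x y; rewrite /N !neg_partE ipZl ipZr half ipBl ipBr sP sh.
have ME x : M x = 2^-1 *: (P x + h x) by [].
have NE x : N x = 2^-1 *: (P x - h x) by [].
have MDN x : M x + N x = P x.
  by rewrite /M /N pos_partE neg_partE -scalerDr addrACA subrr addr0 half_double.
have MN x : M (N x) = 0.
  rewrite ME NE !(opZ lP) !(opZ lh) (opB lP) (opB lh).
  by rewrite -scalerDr PP hP addrA subrK subrr !scaler0.
have NM x : N (M x) = 0.
  rewrite NE ME !(opZ lP) !(opZ lh) (opD lP) (opD lh).
  by rewrite -scalerBr PP hP [X in _ - X]addrC subrr !scaler0.
pose M1 := opabs M; pose N1 := opabs N.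
have pM1 : positive M1 := opabs_positive M.
have pN1 : positive N1 := opabs_positive N.
have sM1 := positive_selfadj pM1; have sN1 := positive_selfadj pN1.
have bM1 := positive_bop pM1; have bN1 := positive_bop pN1.
have lM1 := bop_lin bM1; have lN1 := bop_lin bN1.
have M11 x : M1 (M1 x) = M (M x) by rewrite /M1 opabsK// selfadj_adjoint.
have N11 x : N1 (N1 x) = N (N x) by rewrite /N1 opabsK// selfadj_adjoint.
(* |T| kills the kernel of T. *)
have ker T x : bounded_operator T -> T x = 0 -> opabs T x = 0.
  by move=> bT Tx; apply: hnm_eq0; rewrite hnm_opabs// Tx hnm0.
have M1N x : M1 (N x) = 0 by exact: ker.
have N1M x : N1 (M x) = 0 by exact: ker.
have NM1 x : N (M1 x) = 0.
  by apply: ip_ext => v; rewrite sN sM1 M1N ip0r ip0l.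
have MN1 x : M (N1 x) = 0.
  by apply: ip_ext => v; rewrite sM sN1 N1M ip0r ip0l.
have N1M1 x : N1 (M1 x) = 0 by exact: ker.
have M1N1 x : M1 (N1 x) = 0 by exact: ker.
have E : M1 + N1 = P.
  apply: (@sqrt_unique _ _ _ _ (h \o h)) => //; first exact: positiveD.
    apply/funext => x; rewrite /= !addopE (opD lM1) (opD lN1).
    rewrite M1N1 N1M1 addr0 add0r M11 N11 -PP -!MDN (opD lM) (opD lN).
    by rewrite MN NM addr0 add0r.
  by apply/funext => x /=; rewrite PP.
have ZE x : M1 x - M x = N x - N1 x.
  have := congr1 (@^~ x) E; rewrite addopE -MDN => EE.
  by apply/eqP; rewrite subr_eq addrAC eq_sym subr_eq EE addrC.
have /eqP : M1 - M = 0.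
  apply: selfadj_sqr0 => [x y|x]; first by rewrite !subopE ipBl ipBr sM1 sM.
  have -> : (M1 - M) x = N x - N1 x by exact: ZE.
  by rewrite subopE (opB lM1) (opB lM) M1N M1N1 MN MN1 !subr0.
by rewrite subr_eq0 -/M => /eqP <-.
Qed.

Lemma neg_part_positive (h : H -> H) : bounded_operator h -> selfadj h ->
  positive (neg_part h).
Proof.
move=> bh sh; have -> : neg_part h = pos_part (- h).
  rewrite /neg_part /pos_part; congr (_ *: (_ + _)); rewrite /opabs.
  rewrite !selfadj_adjoint//; last 2 first.
  - exact: bopN.
  - by move=> x y; rewrite ipNl ipNr sh.
  congr opsqrt; apply/funext => x /=.
  have -> : (- h) ((- h) x) = - h (- h x) by [].
  by rewrite (opN (bop_lin bh)) opprK.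
apply: pos_part_positive; first exact: bopN.
by move=> x y; rewrite ipNl ipNr sh.
Qed.

Lemma bop_Reop A : bounded_operator A -> bounded_operator (Reop A).
Proof. by move=> bA; apply/bopZ/bopD => //; exact: bop_adjoint. Qed.

Lemma bop_Imop A : bounded_operator A -> bounded_operator (Imop A).
Proof. by move=> bA; apply/bopZ/bopB => //; exact: bop_adjoint. Qed.

Lemma Reop_selfadj A : bounded_operator A -> selfadj (Reop A).
Proof.
move=> bA x y; rewrite !ReopE ipZl ipZr ipDl ipDr adjointEl//.
by rewrite -adjointE// addrC fmorphV /= conjC_nat.
Qed.

Lemma Imop_selfadj A : bounded_operator A -> selfadj (Imop A).
Proof.
move=> bA x y; rewrite !ImopE ipZl ipZr ipBl ipBr adjointEl//.
rewrite -adjointE// -opprB mulrN -mulNr; congr (_ * _).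
rewrite fmorphV rmorphM /= conjC_nat.
have -> : ('i : R[i])^* = - 'i by apply: complex_eq; rewrite /= ?oppr0.
by rewrite mulrN invrN.
Qed.

Lemma pos_neg_parts (h : H -> H) x : pos_part h x - neg_part h x = h x.
Proof.
rewrite pos_partE neg_partE -scalerBr opprB [opabs h x + _]addrC.
by rewrite addrACA subrr addr0 half_double.
Qed.

Lemma Re_Im_parts A x : Reop A x + 'i *: Imop A x = A x.
Proof.
rewrite ReopE ImopE scalerA invfM mulrCA mulfV ?mulr1; last first.
  by rewrite eq_complex /= oner_eq0 andbF.
by rewrite -scalerDr addrACA subrr addr0 half_double.
Qed.

End Riesz.

(** * Hilbert-Schmidt operators *)

Section NonnegativeSeries.
Context {R : realType}.

Lemma eseries_cvg_real (x : nat -> R) (l : R) :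
  (fun n => \sum_(k < n) x k) @ \oo --> l ->
  (\sum_(k <oo) (x k)%:E)%E = l%:E.
Proof.
move=> h; apply/cvg_lim => //.
under eq_fun do rewrite sumEFin big_mkord.
exact: (cvg_comp _ _ h).
Qed.

Lemma real_cvg_eseries (x : nat -> R) : (forall k, 0 <= x k) ->
  (\sum_(k <oo) (x k)%:E < +oo)%E ->
  (fun n => \sum_(k < n) x k) @ \oo --> fine (\sum_(k <oo) (x k)%:E)%E.
Proof.
move=> x0 h.
have c : cvgn (fun n => \sum_(k < n) x k).
  apply: nondecreasing_is_cvgn.
    by apply/nondecreasing_seqP => n; rewrite big_ord_recr lerDl.
  exists (fine (\sum_(k <oo) (x k)%:E)%E) => _ [n _ <-].
  rewrite -lee_fin fineK; last first.
    by rewrite ge0_fin_numE// nneseries_ge0// => *; rewrite lee_fin.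
  rewrite -(big_mkord xpredT) -sumEFin; apply: nneseries_lim_ge => *.
  by rewrite lee_fin.
by rewrite (@eseries_cvg_real _ (limn (fun n => \sum_(k < n) x k)))//.
Qed.

End NonnegativeSeries.

Section HilbertSchmidt.
Context {R : realType} {H : hilbertType R}.
Variables (I : set nat) (e : nat -> H).
Hypothesis He : orthonormal_basis I e.
Implicit Types (A a c d : H -> H) (x y : H) (b : nat -> H).
Local Open Scope ereal_scope.

Definition hsum c b : \bar R := \sum_(k <oo) ((hnm (c (b k)) ^+ 2)%R)%:E.

Lemma hsum_ge0 c b : 0 <= hsum c b.
Proof. by apply: nneseries_ge0 => *; rewrite lee_fin sqr_ge0. Qed.

Lemma parseval_eseries b x : frame b ->
  \sum_(k <oo) ((cmod '[x, b k] ^+ 2)%R)%:E = ((hnm x ^+ 2)%R)%:E.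
Proof. by move=> hb; apply: eseries_cvg_real; exact: frame_parseval. Qed.

(** Both sides are the sum of |<c b_k, b'_j>|^2 over all j and k. *)
Lemma hsum_adjoint c b b' : bounded_operator c -> frame b -> frame b' ->
  hsum c b = hsum (adjoint c) b'.
Proof.
move=> bc hb hb'; rewrite /hsum.
under eq_eseriesr do rewrite -(parseval_eseries _ hb').
rewrite nneseries_interchange; last by move=> *; rewrite lee_fin sqr_ge0.
apply: eq_eseriesr => j _; rewrite -(parseval_eseries _ hb).
by apply: eq_eseriesr => k _; rewrite (adjointE He)// ipC cmodJ.
Qed.

(** Summability is tested in the fixed basis; by hsum_adjoint the sum is the same
    in every frame. *)
Definition hs c := bounded_operator c /\ hsum c (pad I e) < +oo.

Local Close Scope ereal_scope.

Let be := pad_frame He.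

Lemma hs_bop c : hs c -> bounded_operator c. Proof. by case. Qed.

Lemma hs_adjoint c : hs c -> hs (adjoint c).
Proof.
move=> [bc hc]; split; first exact: (bop_adjoint He).
by rewrite -(hsum_adjoint bc be be).
Qed.

Definition hsq c : R := fine (hsum c (pad I e)).

Lemma hsq_adjoint c : hs c -> hsq (adjoint c) = hsq c.
Proof. by move=> [bc _]; rewrite /hsq -(hsum_adjoint bc be be). Qed.

Lemma hs_cvg c b : hs c -> frame b ->
  (fun n => \sum_(k < n) hnm (c (b k)) ^+ 2) @ \oo --> hsq c.
Proof.
move=> [bc hc] hb; have E : hsum c b = hsum c (pad I e).
  by rewrite (hsum_adjoint bc hb be) -(hsum_adjoint bc be be).
rewrite /hsq -E; apply: real_cvg_eseries => [k|]; first exact: sqr_ge0.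
by move: hc; rewrite -E.
Qed.

Lemma hs_le c (M : R) a a' : bounded_operator c ->
  (forall x, hnm (c x) ^+ 2 <= M * (hnm (a x) ^+ 2 + hnm (a' x) ^+ 2)) ->
  hs a -> hs a' -> hs c.
Proof.
move=> bc hc ha ha'; split=> //.
have la := rcvgZ M (rcvgD (hs_cvg ha be) (hs_cvg ha' be)).
apply: (@le_lt_trans _ _ (M * (hsq a + hsq a'))%:E); last by rewrite ltry.
rewrite -(@eseries_cvg_real _
   (fun k => M * (hnm (a (pad I e k)) ^+ 2 + hnm (a' (pad I e k)) ^+ 2))); last first.
  apply: eq_rcvg la => n /=.
  by rewrite -big_split -mulr_sumr.
apply: lee_nneseries => [k _ _|k _]; first by rewrite lee_fin sqr_ge0.
by rewrite lee_fin.
Qed.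

Lemma hsD a c : hs a -> hs c -> hs (a + c).
Proof.
move=> ha hc; apply: (hs_le (M := 2) _ _ ha hc); first exact: bopD (hs_bop ha) (hs_bop hc).
move=> x; have := hnmD (a x) (c x); rewrite -addopE.
move: (hnm_ge0 (a x)) (hnm_ge0 (c x)) (hnm_ge0 ((a + c) x)).
move: (hnm (a x)) (hnm (c x)) (hnm ((a + c) x)) => p q r p0 q0 r0 rpq.
apply: (@le_trans _ _ ((p + q) ^+ 2)).
  by rewrite ler_pXn2r ?nnegrE ?addr_ge0.
by have := sqr_ge0 (p - q); nra.
Qed.

Lemma hs_compl A c : bounded_operator A -> hs c -> hs (A \o c).
Proof.
move=> bA hc; have /bopP[lA [M M0 hM]] := bA.
apply: (hs_le (M := M ^+ 2) _ _ hc hc); first exact: bop_comp bA (hs_bop hc).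
move=> x; have := hM (c x) => /= h.
apply: (@le_trans _ _ ((M * hnm (c x)) ^+ 2)).
  by rewrite ler_pXn2r ?nnegrE ?mulr_ge0 ?hnm_ge0.
by rewrite exprMn ler_wpM2l ?sqr_ge0// lerDl sqr_ge0.
Qed.

Lemma hs_compr A c : bounded_operator A -> hs c -> hs (c \o A).
Proof.
move=> bA hc; have bc := hs_bop hc.
have -> : c \o A = adjoint (adjoint A \o adjoint c).
  apply/esym/(adjoint_unique He).
    by apply: bop_comp; exact: (bop_adjoint He).
  by move=> x y; rewrite /= (adjointEl He)// (adjointEl He).
apply: hs_adjoint; apply: hs_compl; first exact: (bop_adjoint He).
exact: hs_adjoint.
Qed.

Lemma hsZ z c : hs c -> hs (z *: c).
Proof.
move=> hc; rewrite (_ : _ *: _ = (z *: id) \o c)//.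
by apply: hs_compl => //; exact/bopZ/bop_id.
Qed.

Lemma hsB a c : hs a -> hs c -> hs (a - c).
Proof. by move=> ha hc; apply: hsD => //; rewrite -scaleN1r; exact: hsZ. Qed.

Lemma Re_polar x y :
  complex.Re '[x, y] = 4^-1 * (hnm (x + y) ^+ 2 - hnm (x - y) ^+ 2).
Proof.
have -> : hnm (x - y) ^+ 2 = hnm x ^+ 2 + hnm y ^+ 2 - 2 * complex.Re '[x, y].
  by rewrite hnmD_sqr hnmN ipNr cReN; ring.
by rewrite hnmD_sqr; field.
Qed.

Lemma Im_polar x y : complex.Im '[x, y] =
  4^-1 * (hnm (x + 'i *: y) ^+ 2 - hnm (x - 'i *: y) ^+ 2).
Proof.
rewrite -Re_polar ipZr.
by case: '[x, y] => p q; rewrite cReM /=; ring.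
Qed.

(** The Hilbert-Schmidt inner product, defined by polarisation of hsq and so
    independent of the basis by construction. *)
Definition hsip a d : R[i] :=
  (4^-1 * (hsq (a + d) - hsq (a - d))) +i*
  (4^-1 * (hsq (a + 'i *: d) - hsq (a - 'i *: d))).

Lemma hsip_cvg a d b : hs a -> hs d -> frame b ->
  ccvg (fun n => \sum_(k < n) '[a (b k), d (b k)]) (hsip a d).
Proof.
move=> ha hd hb; apply/ccvg_ReIm; split.
  have h1 := hs_cvg (hsD ha hd) hb; have h2 := hs_cvg (hsB ha hd) hb.
  apply: eq_rcvg (rcvgZ 4^-1 (rcvgB h1 h2)) => n; rewrite (big_morph (@complex.Re R) cReD (erefl _)).
  by rewrite -sumrN -big_split mulr_sumr; apply: eq_bigr => k _; rewrite Re_polar.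
have hid := hsZ 'i hd.
have h1 := hs_cvg (hsD ha hid) hb; have h2 := hs_cvg (hsB ha hid) hb.
apply: eq_rcvg (rcvgZ 4^-1 (rcvgB h1 h2)) => n; rewrite (big_morph (@complex.Im R) cImD (erefl _)).
by rewrite -sumrN -big_split mulr_sumr; apply: eq_bigr => k _; rewrite Im_polar.
Qed.

Lemma adjointD a d : bounded_operator a -> bounded_operator d ->
  adjoint (a + d) = adjoint a + adjoint d.
Proof.
move=> ba bd; apply: (adjoint_unique He) => [|x y]; first exact: bopD.
by rewrite !addopE ipDl ipDr !(adjointE He).
Qed.

Lemma adjointZ z a : bounded_operator a ->
  adjoint (z *: a) = z^* *: adjoint a.
Proof.
move=> ba; apply: (adjoint_unique He) => [|x y]; first exact: bopZ.
by rewrite !scaleopE ipZl ipZr conjCK (adjointE He).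
Qed.

Lemma hsqZ z c : hs c -> hsq (z *: c) = cmod z ^+ 2 * hsq c.
Proof.
move=> hc; apply: (cvg_unique _ (hs_cvg (hsZ z hc) be)) => //.
apply: eq_rcvg (rcvgZ (cmod z ^+ 2) (hs_cvg hc be)) => n; rewrite mulr_sumr; apply: eq_bigr => k _.
by rewrite scaleopE hnmZ exprMn.
Qed.

Lemma cmod_i : cmod ('i : R[i]) = 1.
Proof. by rewrite /cmod normc_def /= expr0n /= add0r expr1n sqrtr1. Qed.

Lemma hsip_adjoint a d : hs a -> hs d ->
  hsip (adjoint d) (adjoint a) = hsip a d.
Proof.
move=> ha hd; have ba := hs_bop ha; have bd := hs_bop hd.
have hs_a := hs_adjoint ha; have hs_d := hs_adjoint hd.
have hid := hsZ 'i hd.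
have E1 : adjoint d + adjoint a = adjoint (a + d).
  by rewrite adjointD// addrC.
have E2 : adjoint d - adjoint a = (-1) *: adjoint (a - d).
  rewrite adjointD//; last exact: bopN.
  rewrite -[- d]scaleN1r adjointZ// rmorphN1 !scaleN1r opprD opprK addrC.
  by [].
have i_conj : ('i : R[i])^* = - 'i by apply: complex_eq; rewrite /= ?oppr0.
have ii : ('i : R[i]) * 'i = -1 by apply: complex_eq; rewrite /=; ring.
have E3 : adjoint d + 'i *: adjoint a = 'i *: adjoint (a + 'i *: d).
  rewrite adjointD//; last exact: bopZ.
  rewrite adjointZ// i_conj scalerDr scalerA mulrN ii opprK scale1r addrC.
  by [].
have E4 : adjoint d - 'i *: adjoint a = (- 'i) *: adjoint (a - 'i *: d).
  rewrite adjointD//; last exact/bopN/bopZ.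
  have i_conjN : (- 'i : R[i])^* = 'i by apply: complex_eq; rewrite /= ?oppr0 ?opprK.
  rewrite -!scaleNr adjointZ// i_conjN scalerDr scalerA mulNr ii opprK scale1r.
  by rewrite addrC.
rewrite /hsip E1 E2 E3 E4 !hsqZ ?hsq_adjoint; try by
  do ?[exact: hsD|exact: hsB|apply: hs_adjoint].
by rewrite !cmodN cmod1 cmod_i expr1n !mul1r.
Qed.

Definition is_trace (T : H -> H) (t : R[i]) :=
  forall I e, orthonormal_basis I e ->
    ccvg (fun n => \sum_(k < n | (k : nat) \in I) '[T (e k), e k]) t.

Lemma is_traceE T t : is_trace T t -> Tr T = t.
Proof.
move=> hT; rewrite /Tr; case: xgetP => [u _ hu|/(_ t)[]//].
exact: ccvg_unique (hu _ _ He) (hT _ _ He).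
Qed.

Lemma is_trace_frame T t : linear T ->
  (forall b, frame b -> ccvg (fun n => \sum_(k < n) '[T (b k), b k]) t) ->
  is_trace T t.
Proof.
move=> lT hT J f Hf; have := hT _ (pad_frame Hf); congr (ccvg _ _).
apply/funext => n.
by rewrite (pad_sum J f n (F := fun v => '[T v, v])) ?ip0r.
Qed.

Lemma is_traceD S T s t : is_trace S s -> is_trace T t -> is_trace (S + T) (s + t).
Proof.
move=> hS hT J f Hf; have := ccvgD (hS _ _ Hf) (hT _ _ Hf).
congr (ccvg _ _); apply/funext => n; rewrite -big_split; apply: eq_bigr => k _.
by rewrite addopE ipDl.
Qed.

Lemma is_traceZ z T t : is_trace T t -> is_trace (z *: T) (z * t).
Proof.
move=> hT J f Hf; have := ccvgZ z (hT _ _ Hf).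
congr (ccvg _ _); apply/funext => n; rewrite mulr_sumr; apply: eq_bigr => k _.
by rewrite scaleopE ipZl.
Qed.

Lemma is_trace_hs a d : hs a -> hs d -> is_trace (adjoint d \o a) (hsip a d).
Proof.
move=> ha hd; apply: is_trace_frame => [|b hb].
  by apply: bop_lin; apply: bop_comp (hs_bop ha); exact/(bop_adjoint He)/hs_bop.
have := hsip_cvg ha hd hb; congr (ccvg _ _); apply/funext => n.
by apply: eq_bigr => k _; rewrite /= (adjointEl He)//; exact: hs_bop.
Qed.

End HilbertSchmidt.

(** * Trace class operators *)

Section PolarFactor.
Context {R : realType} {H : hilbertType R}.
Implicit Types (a b s V : H -> H) (x y : H).

Definition op_pow b n x : H := iter n b x.

(** 1 + b + ... + b^(n-1), an approximate inverse of 1 - b. *)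
Fixpoint op_geom b n x : H := if n is m.+1 then x + b (op_geom b m x) else 0.

Lemma op_geom_lin b n : linear b -> linear (op_geom b n).
Proof.
move=> lb; elim: n => [|n IH] z x y /=; first by rewrite scaler0 addr0.
by rewrite IH lb scalerDr addrACA.
Qed.

Lemma conj_real (r : R) : (r%:C)^* = r%:C.
Proof. by apply: complex_eq; rewrite //= oppr0. Qed.

Section Contraction.
Variable a : H -> H.
Hypotheses (pa : positive a) (ha : opbound 1 a).
Let la := bop_lin (positive_bop pa).
Let b : H -> H := id - a.

Let bE z : b z = z - a z. Proof. by []. Qed.
Let bb : bounded_operator b. Proof. exact: bopB bop_id (positive_bop pa). Qed.
Let lb := bop_lin bb.

Lemma op_geomE n x : a (op_geom b n x) = x - op_pow b n x.
Proof.
elim: n => [|n IH] /=; first by rewrite (op0 la) subrr.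
rewrite bE (opD la) (opB la) IH (opB la) bE.
rewrite [a x + _]addrC opprB -addrA subrK opprB -addrA.
by congr (_ + _); rewrite addrC.
Qed.

Lemma op_pow_comm n x : a (op_pow b n x) = op_pow b n (a x).
Proof.
elim: n => // n IH; rewrite /op_pow /= -!/(op_pow b n _) -IH.
by rewrite !bE (opB la).
Qed.

(** |b z|^2 = |z|^2 - 2 <a z, z> + |a z|^2, and |a z|^2 <= <a z, z> as
    0 <= a <= 1. *)
Lemma contraction_drop z : hnm (a z) ^+ 2 <= hnm z ^+ 2 - hnm (b z) ^+ 2.
Proof.
rewrite bE hnmD_sqr hnmN ipNr cReN.
have := positive_sqr_le z pa ler01 ha; rewrite mul1r => h.
have -> : complex.Re '[z, a z] = complex.Re '[a z, z].
  by rewrite (positive_selfadj pa).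
by move: h; move: (hnm z) (hnm (a z)) (complex.Re _) => p q r; lra.
Qed.

Lemma op_pow_bound n : opbound 1 (op_pow b n).
Proof.
have hb z : hnm (b z) <= hnm z.
  rewrite -(@ler_pXn2r _ 2) ?nnegrE ?hnm_ge0//.
  by have := contraction_drop z; have := sqr_ge0 (hnm (a z)); lra.
elim: n => [|n IH] x; first by rewrite mul1r.
exact: le_trans (hb _) (IH x).
Qed.

(** |a b^n y|^2 is at most a difference of consecutive terms of the
    nonincreasing sequence |b^n y|^2. *)
Lemma op_pow_null y : (fun n => hnm (a (op_pow b n y))) @ \oo --> (0 : R).
Proof.
pose q n := hnm (op_pow b n y) ^+ 2.
have q_ni n : q n.+1 <= q n.
  have := contraction_drop (op_pow b n y); have := sqr_ge0 (hnm (a (op_pow b n y))).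
  by rewrite -/(q n) -[b (op_pow b n y)]/(op_pow b n.+1 y) -/(q n.+1); lra.
have cq : cvgn q.
  apply: nonincreasing_is_cvgn; first exact/nonincreasing_seqP.
  by exists 0 => _ [n _ <-]; exact: sqr_ge0.
have cq1 : (fun n => q n.+1) @ \oo --> limn q.
  by rewrite (cvg_shiftS q).
have := rcvgB cq cq1; rewrite subrr => h.
have h2 : (fun n => hnm (a (op_pow b n y)) ^+ 2) @ \oo --> (0 : R).
  apply: null_le h => n; rewrite sqr_ge0 /=; exact: contraction_drop.
apply/null_leP => [n|eps e0]; first exact: hnm_ge0.
have e2 : 0 < eps ^+ 2 by rewrite exprn_gt0.
have /null_leP/(_ _ e2)[n|N hN] := h2; first exact: sqr_ge0.
exists N => n Nn; rewrite -(@ltr_pXn2r _ 2) ?nnegrE ?hnm_ge0 ?(ltW e0)//.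
exact: hN.
Qed.

Lemma polar_factor1 s : bounded_operator s ->
  (forall x, hnm (s x) = hnm (a (a x))) ->
  exists V, [/\ bounded_operator V, forall x, s x = V (a x) &
    forall y, hnm (V y) <= hnm (a y)].
Proof.
move=> bs sE; have ls := bop_lin bs.
pose W n x := s (op_geom b n x).
have lW n : linear (W n).
  by move=> z x y; rewrite /W (op_geom_lin n lb) ls.
have hW1 n y : hnm (W n y) <= hnm (a y) + hnm (a (op_pow b n y)).
  by rewrite /W sE op_geomE (opB la) hnmB.
have hW n : opbound 2 (W n).
  move=> y; rewrite (le_trans (hW1 n y))// [2]mulr2n mulrDl !mul1r lerD//.
    by have := ha y; rewrite mul1r.
  have := ha (op_pow b n y); rewrite mul1r => /le_trans; apply.
  by have := op_pow_bound n y; rewrite mul1r.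
have cW y : exists l, hcvg (fun n => W n y) l.
  apply: hcvg_cauchy => eps e0.
  have e1 : 0 < eps / 2 by rewrite divr_gt0.
  have /null_leP/(_ _ e1)[n|N hN] := op_pow_null y; first exact: hnm_ge0.
  exists N => m n Nm Nn; rewrite /W -(opB ls) sE (opB la) !op_geomE.
  rewrite [y - _ - _]addrC opprB addrA subrK (opB la) (le_lt_trans (hnmB _ _))//.
  by have := hN _ Nm; have := hN _ Nn; lra.
have [V [bV _ hV]] := op_limit (ler0n R 2) lW hW cW.
exists V; split=> // [x|y].
- apply: hcvg_unique (hV (a x)).
  apply: null_le (op_pow_null (a x)) => n; rewrite hnm_ge0 /W -(opB ls) sE (opB la).
  rewrite op_geomE addrAC subrr add0r (opN la) hnmN -op_pow_comm.
  by rewrite lexx.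
- have h1 := rcvgD (rcvg_cst (hnm (a y))) (op_pow_null y).
  by rewrite addr0 in h1; exact: (rcvg_le (hW1^~ y)) (hcvg_hnm (hV y)) h1.
Qed.

End Contraction.

(** If |s x| = |a^2 x| for all x, then s = V a with |V y| <= |a y|: the polar
    decomposition of s, with one factor a left on the side of V. *)
Lemma polar_factor a s : positive a -> bounded_operator s ->
  (forall x, hnm (s x) = hnm (a (a x))) ->
  exists V, [/\ bounded_operator V, forall x, s x = V (a x) &
    forall y, hnm (V y) <= hnm (a y)].
Proof.
move=> pa bs sE; have [M M0 hM] := opbound_gt0 (positive_bop pa).
have M1 : 0 <= M^-1 by rewrite invr_ge0 ltW.
pose a1 := (M^-1)%:C *: a; pose s1 := (M^-1 ^+ 2)%:C *: s.
have pa1 : positive a1 by exact: positiveZ.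
have ha1 : opbound 1 a1.
  rewrite -[1](@mulVf _ M) ?gt_eqF// -[X in X * M]cmod_real//.
  exact: opboundZ.
have [|x|V [bV sV hV]] := @polar_factor1 a1 pa1 ha1 s1; first exact: bopZ.
  have a1E z : a1 z = (M^-1)%:C *: a z by [].
  rewrite !a1E (opZ (bop_lin (positive_bop pa))) scalerA -rmorphM /= -expr2.
  by rewrite -[s1 x]/(_ *: s x) !hnmZ sE.
exists (M%:C *: V); split; first exact: bopZ.
- move=> x; rewrite scaleopE -[a x](scale1r) -[1](_ : M%:C * (M^-1)%:C = 1); last first.
    by rewrite -rmorphM /= mulfV ?gt_eqF.
  rewrite -scalerA (opZ (bop_lin bV)) -[_ *: a x]/(a1 x) -sV /s1 scaleopE !scalerA.
  by rewrite -!rmorphM /= -expr2 -exprMn mulfV ?gt_eqF// expr1n scale1r.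
- move=> y; rewrite scaleopE hnmZ cmod_real; last exact: ltW.
  apply: (@le_trans _ _ (M * hnm (a1 y))); first by rewrite ler_wpM2l// ltW.
  by rewrite hnmZ cmod_real// mulrA mulfV ?gt_eqF// mul1r.
Qed.

End PolarFactor.

Section TraceClass.
Context {R : realType} {H : hilbertType R}.
Variables (I : set nat) (e : nat -> H).
Hypothesis He : orthonormal_basis I e.
Implicit Types (A B a c d s p : H -> H) (x y u v : H) (b : nat -> H).
Local Notation hs := (hs I e).

Lemma tc_bop s : trace_class s -> bounded_operator s. Proof. by case. Qed.

Lemma hs_frame c b : bounded_operator c -> frame b ->
  (hsum c b < +oo)%E -> hs c.
Proof.
move=> bc hb; rewrite (hsum_adjoint He bc hb (pad_frame He)).
by rewrite -(hsum_adjoint He bc (pad_frame He) (pad_frame He)).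
Qed.

Lemma hsum_pad c J f : linear c -> hsum c (pad J f) =
  (\sum_(k <oo | k \in J) ((hnm (c (f k)) ^+ 2)%R)%:E)%E.
Proof.
move=> lc; rewrite [RHS]eseries_mkcond; apply: eq_eseriesr => k _; rewrite /pad.
by case: ifPn => // _; rewrite op0// hnm0 expr0n.
Qed.

(** s = (s |s|^(-1/2)) |s|^(1/2), both factors being Hilbert-Schmidt. *)
Lemma tc_factor s : trace_class s ->
  exists a d, [/\ hs a, hs d & s = adjoint d \o a].
Proof.
move=> [bs [J [f [Hf hf]]]]; pose P := opabs s; pose a := opsqrt P.
have pP : positive P := opabs_positive s.
have pa : positive a := opsqrt_positive P.
have ba := positive_bop pa.
have aa x : a (a x) = P x by exact: opsqrtK.
have ha : hs a.
  apply: (hs_frame ba (pad_frame Hf)); rewrite hsum_pad; last exact: bop_lin.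
  move: hf; congr (_ < _)%E; apply: eq_eseriesr => k _.
  by rewrite -Re_ipxx (positive_selfadj pa) aa [in RHS]ipC cReJ.
have [|V [bV sV hV]] := polar_factor pa bs.
  by move=> x; rewrite aa -(hnm_opabs He).
have hsV : hs V.
  apply: (hs_le He (M := 1) bV _ ha ha) => y; rewrite mul1r.
  apply: (@le_trans _ _ (hnm (a y) ^+ 2)); last by rewrite lerDl sqr_ge0.
  by rewrite ler_pXn2r ?nnegrE ?hnm_ge0.
exists a, (adjoint V); split=> //; first exact: hs_adjoint.
by rewrite (adjointK He)//; apply/funext.
Qed.

Lemma is_trace_tc s A : trace_class s -> bounded_operator A ->
  is_trace (s \o A) (Tr (s \o A)).
Proof.
move=> /tc_factor[a [d [ha hd ->]]] bA.
have h : is_trace (adjoint d \o (a \o A)) (hsip I e (a \o A) d).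
  by apply: is_trace_hs => //; exact: hs_compr.
by rewrite (is_traceE He h).
Qed.

Lemma Tr_tcD s A B : trace_class s -> bounded_operator A -> bounded_operator B ->
  Tr (s \o (A + B)) = Tr (s \o A) + Tr (s \o B).
Proof.
move=> hs bA bB; apply: (is_traceE He).
rewrite (_ : s \o (A + B) = (s \o A) + (s \o B)).
  by apply: is_traceD; exact: is_trace_tc.
by apply/funext => x; rewrite /= addopE (opD (bop_lin (tc_bop hs))).
Qed.

Lemma Tr_tcZ s z A : trace_class s -> bounded_operator A ->
  Tr (s \o (z *: A)) = z * Tr (s \o A).
Proof.
move=> hs bA; apply: (is_traceE He).
rewrite (_ : s \o (z *: A) = z *: (s \o A)).
  by apply: is_traceZ; exact: is_trace_tc.
by apply/funext => x; rewrite /= scaleopE (opZ (bop_lin (tc_bop hs))).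
Qed.

Lemma Tr_tcDl s s' A : trace_class s -> trace_class s' -> bounded_operator A ->
  Tr ((s + s') \o A) = Tr (s \o A) + Tr (s' \o A).
Proof.
move=> hs hs' bA; apply: (is_traceE He).
rewrite (_ : (s + s') \o A = (s \o A) + (s' \o A))//.
by apply: is_traceD; exact: is_trace_tc.
Qed.

Lemma Tr_tcZl s z A : trace_class s -> bounded_operator A ->
  Tr ((z *: s) \o A) = z * Tr (s \o A).
Proof.
move=> hs bA; apply: (is_traceE He).
rewrite (_ : (z *: s) \o A = z *: (s \o A))//.
by apply: is_traceZ; exact: is_trace_tc.
Qed.

(** Positive trace class operators are the operators c^* c with c
    Hilbert-Schmidt. *)
Definition gram c : H -> H := adjoint c \o c.

Lemma gram_hs_positive c : hs c -> positive (gram c).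
Proof. by move=> hc; apply: (gram_positive He); exact: hs_bop hc. Qed.

Lemma positive_tc p J f : positive p -> orthonormal_basis J f ->
  (\sum_(k <oo | k \in J) (complex.Re '[p (f k), f k])%:E < +oo)%E ->
  trace_class p.
Proof.
move=> pp Hf h; split; first exact: positive_bop.
by exists J, f; split=> //; rewrite (opabs_pos He).
Qed.

Lemma gram_sum_lty c : hs c ->
  (\sum_(k <oo | k \in I) (complex.Re '[gram c (e k), e k])%:E < +oo)%E.
Proof.
move=> hc; have [bc] := hc; rewrite hsum_pad; last exact: bop_lin.
congr (_ < _)%E; apply: eq_eseriesr => k _.
by rewrite /gram /= (adjointEl He)// Re_ipxx.
Qed.

Lemma gram_tc c : hs c -> trace_class (gram c).
Proof.
move=> hc; apply: (positive_tc (gram_hs_positive hc) He); exact: gram_sum_lty.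
Qed.

Lemma tc_gram p : positive p -> trace_class p -> exists2 c, hs c & p = gram c.
Proof.
move=> pp [bp [J [f [Hf]]]]; rewrite (opabs_pos He)// => hf.
have pc := opsqrt_positive p; have bc := positive_bop pc.
exists (opsqrt p).
  apply: (hs_frame bc (pad_frame Hf)); rewrite hsum_pad; last exact: bop_lin.
  move: hf; congr (_ < _)%E; apply: eq_eseriesr => k _.
  by rewrite -Re_ipxx (positive_selfadj pc) opsqrtK// [in RHS]ipC cReJ.
rewrite /gram (selfadj_adjoint He bc (positive_selfadj pc)).
by apply/funext => x; rewrite /= opsqrtK.
Qed.

Lemma tc_gramZ (r : R) c : 0 <= r -> hs c -> trace_class (r%:C *: gram c).
Proof.
move=> r0 hc; rewrite (_ : _ *: _ = gram ((Num.sqrt r)%:C *: c)).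
  exact/gram_tc/hsZ.
have bc := hs_bop hc.
rewrite /gram (adjointZ He)//; apply/funext => x /=.
rewrite !scaleopE (opZ (bop_lin (bop_adjoint He bc))) scalerA.
by rewrite conj_real -rmorphM /= -expr2 sqr_sqrtr.
Qed.

(** Polarisation of the factorisation s = d^* a. *)
Lemma tc_decomp s : trace_class s -> exists c1 c2 c3 c4,
  [/\ [/\ hs c1, hs c2, hs c3 & hs c4] &
    s = 4^-1 *: ((gram c1 - gram c2) + 'i *: (gram c3 - gram c4))].
Proof.
move=> /tc_factor[a [d [ha hd ->]]].
have hid := hsZ He 'i hd.
exists (a + d), (a - d), (a + 'i *: d), (a - 'i *: d); split.
  by split; [exact: hsD|exact: hsB|exact: hsD|exact: hsB].
have ba := hs_bop ha; have bd := hs_bop hd.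
apply/funext => x; apply: ip_ext => y.
rewrite scaleopE addopE !subopE scaleopE subopE ipZl ipDl ipBl ipZl ipBl.
rewrite /gram /= !(adjointEl He)//; try by do ?[apply: bopB|apply: bopD|apply: bopZ].
rewrite !(addopE, subopE, scaleopE) !(ipDl, ipDr, ipBl, ipBr, ipZl, ipZr).
rewrite !(ipNl, ipNr, ipZl, ipZr).
have -> : ('i : R[i])^* = - 'i by apply: complex_eq; rewrite /= ?oppr0.
have ii : ('i : R[i]) * 'i = -1 by apply: complex_eq; rewrite /=; ring.
move: ii; move: ('i : R[i]) => i ii.
move: '[a x, a y] '[a x, d y] '[d x, a y] '[d x, d y] => p q r t.
rewrite [RHS](_ : _ = 2^-1 * (q + r + (i * i) * r - (i * i) * q)); last by field.
by rewrite ii; field.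
Qed.

(** The trace against a positive operator p = c^* c, computed through the
    frame c^* b_k. *)
Lemma Tr_gram c A b : hs c -> bounded_operator A -> frame b ->
  ccvg (fun n => \sum_(k < n) '[A (adjoint c (b k)), adjoint c (b k)])
    (Tr (gram c \o A)).
Proof.
move=> hc bA hb; have bc := hs_bop hc.
have hcA : hs (c \o A) := hs_compr He bA hc.
have h : is_trace (adjoint c \o (c \o A)) (hsip I e (c \o A) c).
  by apply: is_trace_hs.
have := is_traceE He h; rewrite -[adjoint c \o _]/(gram c \o A) => ->.
rewrite -(hsip_adjoint He)//.
have := hsip_cvg He (hs_adjoint He hc) (hs_adjoint He hcA) hb.
congr (ccvg _ _); apply/funext => n; apply: eq_bigr => k _.
rewrite ipC (adjointEl He) /=; last exact: hs_bop hcA.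
by rewrite -(adjointEl He)// -ipC.
Qed.

Lemma Tr_gram_ge0 c A : hs c -> positive A -> 0 <= Tr (gram c \o A).
Proof.
move=> hc pA; have [bA qA] := pA.
have /ccvg_ReIm[hR hI] := Tr_gram hc bA (pad_frame He).
apply/ge0_complexP; split.
  apply: (cvg_unique _ hI) => //; rewrite (_ : (fun _ => _) = fun=> 0); first exact: cvg_cst.
  apply/funext => n; rewrite (big_morph (@complex.Im R) cImD (erefl _)).
  by apply: big1 => k _; have /ge0_complexP[] := qA (adjoint c (pad I e k)).
rewrite -(cvg_lim _ hR)//; apply: limr_ge; first by apply/cvg_ex; eexists; exact: hR.
apply: nearW => n; rewrite (big_morph (@complex.Re R) cReD (erefl _)).
by apply: sumr_ge0 => k _; exact: positive_ge0.
Qed.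

Lemma tc_Tr_ge0 p A : positive p -> trace_class p -> positive A ->
  0 <= Tr (p \o A).
Proof. by move=> pp /(tc_gram pp)[c hc ->]; exact: Tr_gram_ge0. Qed.

Lemma bop_rank_one u v : bounded_operator (rank_one u v : H -> H).
Proof.
apply/bopP; split; first by move=> a x y; rewrite /rank_one ipDl ipZl scalerDl scalerA.
exists (hnm v * hnm u) => [|x]; first by rewrite mulr_ge0 ?hnm_ge0.
rewrite /rank_one hnmZ mulrAC ler_wpM2r ?hnm_ge0// mulrC; exact: ip_CS.
Qed.

Lemma hs_rank_one u v : hs (rank_one u v).
Proof.
apply: (hs_frame (bop_rank_one u v) (pad_frame He)).
rewrite /hsum (_ : (\sum_(k <oo) _)%E = ((hnm u ^+ 2)%:E * (\sum_(k <oo) ((cmod '[v, pad I e k] ^+ 2)%:E)))%E).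
  by rewrite (parseval_eseries _ (pad_frame He)) -EFinM ltry.
rewrite -nneseriesZl; last by move=> *; rewrite lee_fin sqr_ge0.
apply: eq_eseriesr => k _; rewrite /rank_one hnmZ exprMn mulrC EFinM.
by rewrite ipC cmodJ.
Qed.

Lemma adjoint_rank_one u v : adjoint (rank_one u v) = rank_one v u.
Proof.
apply: (adjoint_unique He) => [|x y]; first exact: bop_rank_one.
by rewrite /rank_one ipZl ipZr -ipC mulrC.
Qed.

Lemma gram_rank_one u v : gram (rank_one u v) = (hnm u ^+ 2)%:C *: rank_one v v.
Proof.
rewrite /gram adjoint_rank_one; apply/funext => x /=.
by rewrite scaleopE /rank_one ipZl ipxx scalerA mulrC.
Qed.

Lemma rank_one_tc u v : trace_class (rank_one u v).
Proof.
split; first exact: bop_rank_one.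
exists I, e; split=> //.
have [->|vn0] := eqVneq v 0.
  have -> : rank_one u 0 = 0 by apply/funext => x; rewrite /rank_one ip0r scale0r.
  rewrite (opabs_pos He); last exact: positive0.
  by rewrite eseries0 ?ltry// => k _ _ /=; rewrite ip0l.
have nv : 0 < hnm v.
  by rewrite lt_def hnm_ge0 andbT; apply: contra_neqN vn0 => /eqP/hnm_eq0.
pose r := hnm u / hnm v; have r0 : 0 <= r by rewrite divr_ge0 ?hnm_ge0.
have pv : positive (rank_one v v : H -> H).
  split; first exact: bop_rank_one.
  by move=> x; rewrite /rank_one ipZl [X in _ * X]ipC mulcJ lecR sqr_ge0.
have -> : opabs (rank_one u v) = r%:C *: rank_one v v.
  apply: opsqrt_unique; first exact: positiveZ.
  rewrite -[adjoint _ \o _]/(gram (rank_one u v)) gram_rank_one; apply/funext => x /=.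
  rewrite !scaleopE /rank_one !ipZl ipxx !scalerA mulrA -!rmorphM /=.
  congr (_ *: _); rewrite ['[x, v] * _]mulrC mulrA -rmorphM /=.
  congr (_%:C * _).
  by rewrite /r; field; rewrite gt_eqF.
pose w := (Num.sqrt r / hnm v)%:C *: v.
have wE : hnm w ^+ 2 = r.
  rewrite hnmZ cmod_real ?divr_ge0 ?sqrtr_ge0 ?ltW//.
  by rewrite mulfVK ?gt_eqF// sqr_sqrtr.
by rewrite -wE -gram_rank_one; apply: gram_sum_lty; exact: hs_rank_one.
Qed.

Lemma is_trace_rank_one u v A : bounded_operator A ->
  is_trace (rank_one u v \o A) '[A u, v].
Proof.
move=> bA; have bT := bop_comp (bop_rank_one u v) bA.
apply: is_trace_frame => [|b hb]; first exact: bop_lin.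
have := @frame_ip _ _ b hb u (adjoint A v); rewrite -(adjointE He)//.
congr (ccvg _ _); apply/funext => n; apply: eq_bigr => k _.
by rewrite /= /rank_one ipZl (adjointE He)// mulrC.
Qed.

Lemma Tr_rank_one u v A : bounded_operator A ->
  Tr (rank_one u v \o A) = '[A u, v].
Proof. by move=> bA; apply: (is_traceE He); exact: is_trace_rank_one. Qed.

End TraceClass.

(** * Integration of complex functions and of positive operator functions *)

Section ComplexIntegration.
Context d {T : measurableType d} {R : realType}.
Variable mu : {measure set T -> \bar R}.
Implicit Types (g h : T -> R[i]) (E : set T).

Lemma cintegrableD E g h : measurable E -> cintegrable mu E g ->
  cintegrable mu E h -> cintegrable mu E (fun x => g x + h x).
Proof.
move=> mE [g1 g2] [h1 h2]; split.
  by under eq_fun do rewrite cReD EFinD; exact: integrableD.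
by under eq_fun do rewrite cImD EFinD; exact: integrableD.
Qed.

Lemma cintegrableZ E z g : measurable E -> cintegrable mu E g ->
  cintegrable mu E (fun x => z * g x).
Proof.
move=> mE [g1 g2]; split.
  under eq_fun do rewrite cReM EFinB !EFinM.
  by apply: integrableB => //; apply: integrableZl.
under eq_fun do rewrite cImM EFinD !EFinM.
by apply: integrableD => //; apply: integrableZl.
Qed.

Lemma cintegralD E g h : measurable E -> cintegrable mu E g ->
  cintegrable mu E h ->
  cintegral mu E (fun x => g x + h x) = cintegral mu E g + cintegral mu E h.
Proof.
move=> mE [g1 g2] [h1 h2]; apply: complex_eq; rewrite ?cReD ?cImD /=.
  under eq_integral do rewrite cReD EFinD.
  by rewrite integralD// fineD//; exact: integrable_fin_num.
under eq_integral do rewrite cImD EFinD.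
by rewrite integralD// fineD//; exact: integrable_fin_num.
Qed.

Lemma cintegralZ E z g : measurable E -> cintegrable mu E g ->
  cintegral mu E (fun x => z * g x) = z * cintegral mu E g.
Proof.
move=> mE [g1 g2]; apply: complex_eq; rewrite ?cReM ?cImM /=.
  under eq_integral do rewrite cReM EFinB !EFinM.
  rewrite integralB//; [|exact: integrableZl..].
  rewrite !integralZl// fineB ?fineM//; try exact: integrable_fin_num;
  by rewrite fin_numM//; exact: integrable_fin_num.
under eq_integral do rewrite cImM EFinD !EFinM.
rewrite integralD//; [|exact: integrableZl..].
rewrite !integralZl// fineD ?fineM//; try exact: integrable_fin_num;
by rewrite fin_numM//; exact: integrable_fin_num.
Qed.

Lemma Re_cintegral_ge0 E g : (forall x, 0 <= complex.Re (g x)) ->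
  0 <= complex.Re (cintegral mu E g).
Proof. by move=> g0; rewrite /= fine_ge0// integral_ge0// => x _; rewrite lee_fin. Qed.

Lemma le_Re_cintegral E g h : measurable E -> cintegrable mu E g ->
  cintegrable mu E h ->
  (forall x, complex.Re (g x) <= complex.Re (h x)) ->
  complex.Re (cintegral mu E g) <= complex.Re (cintegral mu E h).
Proof.
move=> mE [g1 _] [h1 _] gh /=; apply: fine_le; try exact: integrable_fin_num.
by apply: le_integral => // x _; rewrite lee_fin.
Qed.

Lemma cintegral_ge0 E g : (forall x, 0 <= g x) -> 0 <= cintegral mu E g.
Proof.
move=> g0; apply/ge0_complexP; split; last first.
  by apply: Re_cintegral_ge0 => x; have /ge0_complexP[] := g0 x.
rewrite /= (eq_integral (cst 0%E)); first by rewrite integral0.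
by move=> x _; have /ge0_complexP[-> _] := g0 x.
Qed.

End ComplexIntegration.

Section MoreTrace.
Context {R : realType} {H : hilbertType R}.
Variables (I : set nat) (e : nat -> H).
Hypothesis He : orthonormal_basis I e.
Implicit Types (A B a c d s p : H -> H) (x y u v : H) (b : nat -> H).
Local Notation hs := (hs I e).
Local Notation hsq := (hsq I e).

Lemma hsq_ge0 c : 0 <= hsq c.
Proof. by rewrite fine_ge0// hsum_ge0. Qed.

Lemma is_trace_gram c : hs c -> is_trace (gram c) (hsq c)%:C.
Proof.
move=> hc; have bc := hs_bop hc; apply: is_trace_frame => [|b hb].
  exact/bop_lin/positive_bop/(gram_hs_positive He).
apply/ccvg_ReIm; split.
  apply: eq_rcvg (hs_cvg He hc hb) => n.
  rewrite (big_morph (@complex.Re R) cReD (erefl _)); apply: eq_bigr => k _.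
  by rewrite /gram /= (adjointEl He)// Re_ipxx.
apply: eq_rcvg (rcvg_cst 0) => n.
rewrite (big_morph (@complex.Im R) cImD (erefl _)) big1// => k _.
by rewrite /gram /= (adjointEl He)// ipxx.
Qed.

Lemma hsq_eq0 c : hs c -> hsq c = 0 -> c = 0.
Proof.
move=> hc c0; have be := pad_frame He; have bc := hs_bop hc.
have lc := bop_lin bc.
have ck k : c (pad I e k) = 0.
  apply: hnm_eq0; apply/eqP; rewrite -sqrf_eq0; apply/eqP/le_anti.
  rewrite sqr_ge0 andbT -c0 -lee_fin /hsq fineK; last first.
    by rewrite ge0_fin_numE ?hsum_ge0//; case: hc.
  have : (forall n, (0 <= n)%N -> true ->
    (0%R <= (hnm (c (pad I e n)) ^+ 2)%:E)%E) by move=> *; rewrite lee_fin sqr_ge0.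
  move=> /(@nneseries_lim_ge R _ xpredT 0 k.+1); apply: le_trans.
  by rewrite big_nat_recr//= leeDr// sume_ge0// => *; rewrite lee_fin sqr_ge0.
apply/funext => x; apply: (hcvg_unique (op_cvg bc (be x))).
have := hcvg_cst (0 : H); congr (hcvg _ _); apply/funext => n.
by rewrite (op_sum lc) big1// => k _; rewrite (opZ lc) ck scaler0.
Qed.

(** Hypotheses made for states only pass to every c^* c by scaling. *)
Lemma gram_state c : hs c -> c <> 0 ->
  exists2 r : R, 0 < r & state (r%:C *: gram c).
Proof.
move=> hc c0; have q0 : 0 < hsq c.
  by rewrite lt_def hsq_ge0 andbT; apply/eqP => /(hsq_eq0 hc).
have qi0 : 0 <= (hsq c)^-1 by rewrite invr_ge0 ltW.
exists (hsq c)^-1; first by rewrite invr_gt0.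
split; first exact: (tc_gramZ He).
split; first exact/positiveZ/(gram_hs_positive He).
apply: (is_traceE He); rewrite (_ : 1 = ((hsq c)^-1)%:C * (hsq c)%:C).
  exact/is_traceZ/is_trace_gram.
by rewrite -rmorphM /= mulVf ?gt_eqF.
Qed.

Lemma tc_Tr_decomp s : trace_class s -> exists c1 c2 c3 c4,
  [/\ hs c1, hs c2, hs c3 & hs c4] /\ forall A, bounded_operator A ->
    Tr (s \o A) = 4^-1 * (Tr (gram c1 \o A) + (- 1) * Tr (gram c2 \o A) +
      'i * (Tr (gram c3 \o A) + (- 1) * Tr (gram c4 \o A))).
Proof.
move=> /(tc_decomp He)[c1 [c2 [c3 [c4 [[h1 h2 h3 h4] sE]]]]].
exists c1, c2, c3, c4; split=> // A bA; apply: (is_traceE He).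
have t c : hs c -> is_trace (gram c \o A) (Tr (gram c \o A)).
  by move=> hc; apply: (is_trace_tc He) => //; exact: (gram_tc He).
have -> : s \o A = 4^-1 *: ((gram c1 \o A) + (-1) *: (gram c2 \o A) +
    'i *: ((gram c3 \o A) + (-1) *: (gram c4 \o A))).
  by rewrite sE; apply/funext => x; rewrite !scaleN1r.
apply/is_traceZ/is_traceD; first by apply/is_traceD/is_traceZ; exact: t.
by apply/is_traceZ/is_traceD/is_traceZ; exact: t.
Qed.

End MoreTrace.

Section DyadicState.
Context {R : realType} {H : hilbertType R}.
Variables (I : set nat) (e : nat -> H).
Hypothesis He : orthonormal_basis I e.
Variable w : nat -> H.
Hypothesis w1 : forall n, hnm (w n) = 1.

Let dy (k : nat) : R := 2^-1 ^+ k.+1.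
Let dy_ge0 k : 0 <= dy k. Proof. by rewrite exprn_ge0// invr_ge0. Qed.
Let S n : H -> H := \sum_(k < n) (dy k)%:C *: rank_one (w k) (w k).

Let SE n x : S n x = \sum_(k < n) (dy k)%:C *: ('[x, w k] *: w k).
Proof. by elim: n => [|n IH]; rewrite /S ?big_ord0// !big_ord_recr /= -IH. Qed.

Let ip_self (r : R) (u x : H) : '[r%:C *: ('[x, u] *: u), x] = (r * cmod '[x, u] ^+ 2)%:C.
Proof. by rewrite !ipZl [X in _ * (_ * X)]ipC mulcJ -rmorphM. Qed.

(** s = sum_k 2^-(k+1) |w_k><w_k| dominates each of its terms. *)
Lemma dyadic_operator : exists s, [/\ positive s, trace_class s &
  forall n, positive (s - (dy n)%:C *: rank_one (w n) (w n)) /\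
    trace_class (s - (dy n)%:C *: rank_one (w n) (w n))].
Proof.
have bS n : bounded_operator (S n).
  apply: (bop_sum n (F := fun k => (dy k)%:C *: rank_one (w k) (w k))) => k.
  exact/bopZ/bop_rank_one.
have Sd m n x : (m <= n)%N -> hnm (S n x - S m x) <= (2^-1 ^+ m - 2^-1 ^+ n) * hnm x.
  elim: n => [|n IH]; first by rewrite leqn0 => /eqP ->; rewrite !subrr mul0r hnm0.
  rewrite leq_eqVlt => /orP[/eqP ->|]; first by rewrite !subrr mul0r hnm0.
  rewrite ltnS => mn; rewrite !SE big_ord_recr /= -!SE addrAC.
  rewrite (le_trans (hnmD _ _))// -(subrK (2^-1 ^+ n) (2^-1 ^+ m)) -addrA mulrDl.
  apply: lerD; first exact: IH.
  rewrite hnmZ hnmZ w1 mulr1 cmod_real//.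
  have -> : 2^-1 ^+ n - 2^-1 ^+ n.+1 = dy n by rewrite /dy exprS; field.
  by rewrite ler_wpM2l// (le_trans (ip_CS _ _))// w1 mulr1.
have hS n : opbound 1 (S n).
  move=> x; have := Sd 0 n x (leq0n n); rewrite {2}/S big_ord0 subr0.
  move=> /le_trans; apply; rewrite ler_wpM2r ?hnm_ge0// expr0 lerBlDr lerDl.
  by rewrite exprn_ge0// invr_ge0.
have half0 : (fun n => 2^-1 ^+ n : R) @ \oo --> (0 : R).
  by apply: cvg_expr; rewrite ger0_norm ?invr_ge0// invf_lt1 ?ltr1n.
have cS x : exists l, hcvg (fun n => S n x) l.
  apply: hcvg_cauchy => eps e0.
  have e1 : 0 < eps / (hnm x + 1) by rewrite divr_gt0// ltr_wpDl// hnm_ge0.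
  have /null_leP/(_ _ e1)[n|N hN] := half0; first by rewrite exprn_ge0// invr_ge0.
  exists N.
  suff aux m n : (N <= m)%N -> (m <= n)%N -> hnm (S n x - S m x) < eps.
    move=> m n Nm Nn; have [mn|/ltnW nm] := leqP m n; first exact: aux.
    by rewrite hnm_distC; exact: aux.
  move=> Nm mn; rewrite (le_lt_trans (Sd _ _ _ mn))//.
  have := hN _ Nm; rewrite ltr_pdivlMr ?ltr_wpDl ?hnm_ge0// => h.
  have x0 := hnm_ge0 x; have n0 : 0 <= 2^-1 ^+ n :> R by rewrite exprn_ge0// invr_ge0.
  have m0 : 0 <= 2^-1 ^+ m :> R by rewrite exprn_ge0// invr_ge0.
  by move: h; move: (2^-1 ^+ m) (2^-1 ^+ n) (hnm x) n0 m0 x0 => p q r; nra.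
have [s [bs _ hs]] := op_limit ler01 (fun n => bop_lin (bS n)) hS cS.
have Sip n x : '[S n x, x] = (\sum_(k < n) dy k * cmod '[x, w k] ^+ 2)%:C.
  rewrite SE ip_suml rmorph_sum; apply: eq_bigr => k _.
  exact: ip_self.
have sip x : (fun n => \sum_(k < n) dy k * cmod '[x, w k] ^+ 2) @ \oo -->
    complex.Re '[s x, x] /\ complex.Im '[s x, x] = 0.
  have /ccvg_ReIm[hR hI] := ip_cvg (hs x) (hcvg_cst x); split.
    by apply: eq_rcvg hR => n; rewrite Sip.
  by apply: (cvg_unique _ hI) => //; apply: eq_rcvg (rcvg_cst 0) => n; rewrite Sip.
have term_le n x : dy n * cmod '[x, w n] ^+ 2 <= complex.Re '[s x, x].
  have [h _] := sip x; rewrite -(cvg_lim _ h)//.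
  apply: le_trans (nondecreasing_cvgn_le _ _ n.+1).
  - by rewrite big_ord_recr lerDr sumr_ge0// => k _; rewrite mulr_ge0 ?sqr_ge0.
  - apply/nondecreasing_seqP => k; rewrite big_ord_recr lerDl.
    by rewrite mulr_ge0 ?sqr_ge0.
  - by apply/cvg_ex; eexists; exact: h.
have ps : positive s.
  split=> // x; apply/ge0_complexP; split; first by have [] := sip x.
  by rewrite (le_trans _ (term_le 0 x))// mulr_ge0 ?sqr_ge0.
have ss := positive_selfadj ps.
have be := pad_frame He; pose b := pad I e.
have sumE : (\sum_(k <oo) (complex.Re '[s (b k), b k])%:E = 1%:E)%E.
  transitivity (\sum_(k <oo) \sum_(j <oo) (dy j * cmod '[b k, w j] ^+ 2)%:E)%E.
    apply: eq_eseriesr => k _; apply/esym/eseries_cvg_real.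
    by have [] := sip (b k).
  rewrite nneseries_interchange; last by move=> *; rewrite lee_fin mulr_ge0 ?sqr_ge0.
  transitivity (\sum_(j <oo) (dy j)%:E)%E.
    apply: eq_eseriesr => j _.
    under eq_eseriesr do rewrite EFinM.
    rewrite nneseriesZl; last by move=> *; rewrite lee_fin sqr_ge0.
    rewrite (eq_eseriesr (g := fun k => (cmod '[w j, b k] ^+ 2)%:E)); last first.
      by move=> k _; rewrite ipC cmodJ.
    by rewrite (parseval_eseries _ be) w1 expr1n mule1.
  apply: eseries_cvg_real; have := rcvgB (rcvg_cst 1) half0; rewrite subr0.
  apply: eq_rcvg => n; elim: n => [|n IH]; first by rewrite big_ord0 expr0 subrr.
  by rewrite big_ord_recr /= -IH /dy exprS; field.
have padE (A : H -> H) : (\sum_(k <oo | k \in I) (complex.Re '[A (e k), e k])%:E =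
    \sum_(k <oo) (complex.Re '[A (b k), b k])%:E)%E.
  rewrite [LHS]eseries_mkcond; apply: eq_eseriesr => k _; rewrite /b /pad.
  by case: ifPn => // _; rewrite ip0r.
exists s; split=> // [|n].
  by apply: (positive_tc He ps He); rewrite padE sumE ltry.
have pn : positive (s - (dy n)%:C *: rank_one (w n) (w n)).
  apply: selfadj_positive.
  - exact/bopB/bopZ/bop_rank_one.
  - move=> x y; rewrite !subopE ipBl ipBr ss !scaleopE /rank_one !(ipZl, ipZr).
    by rewrite conj_real -(ipC (w n) y) ['[w n, y] * _]mulrC.
  - move=> x; rewrite subopE ipBl cReD cReN subr_ge0 scaleopE /rank_one ip_self.
    exact: term_le.
split=> //; apply: (positive_tc He pn He); rewrite padE.
apply: (@le_lt_trans _ _ 1%:E); last exact: ltry.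
rewrite -sumE; apply: lee_nneseries => [k _ _|k _].
  by rewrite lee_fin; exact: positive_ge0.
rewrite lee_fin subopE ipBl cReD cReN gerBl scaleopE /rank_one ip_self.
by rewrite /= mulr_ge0 ?sqr_ge0.
Qed.

End DyadicState.

Section PositiveIntegral.
Context d {T : measurableType d} {R : realType} {H : hilbertType R}.
Variable mu : {measure set T -> \bar R}.
Variables (I : set nat) (e : nat -> H).
Hypothesis He : orthonormal_basis I e.
Local Notation hs := (hs I e).
Variable G : T -> H -> H.
Hypothesis pG : forall x, positive (G x).
Hypothesis iG : forall s, state s ->
  cintegrable mu setT (fun x => Tr (s \o G x)).

Let bG x : bounded_operator (G x). Proof. exact: positive_bop. Qed.
Let mT : measurable [set: T]. Proof. exact: measurableT. Qed.

Lemma gram_integrable c : hs c ->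
  cintegrable mu setT (fun x => Tr (gram c \o G x)).
Proof.
move=> hc; have tc := gram_tc He hc; have [->|c0] := pselect (c = 0).
  have -> : (fun x => Tr (gram 0 \o G x)) = fun=> 0.
    apply/funext => x; apply: (is_traceE He) => J f _.
    have := @ccvg_cst R 0; congr (ccvg _ _); apply/funext => n.
    rewrite big1// => k _; rewrite /gram /= op0 ?ip0l//.
    exact/bop_lin/(bop_adjoint He)/bop0.
  by split; exact: integrable0.
have [r r0 sr] := gram_state He hc c0.
have := cintegrableZ (r^-1)%:C mT (iG sr); congr (cintegrable _ _ _).
apply/funext => x; rewrite (Tr_tcZl He)// mulrA -rmorphM /=.
by rewrite mulVf ?gt_eqF// mul1r.
Qed.

Lemma tc_integrable s : trace_class s ->
  cintegrable mu setT (fun x => Tr (s \o G x)).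
Proof.
move=> /(tc_Tr_decomp He)[c1 [c2 [c3 [c4 [[h1 h2 h3 h4] sE]]]]].
under eq_fun do rewrite sE//.
apply: cintegrableZ => //; apply: cintegrableD => //.
  apply: cintegrableD => //; first exact: gram_integrable.
  by apply: cintegrableZ => //; exact: gram_integrable.
apply: cintegrableZ => //; apply: cintegrableD => //.
  exact: gram_integrable.
by apply: cintegrableZ => //; exact: gram_integrable.
Qed.

Lemma ip_integrable u v : cintegrable mu setT (fun x => '[G x u, v]).
Proof.
have := tc_integrable (rank_one_tc He u v); congr (cintegrable _ _ _).
by apply/funext => x; rewrite (Tr_rank_one He).
Qed.

Definition int_form u v : R[i] := cintegral mu setT (fun x => '[G x u, v]).

Lemma int_form_pos : pos_form int_form.
Proof.
split=> [a x y z|a x y z|x].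
- rewrite /int_form -cintegralZ//; last exact: ip_integrable.
  rewrite -cintegralD//; [|apply: cintegrableZ => //|]; try exact: ip_integrable.
  by congr cintegral; apply/funext => t; rewrite (bop_lin (bG t)) ipDl ipZl.
- rewrite /int_form -cintegralZ//; last exact: ip_integrable.
  rewrite -cintegralD//; [|apply: cintegrableZ => //|]; try exact: ip_integrable.
  by congr cintegral; apply/funext => t; rewrite ipDr ipZr.
- by apply: cintegral_ge0 => t; case: (pG t).
Qed.

(** Were the form unbounded, there would be unit vectors w_n with
    2^-(n+1) B(w_n, w_n) > n; the integral of Tr (s G) for the operator
    s = sum_n 2^-(n+1) |w_n><w_n| would dominate all of them. *)
Lemma int_form_bounded : exists2 C : R, 0 <= C &
  forall u, complex.Re (int_form u u) <= C * hnm u ^+ 2.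
Proof.
apply: contrapT => /forall2NP nC.
have /choice[w hw] n : exists w : H, hnm w = 1 /\
    2 ^+ n.+1 * n%:R < complex.Re (int_form w w).
  have [h|/existsNP[u /negP]] := nC (2 ^+ n.+1 * n%:R).
    by case: h; rewrite mulr_ge0// exprn_ge0.
  rewrite -ltNge => hu.
  have u0 : 0 < hnm u.
    rewrite lt_def hnm_ge0 andbT; apply/eqP => /hnm_eq0 u0; move: hu.
    by rewrite u0 (pos_form0l int_form_pos) hnm0 expr0n mulr0 ltxx.
  exists ((hnm u)^-1%:C *: u).
  have ui : 0 <= (hnm u)^-1 by rewrite invr_ge0 ltW.
  split; first by rewrite hnmZ cmod_real// mulVf ?gt_eqF.
  rewrite (pos_formZl int_form_pos) (pos_formZr int_form_pos) conj_real !cReZ.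
  by rewrite mulrA -expr2 exprVn -ltr_pdivrMl ?invr_gt0 ?exprn_gt0// invrK mulrC.
have [s [ps ts hs']] := dyadic_operator He (fun n => proj1 (hw n)).
set K := complex.Re (cintegral mu setT (fun x => Tr (s \o G x))).
suff hK n : n%:R < K.
  have := hK (Num.truncn K).+1; rewrite ltNge => /negP; apply.
  have K0 : 0 <= K.
    apply: Re_cintegral_ge0 => x.
    by have /ge0_complexP[] := tc_Tr_ge0 He ps ts (pG x).
  by have /andP[_ /ltW] := truncn_itv K0.
have [_ hwn] := hw n; have [pn tn] := hs' n.
set r := 2^-1 ^+ n.+1 in pn tn.
have r0 : 0 <= r by rewrite exprn_ge0// invr_ge0.
apply: (@lt_le_trans _ _ (r * complex.Re (int_form (w n) (w n)))).
  rewrite /r exprVn -ltr_pdivrMl ?invr_gt0 ?exprn_gt0//.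
  by rewrite invrK.
rewrite -cReZ -cintegralZ//; last exact: ip_integrable.
apply: le_Re_cintegral => //.
- by apply: cintegrableZ => //; exact: ip_integrable.
- exact: tc_integrable.
move=> x; rewrite -[in leRHS](subrK (r%:C *: rank_one (w n) (w n)) s).
have tr : trace_class (r%:C *: rank_one (w n) (w n)).
  rewrite -[X in X%:C *: _](_ : hnm ((Num.sqrt r)%:C *: w n) ^+ 2 = r).
    by rewrite -(gram_rank_one He); apply: (gram_tc He); exact: (hs_rank_one He).
  rewrite hnmZ (proj1 (hw n)) mulr1 cmod_real ?sqrtr_ge0// sqr_sqrtr//.
rewrite (Tr_tcDl He)// (Tr_tcZl He)//; last exact: (rank_one_tc He).
rewrite (Tr_rank_one He)// cReD lerDr.
by have /ge0_complexP[] := tc_Tr_ge0 He pn tn (pG x).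
Qed.

(** Riesz turns the bounded form int <G u, v> into Q. For s = c^* c both sides of
    the trace identity are sums over the vectors c^* b_k of nonnegative terms, and
    sum and integral may be exchanged; a general s is a combination of four such
    operators. *)
Lemma positive_integral : exists Q, bounded_operator Q /\
  forall s, trace_class s -> Tr (s \o Q) = cintegral mu setT (fun x => Tr (s \o G x)).
Proof.
have [C C0 hC] := int_form_bounded.
have fE := int_form_pos.
have [|||Q [bQ hQ]] := @riesz_form _ _ _ _ He int_form C C0.
- by case: fE.
- by case: fE.
- move=> x y; rewrite -(@ler_pXn2r _ 2)// ?nnegrE ?mulr_ge0 ?cmod_ge0 ?hnm_ge0//.
  rewrite (le_trans (pos_form_CS fE x y))// !exprMn.
  apply: (@le_trans _ _ ((C * hnm x ^+ 2) * (C * hnm y ^+ 2))).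
    by rewrite ler_pM//; have /ge0_complexP[] := pos_form_ge0 fE x;
      have /ge0_complexP[] := pos_form_ge0 fE y.
  by rewrite le_eqVlt; apply/orP; left; apply/eqP; ring.
exists Q; split=> //.
have pQ : positive Q by split=> // x; rewrite hQ; exact: pos_form_ge0.
have gramE c : hs c ->
    Tr (gram c \o Q) = cintegral mu setT (fun x => Tr (gram c \o G x)).
  move=> hc; have be := pad_frame He; pose v k := adjoint c (pad I e k).
  apply: complex_eq; last first.
    have /ge0_complexP[-> _] := Tr_gram_ge0 He hc pQ.
    have : 0 <= cintegral mu setT (fun x => Tr (gram c \o G x)).
      by apply: cintegral_ge0 => x; exact: (Tr_gram_ge0 He).
    by move=> /ge0_complexP[].
  have sE A : positive A -> (\sum_(k <oo) (complex.Re '[A (v k), v k])%:E)%E =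
      (complex.Re (Tr (gram c \o A)))%:E.
    move=> pA; apply: eseries_cvg_real.
    have /ccvg_ReIm[h _] := Tr_gram He hc (positive_bop pA) be.
    by apply: eq_rcvg h => n; rewrite (big_morph (@complex.Re R) cReD (erefl _)).
  apply: EFin_inj; rewrite -sE// /=.
  have -> : (\int[mu]_x (complex.Re (Tr (gram c \o G x)))%:E =
      \int[mu]_x \sum_(k <oo) (complex.Re '[G x (v k), v k])%:E)%E.
    by apply: eq_integral => x _; rewrite sE.
  rewrite integral_nneseries//; last 2 first.
  - by move=> k; have [/measurable_int] := ip_integrable (v k) (v k).
  - by move=> k x _; rewrite lee_fin; exact: positive_ge0.
  have -> : (\sum_(k <oo) \int[mu]_x (complex.Re '[G x (v k), v k])%:E =
      \sum_(k <oo) (complex.Re '[Q (v k), v k])%:E)%E.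
    apply: eq_eseriesr => k _; rewrite hQ /= fineK//.
    by have [h _] := ip_integrable (v k) (v k); exact: integrable_fin_num h.
  by rewrite sE.
move=> s /(tc_Tr_decomp He)[c1 [c2 [c3 [c4 [[h1 h2 h3 h4] sE]]]]].
have g := gram_integrable.
rewrite sE// !gramE//.
rewrite (_ : (fun x => Tr (s \o G x)) = fun x => 4^-1 *
    (Tr (gram c1 \o G x) + -1 * Tr (gram c2 \o G x) +
     'i * (Tr (gram c3 \o G x) + -1 * Tr (gram c4 \o G x)))); last first.
  by apply/funext => x; rewrite sE.
rewrite -(cintegralZ (-1) mT (g _ h2)) -(cintegralZ (-1) mT (g _ h4)).
have g2 := cintegrableZ (-1) mT (g _ h2); have g4 := cintegrableZ (-1) mT (g _ h4).
rewrite -(cintegralD mT (g _ h1) g2) -(cintegralD mT (g _ h3) g4).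
have g12 := cintegrableD mT (g _ h1) g2; have g34 := cintegrableD mT (g _ h3) g4.
have g34' := cintegrableZ 'i mT g34.
by rewrite -(cintegralZ 'i mT g34) -(cintegralD mT g12 g34') -(cintegralZ _ mT (cintegrableD mT g12 g34')).
Qed.

End PositiveIntegral.

(** * Measurability of operator functions *)

Section DenseSequence.
Context {R : realType} {H : hilbertType R}.
Variables (I : set nat) (e : nat -> H).
Hypothesis He : orthonormal_basis I e.
Let b := pad I e.

Let gridN (m : nat) : R := m.+1%:R ^+ 2.
Let gridN_gt0 m : 0 < gridN m. Proof. by rewrite exprn_gt0// ltr0n. Qed.

(** Combinations of the first m basis vectors with coefficients in
    (Z + iZ) / (m+1)^2. *)
Definition grid_coef (m : nat) (z : int * int) : R[i] :=
  (z.1%:~R / m.+1%:R ^+ 2) +i* (z.2%:~R / m.+1%:R ^+ 2).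

Definition grid_vec (m : nat) (l : seq (int * int)) : H :=
  \sum_(k < m) grid_coef m (nth (0, 0) l k) *: b k.

Definition grid_seq (n : nat) : H :=
  if @unpickle (nat * seq (int * int))%type n is Some ml
  then grid_vec ml.1 ml.2 else 0.

Let floorZ (m : nat) (z : R[i]) : int * int :=
  (Num.floor (complex.Re z * gridN m), Num.floor (complex.Im z * gridN m)).

Let floor_dist m z : cmod (grid_coef m (floorZ m z) - z) <= 2 / gridN m.
Proof.
have fl (r : R) : `|(Num.floor (r * gridN m))%:~R / gridN m - r| <= (gridN m)^-1.
  have := floor_itv (r * gridN m); set k := (Num.floor _)%:~R.
  move=> /andP[h1]; rewrite intrD -/k => h2.
  have -> : k / gridN m - r = (k - r * gridN m) / gridN m.
    by field; rewrite gt_eqF.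
  rewrite normrM [X in _ * X]gtr0_norm ?invr_gt0// -[leRHS]mul1r.
  by rewrite ler_wpM2r ?invr_ge0 ?(ltW (gridN_gt0 m))// ler_norml; apply/andP; split; lra.
rewrite (le_trans (cmod_le _))// cReD cImD cReN cImN /=.
by rewrite [2]mulr2n mulrDl mul1r lerD.
Qed.

Let hnm_b k : hnm (b k) <= 1.
Proof.
rewrite -(@ler_pXn2r _ 2) ?nnegrE ?hnm_ge0// expr1n -Re_ipxx (pad_orthogonal He) eqxx /=.
by case: (k \in I).
Qed.

Lemma grid_dense u : exists n : nat -> nat, hcvg (fun m => grid_seq (n m)) u.
Proof.
pose l m := mkseq (fun k => floorZ m '[u, b k]) m.
exists (fun m => pickle (m, l m)).
have E m : grid_seq (pickle (m, l m)) = grid_vec m (l m).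
  by rewrite /grid_seq pickleK.
have grid0 : (fun m => 2 * m.+1%:R^-1 : R) @ \oo --> (0 : R).
  by apply: nullZ; exact: cvg_harmonic.
have h := nullD (pad_frame He u) grid0.
apply: null_le h => m; rewrite hnm_ge0 /= E.
set v := \sum_(k < m) '[u, pad I e k] *: pad I e k.
have -> : grid_vec m (l m) - u = (v - u) + (grid_vec m (l m) - v).
  by rewrite [RHS]addrC addrA subrK.
apply: (le_trans (hnmD _ _)); rewrite lerD2l.
have -> : grid_vec m (l m) - v =
    \sum_(k < m) (grid_coef m (floorZ m '[u, b k]) - '[u, b k]) *: b k.
  rewrite /grid_vec /v -sumrB; apply: eq_bigr => k _.
  by rewrite nth_mkseq// scalerBl.
apply: (le_trans (hnm_sum m
  (fun k => (grid_coef m (floorZ m '[u, b k]) - '[u, b k]) *: b k))).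
apply: (@le_trans _ _ (\sum_(k < m) (2 / gridN m))).
  apply: ler_sum => k _; rewrite hnmZ -[leRHS]mulr1 ler_pM ?cmod_ge0 ?hnm_ge0//.
rewrite sumr_const card_ord -[X in X <= _]mulr_natl /gridN expr2 invfM.
have m1 : 0 < m.+1%:R :> R by rewrite ltr0n.
rewrite mulrCA ler_wpM2l// mulrA ler_piMl ?invr_ge0 ?(ltW m1)//.
by rewrite ler_pdivrMr// mul1r ler_nat.
Qed.

Lemma hnm_grid_cvg u (n : nat -> nat) : hcvg (fun m => grid_seq (n m)) u ->
  (fun m => hnm (grid_seq (n m)) ^+ 2) @ \oo --> hnm u ^+ 2.
Proof.
move=> h; have /ccvg_ReIm[+ _] := ip_cvg h h; rewrite Re_ipxx.
by apply: eq_rcvg => m; rewrite Re_ipxx.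
Qed.

Lemma grid_form_cvg A u (n : nat -> nat) : bounded_operator A ->
  hcvg (fun m => grid_seq (n m)) u ->
  ccvg (fun m => '[A (grid_seq (n m)), grid_seq (n m)]) '[A u, u].
Proof. by move=> bA h; apply: (ip_cvg _ h); exact: op_cvg bA h. Qed.

(** Countably many inequalities decide positivity and norm bounds, which makes
    these conditions measurable. *)
Lemma grid_positive A : bounded_operator A ->
  (forall n, 0 <= '[A (grid_seq n), grid_seq n]) -> positive A.
Proof.
move=> bA hA; split=> // u; have [n hn] := grid_dense u.
have /ccvg_ReIm[hR hI] := grid_form_cvg bA hn.
have hA' m : complex.Im '[A (grid_seq (n m)), grid_seq (n m)] = 0 /\
    0 <= complex.Re '[A (grid_seq (n m)), grid_seq (n m)] by apply/ge0_complexP.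
apply/ge0_complexP; split.
  apply: (cvg_unique _ hI) => //; apply: eq_rcvg (rcvg_cst 0) => m.
  by have [-> _] := hA' m.
by apply: (rcvg_le _ (rcvg_cst 0) hR) => m; have [] := hA' m.
Qed.

Lemma grid_bound A (M : R) : positive A -> 0 <= M ->
  (forall n, complex.Re '[A (grid_seq n), grid_seq n] <= M * hnm (grid_seq n) ^+ 2) ->
  opbound M A.
Proof.
move=> pA M0 hA; apply: positive_opbound => // u; have [n hn] := grid_dense u.
have /ccvg_ReIm[hR _] := grid_form_cvg (positive_bop pA) hn.
exact: (rcvg_le (fun m => hA (n m))) hR (rcvgZ M (hnm_grid_cvg hn)).
Qed.

End DenseSequence.

Section Measurability.
Context d {T : measurableType d} {R : realType} {H : hilbertType R}.
Variables (I : set nat) (e : nat -> H).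
Hypothesis He : orthonormal_basis I e.
Implicit Types (g h : T -> R[i]) (F K : T -> H -> H) (u v : H).
Let b := pad I e.

Definition cmeas g := measurable_fun setT (fun x => complex.Re (g x)) /\
  measurable_fun setT (fun x => complex.Im (g x)).

Lemma cmeas_cst z : cmeas (fun=> z).
Proof. by split; exact: measurable_cst. Qed.

Lemma cmeasD g h : cmeas g -> cmeas h -> cmeas (fun x => g x + h x).
Proof.
move=> [g1 g2] [h1 h2]; split.
  by under eq_fun do rewrite cReD; exact: measurable_funD.
by under eq_fun do rewrite cImD; exact: measurable_funD.
Qed.

Lemma cmeasM g h : cmeas g -> cmeas h -> cmeas (fun x => g x * h x).
Proof.
move=> [g1 g2] [h1 h2]; split.
  under eq_fun do rewrite cReM.
  by apply: measurable_funB; exact: measurable_funM.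
under eq_fun do rewrite cImM.
by apply: measurable_funD; exact: measurable_funM.
Qed.

Lemma cmeasJ g : cmeas g -> cmeas (fun x => (g x)^*).
Proof.
move=> [g1 g2]; split; first by under eq_fun do rewrite cReJ.
by under eq_fun do rewrite cImJ; exact: measurable_funN.
Qed.

Lemma cmeas_sum n (g : nat -> T -> R[i]) : (forall k, cmeas (g k)) ->
  cmeas (fun x => \sum_(k < n) g k x).
Proof.
move=> hg; elim: n => [|n IH].
  by under eq_fun do rewrite big_ord0; exact: cmeas_cst.
by under eq_fun do rewrite big_ord_recr; exact: cmeasD.
Qed.

Lemma cmeas_lim (g : nat -> T -> R[i]) h : (forall n, cmeas (g n)) ->
  (forall x, ccvg (fun n => g n x) (h x)) -> cmeas h.
Proof.
move=> mg gh; split.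
  apply: (@measurable_fun_cvg _ _ _ _ (fun n x => complex.Re (g n x))).
    by move=> n; case: (mg n).
  by move=> x _; have /ccvg_ReIm[] := gh x.
apply: (@measurable_fun_cvg _ _ _ _ (fun n x => complex.Im (g n x))).
  by move=> n; case: (mg n).
by move=> x _; have /ccvg_ReIm[] := gh x.
Qed.

(** Measurability of all matrix entries; expansion in a basis shows that it is
    preserved by products, adjoints and traces. *)
Definition wmeas F := forall u v, cmeas (fun x => '[F x u, v]).

Lemma wmeas_cst A : wmeas (fun=> A).
Proof. by move=> u v; exact: cmeas_cst. Qed.

Lemma wmeasD F K : wmeas F -> wmeas K -> wmeas (fun x => F x + K x).
Proof.
move=> mF mK u v; under eq_fun do rewrite addopE ipDl.
by apply: cmeasD; [exact: mF|exact: mK].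
Qed.

Lemma wmeasZ g F : cmeas g -> wmeas F -> wmeas (fun x => g x *: F x).
Proof.
move=> mg mF u v; under eq_fun do rewrite scaleopE ipZl.
by apply: cmeasM => //; exact: mF.
Qed.

Lemma wmeasB F K : wmeas F -> wmeas K -> wmeas (fun x => F x - K x).
Proof.
move=> mF mK; apply: wmeasD => //.
have := wmeasZ (cmeas_cst (-1)) mK.
by under eq_fun do rewrite scaleN1r.
Qed.

Lemma wmeas_comp F K : (forall x, bounded_operator (F x)) ->
  wmeas F -> wmeas K -> wmeas (fun x => F x \o K x).
Proof.
move=> bF mF mK u v.
apply: (cmeas_lim (g := fun n x => \sum_(k < n) '[K x u, b k] * '[F x (b k), v])).
  move=> n; apply: (cmeas_sum n (g := fun k x => '[K x u, b k] * '[F x (b k), v])).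
  by move=> k; apply: cmeasM; [exact: mK|exact: mF].
move=> x; have := @frame_ip _ _ _ (pad_frame He) (K x u) (adjoint (F x) v).
rewrite -(adjointE He)//; congr (ccvg _ _); apply/funext => n.
by apply: eq_bigr => k _; rewrite -(adjointE He).
Qed.

Lemma wmeas_adjoint F : (forall x, bounded_operator (F x)) ->
  wmeas F -> wmeas (fun x => adjoint (F x)).
Proof.
move=> bF mF u v; have := cmeasJ (mF v u); congr cmeas.
by apply/funext => x; rewrite (adjointEl He)// -ipC.
Qed.

Lemma wmeas_lim (F : nat -> T -> H -> H) K : (forall n, wmeas (F n)) ->
  (forall x u, hcvg (fun n => F n x u) (K x u)) -> wmeas K.
Proof.
move=> mF FK u v; apply: (cmeas_lim (g := fun n x => '[F n x u, v])).
  by move=> n; exact: mF.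
by move=> x; apply: ip_cvg; [exact: FK|exact: hcvg_cst].
Qed.

Lemma bop_sqrt_iter (B : H -> H) n : bounded_operator B ->
  bounded_operator (sqrt_iter B n).
Proof.
by move=> bB; elim: n => [|n IH] /=; [exact: bop0|apply/bopZ/bopD => //; exact: bop_comp].
Qed.

Lemma wmeas_sqrt_iter F n : (forall x, bounded_operator (F x)) -> wmeas F ->
  wmeas (fun x => sqrt_iter (F x) n).
Proof.
move=> bF mF; elim: n => [|n IH] /=; first exact: wmeas_cst.
apply: wmeasZ; first exact: cmeas_cst.
apply: wmeasD => //; apply: wmeas_comp => // x; exact: bop_sqrt_iter.
Qed.

(** The square root is measurable on uniformly bounded functions, being a
    limit of polynomials. *)
Lemma wmeas_opsqrt_bounded F (M : R) : 0 < M -> (forall x, positive (F x)) ->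
  (forall x, opbound M (F x)) -> wmeas F -> wmeas (fun x => opsqrt (F x)).
Proof.
move=> M0 pF hF mF.
apply: (wmeas_lim (F := fun n x => sqrt_approx M (F x) n)); last first.
  by move=> x u; exact: opsqrt_lim.
move=> n.
have -> : (fun x => sqrt_approx M (F x) n) =
    fun x => (Num.sqrt M)%:C *: (id - sqrt_iter (id - (M^-1)%:C *: F x) n) by [].
apply: wmeasZ; first exact: cmeas_cst.
apply: wmeasB; first exact: wmeas_cst.
apply: wmeas_sqrt_iter => [x|].
  by apply/(bopB bop_id)/bopZ; exact: positive_bop.
apply: wmeasB; first exact: wmeas_cst.
by apply: wmeasZ => //; exact: cmeas_cst.
Qed.

Let q := grid_seq I e.

Lemma measurable_positive_le F (M : R) : wmeas F ->
  measurable [set x | forall n, 0 <= '[F x (q n), q n] /\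
    complex.Re '[F x (q n), q n] <= M * hnm (q n) ^+ 2].
Proof.
move=> mF.
have -> : [set x | forall n, 0 <= '[F x (q n), q n] /\
    complex.Re '[F x (q n), q n] <= M * hnm (q n) ^+ 2] =
  \bigcap_n ([set x | complex.Im '[F x (q n), q n] == 0] `&`
    [set x | 0 <= complex.Re '[F x (q n), q n]] `&`
    [set x | complex.Re '[F x (q n), q n] <= M * hnm (q n) ^+ 2]).
  apply/seteqP; split=> x /= h n.
    by move=> _; have [/ge0_complexP[h1 h2] h3] := h n; split=> //; split=> //; apply/eqP.
  by have [[/eqP h1 h2] h3] := h n Logic.I; split=> //; apply/ge0_complexP.
have mc (c : R) : measurable_fun setT (fun _ : T => c) by exact: measurable_cst.
have mb : measurable [set true] by [].
apply: bigcapT_measurable => n; have [mR mI] := mF (q n) (q n).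
apply: measurableI; first apply: measurableI.
- have := measurable_fun_eqr mI (mc 0) measurableT mb.
  by rewrite setTI.
- have := measurable_fun_ler (mc 0) mR measurableT mb.
  by rewrite setTI.
- have := measurable_fun_ler mR (mc (M * hnm (q n) ^+ 2)) measurableT mb.
  by rewrite setTI.
Qed.

(** Cutting F off outside the measurable sets X_N where it is positive with norm at
    most N+1 reduces to the bounded case; where F is not positive its square root
    is 0. *)
Lemma wmeas_opsqrt F : (forall x, bounded_operator (F x)) -> wmeas F ->
  wmeas (fun x => opsqrt (F x)).
Proof.
move=> bF mF.
pose X N := [set x | forall n, 0 <= '[F x (q n), q n] /\
    complex.Re '[F x (q n), q n] <= N.+1%:R * hnm (q n) ^+ 2].
have mX N : measurable (X N) by exact: measurable_positive_le.
have XE N x : X N x <-> positive (F x) /\ opbound N.+1%:R (F x).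
  split=> [h|[pF hF] n]; last first.
    split; first by case: pF.
    rewrite (le_trans (ler_norm _))// (le_trans (Re_le_cmod _))//.
    rewrite (le_trans (ip_CS _ _))// expr2 mulrA ler_wpM2r ?hnm_ge0//.
  have pF : positive (F x) by apply: (grid_positive He) => // n; have [] := h n.
  by split=> //; apply: (grid_bound He) => // n; have [] := h n.
pose FN N x : H -> H := (\1_(X N) x)%:C *: F x.
have FN1 N x : X N x -> FN N x = F x.
  by move=> Xx; rewrite /FN indicE mem_set// scale1r.
have FN0 N x : ~ X N x -> FN N x = 0.
  by move=> Xx; rewrite /FN indicE memNset// scale0r.
have pFN N x : positive (FN N x).
  have [Xx|nX] := pselect (X N x); first by rewrite FN1//; have [] := proj1 (XE N x) Xx.
  by rewrite FN0//; exact: positive0.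
have hFN N x : opbound N.+1%:R (FN N x).
  have [Xx|nX] := pselect (X N x); first by rewrite FN1//; have [] := proj1 (XE N x) Xx.
  by rewrite FN0// => y; rewrite hnm0 mulr_ge0// hnm_ge0.
have mFN N : wmeas (FN N).
  apply: wmeasZ => //; split=> /=; last exact: measurable_cst.
  exact: measurable_indic.
apply: (wmeas_lim (F := fun N x => opsqrt (FN N x))) => [N|x u].
  exact: (wmeas_opsqrt_bounded (M := N.+1%:R)).
have [pF|nF] := pselect (positive (F x)); last first.
  have E N : opsqrt (FN N x) = 0.
    rewrite FN0; last by move=> /XE[].
    apply: opsqrt_unique; first exact: positive0.
    by apply/funext.
  rewrite opsqrt0_nonpos//; have := @hcvg_cst R H 0; congr (hcvg _ _).
  by apply/funext => N; rewrite E.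
have [M M0 hM] := opbound_gt0 (bF x).
have XN N : M <= N.+1%:R -> X N x.
  by move=> MN; apply/XE; split=> //; exact: opbound_le hM.
apply/null_leP => [N|eps e0]; first exact: hnm_ge0.
exists (Num.truncn M) => N MN; rewrite FN1 ?subrr ?hnm0//.
apply: XN; have /andP[_ /ltW/le_trans] := truncn_itv (ltW M0); apply.
by rewrite ler_nat.
Qed.

Lemma wmeas_opabs F : (forall x, bounded_operator (F x)) -> wmeas F ->
  wmeas (fun x => opabs (F x)).
Proof.
move=> bF mF; have bA x : bounded_operator (adjoint (F x)) by exact: (bop_adjoint He).
apply: wmeas_opsqrt => [x|]; first exact: bop_comp.
by apply: wmeas_comp => //; exact: wmeas_adjoint.
Qed.

Lemma wmeas_pos_part F : (forall x, bounded_operator (F x)) -> wmeas F ->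
  wmeas (fun x => pos_part (F x)).
Proof.
move=> bF mF; apply: wmeasZ; first exact: cmeas_cst.
by apply: wmeasD => //; exact: wmeas_opabs.
Qed.

Lemma wmeas_neg_part F : (forall x, bounded_operator (F x)) -> wmeas F ->
  wmeas (fun x => neg_part (F x)).
Proof.
move=> bF mF; apply: wmeasZ; first exact: cmeas_cst.
by apply: wmeasB => //; exact: wmeas_opabs.
Qed.

Lemma wmeas_Reop F : (forall x, bounded_operator (F x)) -> wmeas F ->
  wmeas (fun x => Reop (F x)).
Proof.
move=> bF mF; apply: wmeasZ; first exact: cmeas_cst.
by apply: wmeasD => //; exact: wmeas_adjoint.
Qed.

Lemma wmeas_Imop F : (forall x, bounded_operator (F x)) -> wmeas F ->
  wmeas (fun x => Imop (F x)).
Proof.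
move=> bF mF; apply: wmeasZ; first exact: cmeas_cst.
by apply: wmeasB => //; exact: wmeas_adjoint.
Qed.

Lemma cmeas_Tr F s : trace_class s -> (forall x, bounded_operator (F x)) ->
  wmeas F -> cmeas (fun x => Tr (s \o F x)).
Proof.
move=> ts bF mF; have bs := tc_bop ts.
apply: (cmeas_lim (g := fun n x => \sum_(k < n) '[F x (b k), adjoint s (b k)])).
  move=> n; apply: (cmeas_sum n (g := fun k x => '[F x (b k), adjoint s (b k)])).
  by move=> k; exact: mF.
move=> x; have := @is_trace_tc _ _ _ _ He s (F x) ts (bF x) I e He.
congr (ccvg _ _); apply/funext => n.
rewrite (pad_sum I e n (F := fun v => '[(s \o F x) v, v])) ?ip0r//.
by apply: eq_bigr => k _; rewrite /= (adjointE He).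
Qed.

(** A quantum random variable is weakly measurable: test it on the states
    |u><u| / |u|^2 and polarise. *)
Lemma wmeas_states F : (forall x, bounded_operator (F x)) ->
  (forall s, state s -> cmeas (fun x => Tr (s \o F x))) -> wmeas F.
Proof.
move=> bF mF u v.
have gm c : hs I e c -> cmeas (fun x => Tr (gram c \o F x)).
  move=> hc; have tc := gram_tc He hc; have [->|c0] := pselect (c = 0).
    have -> : (fun x => Tr (gram 0 \o F x)) = fun=> 0; last exact: cmeas_cst.
    apply/funext => x; apply: (is_traceE He) => J f _.
    have := @ccvg_cst R 0; congr (ccvg _ _); apply/funext => n.
    rewrite big1// => k _; rewrite /gram /= op0 ?ip0l//.
    exact/bop_lin/(bop_adjoint He)/bop0.
  have [r r0 sr] := gram_state He hc c0.
  have := cmeasM (cmeas_cst (r^-1)%:C) (mF _ sr); congr cmeas.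
  apply/funext => x; rewrite (Tr_tcZl He)// mulrA -rmorphM /=.
  by rewrite mulVf ?gt_eqF// mul1r.
have [c1 [c2 [c3 [c4 [[h1 h2 h3 h4] sE]]]]] := tc_Tr_decomp He (rank_one_tc He u v).
under eq_fun do rewrite -(Tr_rank_one He)// sE//.
apply: cmeasM; first exact: cmeas_cst.
apply: cmeasD; first by apply: cmeasD; [|apply: cmeasM; first exact: cmeas_cst]; exact: gm.
apply: cmeasM; first exact: cmeas_cst.
by apply: cmeasD; [|apply: cmeasM; first exact: cmeas_cst]; exact: gm.
Qed.

End Measurability.

(** * Finite measures, almost everywhere equality and densities *)

Section MeasureFromSetFunction.
Context d {T : measurableType d} {R : realType}.
Variable mu : set T -> \bar R.
Local Open Scope ereal_scope.
Hypothesis mu_ge0 : forall E, measurable E -> 0 <= mu E.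
Hypothesis mu_lty : mu setT < +oo.
Hypothesis mu_sigma : forall F : nat -> set T, (forall n, measurable (F n)) ->
  trivIset setT F ->
  (fun n => \sum_(0 <= k < n) mu (F k)) @ \oo --> mu (\bigcup_k F k).
Hypothesis mu_0 : mu set0 = 0.

(** mu may take any value off the sigma-algebra, where a measure must still be
    nonnegative: there it is replaced by 0. *)
Definition measurable_part E := if `[< measurable E >] then mu E else 0.

Let part0 : measurable_part set0 = 0.
Proof. by rewrite /measurable_part; case: ifP. Qed.
Let part_ge0 E : 0 <= measurable_part E.
Proof. by rewrite /measurable_part; case: asboolP => // /mu_ge0. Qed.
Let part_sigma : semi_sigma_additive measurable_part.
Proof.
move=> F mF tF mUF; rewrite /measurable_part asboolT//.
rewrite [X in X @ _ --> _](_ : _ = (fun n => \sum_(0 <= k < n) mu (F k))).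
  exact: mu_sigma.
by apply/funext => n; apply: eq_bigr => k _; rewrite asboolT.
Qed.
HB.instance Definition _ := isMeasure.Build _ _ _ measurable_part
  part0 part_ge0 part_sigma.
Let part_finite : measurable_part setT < +oo.
Proof. by rewrite /measurable_part asboolT//; exact: measurableT. Qed.
HB.instance Definition _ := Measure_isFinite.Build _ _ _ measurable_part
  (@lty_fin_num_fun _ _ _ measurable_part part_finite).

Lemma finite_measure_of : exists m : {finite_measure set T -> \bar R},
  forall E, measurable E -> mu E = m E.
Proof.
exists measurable_part => E mE.
by rewrite /= /measurable_part asboolT.
Qed.
End MeasureFromSetFunction.

Section RawIntegral.
Context d {T : measurableType d} {R : realType}.
Implicit Types m : set T -> \bar R.
Import HBNNSimple.

(** nu_rho is a set function whose values off the sigma-algebra are arbitrary;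
    integrals, suprema over simple functions, do not see them. *)
Lemma eq_raw_integral m1 m2 (D : set T) (f : T -> \bar R) :
  (forall E, measurable E -> m1 E = m2 E) ->
  (\int[m1]_(x in D) f x = \int[m2]_(x in D) f x)%E.
Proof.
move=> m12; have sE (h : {nnsfun T >-> R}) : sintegral m1 h = sintegral m2 h.
  by apply: eq_fsbigr => r _; rewrite m12.
by rewrite /integral; congr (ereal_sup _ - ereal_sup _)%E; apply/seteqP;
  split=> _ [h hf <-]; exists h.
Qed.

Lemma eq_cintegral m1 m2 D (g : T -> R[i]) :
  (forall E, measurable E -> m1 E = m2 E) ->
  cintegral m1 D g = cintegral m2 D g.
Proof. by move=> m12; rewrite /cintegral !(eq_raw_integral _ _ m12). Qed.

Lemma eq_cintegrable m1 m2 D (g : T -> R[i]) :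
  (forall E, measurable E -> m1 E = m2 E) ->
  cintegrable m1 D g = cintegrable m2 D g.
Proof.
move=> m12; rewrite /cintegrable; congr (_ /\ _); rewrite !unlock;
by rewrite (eq_raw_integral _ _ m12).
Qed.

End RawIntegral.

Section NullSets.
Context d {T : measurableType d} {R : realType}.
Variable m : {measure set T -> \bar R}.

Lemma cmeas_cintegrable g : cintegrable m setT g -> cmeas g.
Proof.
by move=> [/measurable_int h1 /measurable_int h2]; split;
  [move/measurable_EFinP: h1|move/measurable_EFinP: h2].
Qed.

(** Over the set where g < 0 the integral is both <= 0 and >= 0. *)
Lemma ae_ge0 (g : T -> R) : m.-integrable setT (EFin \o g) ->
  (forall E, measurable E -> 0 <= fine (\int[m]_(x in E) (g x)%:E)%E) ->
  {ae m, forall x, 0 <= g x}.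
Proof.
move=> ig hg.
have /measurable_EFinP mg := measurable_int _ ig.
pose N := [set x | g x < 0].
have mN : measurable N.
  have mc : measurable_fun setT (fun _ : T => 0 : R) by exact: measurable_cst.
  have mb : measurable [set false] by [].
  have := measurable_fun_ler mc mg measurableT mb; rewrite setTI.
  congr measurable; apply/seteqP; split=> x /=; rewrite /N /= ltNge; first by move=> ->.
  by move/negbTE.
have iN : m.-integrable N (EFin \o g) by exact: integrableS ig.
have ae0 : ae_eq m N (EFin \o g) (cst 0%E).
  apply: integral_ae_eq => // E EN mE.
  rewrite integral0; apply/eqP; rewrite eq_le; apply/andP; split.
    rewrite -[leRHS](integral0 m E); apply: le_integral => //.
    - exact: integrableS ig.
    - exact: integrable0.
    - by move=> x /set_mem /EN /ltW; rewrite lee_fin.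
  have iE : m.-integrable E (EFin \o g) by exact: integrableS ig.
  rewrite -[leRHS](fineK (integrable_fin_num mE iE)) lee_fin; exact: hg.
apply: filterS ae0 => x /= h; rewrite leNgt; apply/negP => gx.
by have := h gx => -[] g0; move: gx; rewrite /N /= g0 ltxx.
Qed.

Lemma ae_cge0 (g : T -> R[i]) : cintegrable m setT g ->
  (forall E, measurable E -> 0 <= cintegral m E g) ->
  {ae m, forall x, 0 <= g x}.
Proof.
move=> [gR gI] hg.
have aR : {ae m, forall x, 0 <= complex.Re (g x)}.
  by apply: ae_ge0 => // E mE; have /ge0_complexP[] := hg _ mE.
have hI E : measurable E -> fine (\int[m]_(x in E) (complex.Im (g x))%:E)%E = 0.
  by move=> mE; have /ge0_complexP[] := hg _ mE.
have aI : ae_eq m setT (fun x => (complex.Im (g x))%:E) (cst 0%E).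
  apply: integral_ae_eq => // E _ mE; rewrite integral0.
  have iE : m.-integrable E (fun x => (complex.Im (g x))%:E) by exact: integrableS gI.
  by rewrite -[LHS](fineK (integrable_fin_num mE iE)) hI.
apply: filterS2 aR aI => x hR hI'; apply/ge0_complexP; split=> //.
by have := hI' Logic.I => -[].
Qed.

Lemma ae_cintegrable (g h : T -> R[i]) : cmeas h -> cintegrable m setT g ->
  {ae m, forall x, g x = h x} -> cintegrable m setT h.
Proof.
move=> [hR hI] [gR gI] gh.
have aux (u v : T -> R) : measurable_fun setT v -> m.-integrable setT (EFin \o u) ->
    {ae m, forall x, u x = v x} -> m.-integrable setT (EFin \o v).
  move=> mv iu uv; have /integrableP[mu hu] := iu.
  apply/integrableP; split; first exact/measurable_EFinP.
  rewrite (@ae_eq_integral _ _ _ m setT (fun x => `|(EFin \o u) x|%E))//.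
  - by apply: measurableT_comp => //; exact/measurable_EFinP.
  - by apply: measurableT_comp.
  - by apply: filterS uv => x /= ->.
split.
  have E : {ae m, forall x, complex.Re (g x) = complex.Re (h x)}.
    by apply: filterS gh => x /= ->.
  exact: (aux (fun x => complex.Re (g x)) (fun x => complex.Re (h x)) hR gR E).
have E : {ae m, forall x, complex.Im (g x) = complex.Im (h x)}.
  by apply: filterS gh => x /= ->.
exact: (aux (fun x => complex.Im (g x)) (fun x => complex.Im (h x)) hI gI E).
Qed.

Lemma ae_cintegral (g h : T -> R[i]) E : measurable E -> cmeas g -> cmeas h ->
  {ae m, forall x, g x = h x} -> cintegral m E g = cintegral m E h.
Proof.
move=> mE [gR gI] [hR hI] gh; apply: complex_eq => /=; congr fine.
  apply: ae_eq_integral => //; try exact/measurable_EFinP/measurable_funTS.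
  by apply: filterS gh => x /= ->.
apply: ae_eq_integral => //; try exact/measurable_EFinP/measurable_funTS.
by apply: filterS gh => x /= ->.
Qed.

Lemma cintegrableS E (g : T -> R[i]) : measurable E ->
  cintegrable m setT g -> cintegrable m E g.
Proof. by move=> mE [g1 g2]; split; [exact: integrableS g1|exact: integrableS g2]. Qed.

Lemma cintegral_ae_eq (g h : T -> R[i]) : cintegrable m setT g ->
  cintegrable m setT h ->
  (forall E, measurable E -> cintegral m E g = cintegral m E h) ->
  {ae m, forall x, g x = h x}.
Proof.
move=> ig ih gh.
have aux (u v : T -> R) : m.-integrable setT (EFin \o u) ->
    m.-integrable setT (EFin \o v) ->
    (forall E, measurable E -> fine (\int[m]_(x in E) (u x)%:E)%E =
      fine (\int[m]_(x in E) (v x)%:E)%E) -> {ae m, forall x, u x = v x}.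
  move=> iu iv uv.
  have : ae_eq m setT (EFin \o u) (EFin \o v).
    apply: integral_ae_eq => //; first exact: measurable_int iv.
    move=> E _ mE.
    have iuE : m.-integrable E (EFin \o u) by exact: integrableS iu.
    have ivE : m.-integrable E (EFin \o v) by exact: integrableS iv.
    rewrite -[LHS](fineK (integrable_fin_num mE iuE)).
    by rewrite -[RHS](fineK (integrable_fin_num mE ivE)) uv.
  by apply: filterS => x /(_ Logic.I)[].
have aR : {ae m, forall x, complex.Re (g x) = complex.Re (h x)}.
  case: ig ih => [ig _] [ih _]; apply: aux ig ih _ => E mE.
  by have := gh _ mE => -[].
have aI : {ae m, forall x, complex.Im (g x) = complex.Im (h x)}.
  case: ig ih => [_ ig] [_ ih]; apply: aux ig ih _ => E mE.
  by have := gh _ mE => -[].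
by apply: filterS2 aR aI => x; exact: complex_eq.
Qed.

End NullSets.

Section ChangeOfMeasure.
Context d {T : measurableType d} {R : realType}.
Variables (m m' : {finite_measure set T -> \bar R}).
Hypothesis mm' : m `<< m'.

(** The derivative dm/dm' as a nonnegative real function. *)
Definition density : T -> R := fine \o Radon_Nikodym_SigmaFinite.f m m'.

Let dE x : Radon_Nikodym_SigmaFinite.f m m' x = (density x)%:E.
Proof. by rewrite /density /= fineK// Radon_Nikodym_SigmaFinite.f_fin_num. Qed.

Lemma density_ge0 x : 0 <= density x.
Proof. by rewrite -lee_fin -dE Radon_Nikodym_SigmaFinite.f_ge0. Qed.

Let change_real (u : T -> R) : m.-integrable setT (EFin \o u) ->
  m'.-integrable setT (fun x => (density x * u x)%:E) /\
  forall E, measurable E ->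
    (\int[m']_(x in E) (density x * u x)%:E = \int[m]_(x in E) (u x)%:E)%E.
Proof.
move=> iu; have mT : measurable [set: T] := measurableT.
have ip := integrable_funepos mT iu; have im := integrable_funeneg mT iu.
have pE v x : (v x * Radon_Nikodym_SigmaFinite.f m m' x)%E = (v x * (density x)%:E)%E.
  by rewrite dE.
have uE x : ((density x * u x)%:E = ((EFin \o u)^\+ x * Radon_Nikodym_SigmaFinite.f m m' x -
    (EFin \o u)^\- x * Radon_Nikodym_SigmaFinite.f m m' x))%E.
  rewrite dE -muleBl//; last exact: add_def_funeposneg.
  by rewrite -[X in (X * _)%E]/(((EFin \o u)^\+ \- (EFin \o u)^\-) x)%E -funeposneg muleC.
have ip' E : measurable E -> m.-integrable E (EFin \o u)^\+%E.
  by move=> mE; exact: integrableS ip.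
have im' E : measurable E -> m.-integrable E (EFin \o u)^\-%E.
  by move=> mE; exact: integrableS im.
split.
  under eq_fun do rewrite uE.
  by apply: integrableB => //; apply: Radon_Nikodym_SigmaFinite.integrableM => //.
move=> E mE; under eq_integral do rewrite uE.
rewrite integralB//; last 2 first.
- by apply: Radon_Nikodym_SigmaFinite.integrableM => //; exact: ip'.
- by apply: Radon_Nikodym_SigmaFinite.integrableM => //; exact: im'.
rewrite !Radon_Nikodym_SigmaFinite.change_of_variables//.
- by rewrite [RHS]integralE.
- exact: measurable_int (im' _ mE).
- exact: measurable_int (ip' _ mE).
Qed.

Lemma cintegrable_density (g : T -> R[i]) : cintegrable m setT g ->
  cintegrable m' setT (fun x => (density x)%:C * g x).
Proof.
move=> [gR gI]; split.
  by under eq_fun do rewrite cReZ; have [] := change_real gR.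
by under eq_fun do rewrite cImZ; have [] := change_real gI.
Qed.

Lemma cintegral_density (g : T -> R[i]) E : measurable E ->
  cintegrable m setT g ->
  cintegral m' E (fun x => (density x)%:C * g x) = cintegral m E g.
Proof.
move=> mE [gR gI]; apply: complex_eq => /=; congr fine.
  under eq_integral do rewrite cReZ.
  by have [_ ->] := change_real gR.
under eq_integral do rewrite cImZ.
by have [_ ->] := change_real gI.
Qed.

End ChangeOfMeasure.

(** * The Radon-Nikodym derivative beyond the basis *)

Section RadonNikodymExtension.
Context d {T : measurableType d} {R : realType} {H : hilbertType R}.
Variables (I : set nat) (e : nat -> H).
Hypothesis He : orthonormal_basis I e.
Variable m : {measure set T -> \bar R}.
Variable nu : set T -> H -> H.
Hypothesis pnu : forall E, measurable E -> positive (nu E).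
Variable D : T -> H -> H.
Hypothesis bD : forall x, bounded_operator (D x).
Let b := pad I e.
Let be := pad_frame He.
Let mT : measurable [set: T]. Proof. exact: measurableT. Qed.
Implicit Types (u v w : H) (K : T -> H -> H).

(** K is the density of the complex measure <nu(.) u, v> with respect to m. *)
Definition RN_pair K u v := cintegrable m setT (fun x => '[K x u, v]) /\
  forall E, measurable E ->
    '[nu E u, v] = cintegral m E (fun x => '[K x u, v]).

Hypothesis hD : forall i j, I i -> I j -> RN_pair D (e j) (e i).

Let cint0 E : measurable E -> cintegral m E (fun=> 0) = 0.
Proof.
move=> mE; apply: complex_eq => /=; by rewrite (integral0 m E).
Qed.

Let RN0l v : RN_pair D 0 v.
Proof.
have E0 : (fun x => '[D x 0, v]) = fun=> 0.
  by apply/funext => x; rewrite (op0 (bop_lin (bD x))) ip0l.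
split; first by rewrite E0; split; exact: integrable0.
move=> E mE; rewrite (op0 (bop_lin (positive_bop (pnu mE)))) ip0l E0.
by rewrite cint0.
Qed.

Let RN0r u : RN_pair D u 0.
Proof.
have E0 : (fun x => '[D x u, 0]) = fun=> 0.
  by apply/funext => x; rewrite ip0r.
split; first by rewrite E0; split; exact: integrable0.
by move=> E mE; rewrite ip0r E0 cint0.
Qed.

Let RN_linl a u u' v : RN_pair D u v -> RN_pair D u' v ->
  RN_pair D (a *: u + u') v.
Proof.
move=> [i1 h1] [i2 h2].
have E0 : (fun x => '[D x (a *: u + u'), v]) =
    fun x => a * '[D x u, v] + '[D x u', v].
  by apply/funext => x; rewrite (bop_lin (bD x)) ipDl ipZl.
split; first by rewrite E0; apply: cintegrableD => //; exact: cintegrableZ.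
move=> E mE; rewrite E0 (bop_lin (positive_bop (pnu mE))) ipDl ipZl h1// h2//.
have j1 := cintegrableS mE i1; have j2 := cintegrableS mE i2.
by rewrite cintegralD ?cintegralZ//; exact: cintegrableZ.
Qed.

Let RN_linr a u v v' : RN_pair D u v -> RN_pair D u v' ->
  RN_pair D u (a *: v + v').
Proof.
move=> [i1 h1] [i2 h2].
have E0 : (fun x => '[D x u, a *: v + v']) =
    fun x => a^* * '[D x u, v] + '[D x u, v'].
  by apply/funext => x; rewrite ipDr ipZr.
split; first by rewrite E0; apply: cintegrableD => //; exact: cintegrableZ.
move=> E mE; rewrite E0 ipDr ipZr h1// h2//.
have j1 := cintegrableS mE i1; have j2 := cintegrableS mE i2.
by rewrite cintegralD ?cintegralZ//; exact: cintegrableZ.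
Qed.

Let RN_b i j : RN_pair D (b j) (b i).
Proof.
rewrite /b /pad; case: ifPn => [/set_mem jI|_]; last exact: RN0l.
by case: ifPn => [/set_mem iI|_]; [exact: hD|exact: RN0r].
Qed.

Definition basis_comb w := exists n (a : nat -> R[i]), w = \sum_(k < n) a k *: b k.

Let RN_comb w w' : basis_comb w -> basis_comb w' -> RN_pair D w w'.
Proof.
move=> [n [a ->]] [n' [a' ->]].
elim: n => [|n IH]; first by rewrite big_ord0; exact: RN0l.
rewrite big_ord_recr /= addrC; apply: RN_linl IH.
elim: n' => [|n' IH']; first by rewrite big_ord0; exact: RN0r.
by rewrite big_ord_recr /= addrC; apply: RN_linr IH'; exact: RN_b.
Qed.

Let trunc u n := \sum_(k < n) '[u, b k] *: b k.

Let trunc_comb u n : basis_comb (trunc u n).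
Proof. by exists n, (fun k => '[u, b k]). Qed.

Let grid_comb n : basis_comb (grid_seq I e n).
Proof.
rewrite /grid_seq; case: unpickle => [[k l]|].
  by exists k, (fun j => grid_coef k (nth (0, 0) l j)).
by exists 0%N, (fun=> 0); rewrite big_ord0.
Qed.

Lemma RN_wmeas : wmeas D.
Proof.
move=> u v; apply: (cmeas_lim (g := fun n x => '[D x (trunc u n), trunc v n])).
  move=> n; apply: (cmeas_cintegrable (m := m)).
  by case: (RN_comb (trunc_comb u n) (trunc_comb v n)).
by move=> x; apply: ip_cvg; [exact: op_cvg (bD x) (be u)|exact: be].
Qed.

Lemma RN_ae_positive : {ae m, forall x, positive (D x)}.
Proof.
have : {ae m, forall x, forall n, 0 <= '[D x (grid_seq I e n), grid_seq I e n]}.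
  apply: ae_foralln => n; have [i1 h1] := RN_comb (grid_comb n) (grid_comb n).
  apply: ae_cge0 => // E mE; rewrite -h1//.
  by have [_ ->] := pnu mE.
by apply: filterS => x; exact: (grid_positive He).
Qed.

(** A version of D that is positive everywhere. *)
Let D0 x := opsqrt (D x) \o opsqrt (D x).

Let pD0 x : positive (D0 x).
Proof.
have pS := opsqrt_positive (D x).
exact: selfadj_sqr_positive (positive_bop pS) (positive_selfadj pS).
Qed.

Let ae_D0 : {ae m, forall x, D x = D0 x}.
Proof. by apply: filterS RN_ae_positive => x /opsqrt_spec[]. Qed.

Let wmeas_D0 : wmeas D0.
Proof.
have mS := wmeas_opsqrt He bD RN_wmeas.
by apply: (wmeas_comp He) => // x; exact/positive_bop/opsqrt_positive.
Qed.

Let ae_ip u v : {ae m, forall x, '[D x u, v] = '[D0 x u, v]}.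
Proof. by apply: filterS ae_D0 => x ->. Qed.

Let RN_comb0 w w' : basis_comb w -> basis_comb w' -> RN_pair D0 w w'.
Proof.
move=> cw cw'; have [i1 h1] := RN_comb cw cw'; split.
  exact: ae_cintegrable (wmeas_D0 w w') i1 (ae_ip w w').
move=> E mE; rewrite h1//.
exact: (ae_cintegral mE (RN_wmeas w w') (wmeas_D0 w w') (ae_ip w w')).
Qed.

Let limn_einfE (x : nat -> \bar R) l : x @ \oo --> l -> limn_einf x = l.
Proof.
move=> h; rewrite is_cvg_limn_einfE; first exact/cvg_lim.
by apply/cvg_ex; exists l.
Qed.

(** Equality holds for the truncations of u, which are finite combinations of basis
    vectors; Fatou leaves one inequality in the limit. *)
Let fatou_le u E : measurable E ->
  (\int[m]_(x in E) (complex.Re '[D0 x u, u])%:E <=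
   (complex.Re '[nu E u, u])%:E)%E.
Proof.
move=> mE; pose h n x := (complex.Re '[D0 x (trunc u n), trunc u n])%:E.
have hE x : (complex.Re '[D0 x u, u])%:E = limn_einf (h^~ x).
  apply/esym; have /ccvg_ReIm[+ _] : ccvg (fun n => '[D0 x (trunc u n), trunc u n]) '[D0 x u, u].
    by apply: ip_cvg (be u); exact: op_cvg (positive_bop (pD0 x)) (be u).
  by move=> c; apply: limn_einfE; exact: (cvg_comp _ _ c).
have nE n : (\int[m]_(x in E) h n x = (complex.Re '[nu E (trunc u n), trunc u n])%:E)%E.
  have [i1 h1] := RN_comb0 (trunc_comb u n) (trunc_comb u n).
  rewrite h1//= fineK//; have [j1 _] := cintegrableS mE i1.
  exact: integrable_fin_num j1.
under eq_integral do rewrite hE.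
apply: (le_trans (fatou m mE _ _)).
- move=> n; apply/measurable_EFinP/measurable_funTS.
  by have [] := wmeas_D0 (trunc u n) (trunc u n).
- by move=> n x _; rewrite lee_fin; exact: positive_ge0.
under eq_fun do rewrite nE.
have /ccvg_ReIm[c _] : ccvg (fun n => '[nu E (trunc u n), trunc u n]) '[nu E u, u].
  by apply: ip_cvg (be u); exact: op_cvg (positive_bop (pnu mE)) (be u).
by rewrite (limn_einfE (l := (complex.Re '[nu E u, u])%:E))//; exact: (cvg_comp _ _ c).
Qed.

Let int_diag u : m.-integrable setT (fun x => (complex.Re '[D0 x u, u])%:E).
Proof.
apply/integrableP; split; first by apply/measurable_EFinP; case: (wmeas_D0 u u).
under eq_integral do rewrite gee0_abs ?lee_fin ?positive_ge0//.
by apply: le_lt_trans (fatou_le u mT) _; rewrite ltry.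
Qed.

Let int_D0 u v : cintegrable m setT (fun x => '[D0 x u, v]).
Proof.
have id := integrableD mT (int_diag u) (int_diag v).
have bd x : cmod '[D0 x u, v] <= complex.Re '[D0 x u, u] + complex.Re '[D0 x v, v].
  have p0 := positive_ge0 u (pD0 x); have q0 := positive_ge0 v (pD0 x).
  rewrite -(@ler_pXn2r _ 2)// ?nnegrE ?addr_ge0 ?cmod_ge0//.
  apply: (le_trans (pos_form_CS (positive_form (pD0 x)) u v)).
  by move: p0 q0; move: (complex.Re _) (complex.Re _) => p q p0 q0; nra.
have [mR mI] := wmeas_D0 u v.
split; apply: le_integrable id => //.
- exact/measurable_EFinP.
- move=> x _; rewrite lee_fin [leRHS]ger0_norm ?addr_ge0 ?positive_ge0//.
  exact: le_trans (Re_le_cmod _) (bd x).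
- exact/measurable_EFinP.
- move=> x _; rewrite lee_fin [leRHS]ger0_norm ?addr_ge0 ?positive_ge0//.
  exact: le_trans (Im_le_cmod _) (bd x).
Qed.

Let defect E u v := '[nu E u, v] - cintegral m E (fun x => '[D0 x u, v]).

Let defect_pos E : measurable E -> pos_form (defect E).
Proof.
move=> mE; have i u v := cintegrableS mE (int_D0 u v).
have lnu := bop_lin (positive_bop (pnu mE)).
split=> [a x y z|a x y z|x].
- rewrite /defect lnu ipDl ipZl.
  rewrite (_ : (fun t => _) = fun t => a * '[D0 t x, z] + '[D0 t y, z]); last first.
    by apply/funext => t; rewrite (bop_lin (positive_bop (pD0 t))) ipDl ipZl.
  rewrite (cintegralD mE (cintegrableZ a mE (i x z)) (i y z)) (cintegralZ a mE (i x z)).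
  by rewrite mulrBr opprD addrACA.
- rewrite /defect ipDr ipZr.
  rewrite (_ : (fun t => _) = fun t => a^* * '[D0 t z, x] + '[D0 t z, y]); last first.
    by apply/funext => t; rewrite ipDr ipZr.
  rewrite (cintegralD mE (cintegrableZ a^* mE (i z x)) (i z y)) (cintegralZ a^* mE (i z x)).
  by rewrite mulrBr opprD addrACA.
- have /ge0_complexP[n0 _] : 0 <= '[nu E x, x] by case: (pnu mE).
  have /ge0_complexP[c0 _] : 0 <= cintegral m E (fun t => '[D0 t x, x]).
    by apply: cintegral_ge0 => t; case: (pD0 t).
  apply/ge0_complexP; rewrite cImD cImN n0 c0 subrr; split=> //.
  rewrite cReD cReN subr_ge0 -lee_fin /= fineK; first exact: fatou_le.
  by have [j _] := i x x; exact: integrable_fin_num j.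
Qed.

(** The defect vanishes on finite combinations of basis vectors, hence
    everywhere by Cauchy-Schwarz, as it is bounded by the form of nu(E). *)
Let defect_eq0 E u v : measurable E -> defect E u v = 0.
Proof.
move=> mE; have pE := defect_pos mE.
have /bopP[_ [M M0 hM]] := positive_bop (pnu mE).
have le_nu w : complex.Re (defect E w w) <= M * hnm w ^+ 2.
  apply: (@le_trans _ _ (complex.Re '[nu E w, w])).
    rewrite cReD cReN gerBl; apply: Re_cintegral_ge0 => x; exact: positive_ge0.
  rewrite (le_trans (ler_norm _))// (le_trans (Re_le_cmod _))//.
  by rewrite (le_trans (ip_CS _ _))// expr2 mulrA ler_wpM2r ?hnm_ge0.
have comb0 n : defect E (trunc u n) v = 0.
  have c := trunc_comb u n; have [_ h1] := RN_comb0 c c.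
  apply: cmod_eq0; apply/eqP; rewrite -sqrf_eq0; apply/eqP/le_anti.
  rewrite sqr_ge0 andbT (le_trans (pos_form_CS pE _ _))//.
  by rewrite /defect -h1// subrr mul0r.
have split_n n : defect E u v = defect E (u - trunc u n) v.
  transitivity (defect E ((u - trunc u n) + trunc u n) v); first by rewrite subrK.
  by rewrite (pos_formDl pE) comb0 addr0.
pose C := complex.Re (defect E v v) * M.
have C0 : 0 <= complex.Re (defect E v v) by have /ge0_complexP[] := pos_form_ge0 pE v.
have le_n n : cmod (defect E u v) ^+ 2 <= C * (hnm (trunc u n - u) * hnm (trunc u n - u)).
  rewrite (split_n n) (le_trans (pos_form_CS pE _ _))// mulrC /C -mulrA.
  by rewrite ler_wpM2l// (le_trans (le_nu _))// expr2 hnm_distC.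
have lim0 : (fun n => C * (hnm (trunc u n - u) * hnm (trunc u n - u))) @ \oo --> (0 : R).
  by apply: nullZ; rewrite -[0](mulr0 0); apply: cvgM; exact: be.
apply: cmod_eq0; apply/eqP; rewrite -sqrf_eq0; apply/eqP/le_anti.
by rewrite sqr_ge0 andbT; exact: (rcvg_le le_n (rcvg_cst _) lim0).
Qed.

(** This frees the derivative from the basis in which it was defined. *)
Lemma RN_extension u v : RN_pair D u v.
Proof.
have ae' : {ae m, forall x, '[D0 x u, v] = '[D x u, v]}.
  by apply: filterS (ae_ip u v) => x ->.
split; first exact: ae_cintegrable (RN_wmeas u v) (int_D0 u v) ae'.
move=> E mE; have /eqP := defect_eq0 u v mE; rewrite subr_eq0 => /eqP ->.
exact: (ae_cintegral mE (wmeas_D0 u v) (RN_wmeas u v) ae').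
Qed.

End RadonNikodymExtension.

(** * The scalar measures of a POVM *)

Section OperatorMeasure.
Context {R : realType} {H : hilbertType R} {X : ptopologicalType}.
Variables (I : set nat) (e : nat -> H).
Hypothesis He : orthonormal_basis I e.
Variable nu : set (borel X) -> H -> H.
Hypothesis nuP : POVM nu.
Implicit Types (rho s : H -> H) (E : set (borel X)).

Lemma POVM_positive E : measurable E -> positive (nu E).
Proof. by case: nuP => h _; exact: h. Qed.

Let bnu E : measurable E -> bounded_operator (nu E).
Proof. by move=> /POVM_positive; exact: positive_bop. Qed.

Lemma Tr_tc_sum s (A : nat -> H -> H) n : trace_class s ->
  (forall k, bounded_operator (A k)) ->
  Tr (s \o \sum_(k < n) A k) = \sum_(k < n) Tr (s \o A k).
Proof.
move=> ts bA; elim: n => [|n IH].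
  rewrite !big_ord0; apply: (is_traceE He) => J f _.
  have := @ccvg_cst R 0; congr (ccvg _ _); apply/funext => n.
  by rewrite big1// => k _; rewrite /= (op0 (bop_lin (tc_bop ts))) ip0l.
by rewrite !big_ord_recr /= (Tr_tcD He)// ?IH//; exact: bop_sum.
Qed.

Lemma POVM_sigma s (F : nat -> set (borel X)) : trace_class s ->
  (forall n, measurable (F n)) -> trivIset setT F ->
  (fun n => \sum_(k < n) complex.Re (Tr (s \o nu (F k)))) @ \oo -->
    complex.Re (Tr (s \o nu (\bigcup_k F k))).
Proof.
move=> ts mF tF; have [_ /(_ F mF tF s ts)/ccvg_ReIm[+ _]] := nuP.
apply: eq_rcvg => n; rewrite (Tr_tc_sum n (A := fun k => nu (F k)))//.
  by rewrite (big_morph (@complex.Re R) cReD (erefl _)).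
by move=> k; exact: bnu.
Qed.

(** Apply additivity to the constant sequence of empty sets. *)
Lemma POVM_set0 s : trace_class s -> complex.Re (Tr (s \o nu set0)) = 0.
Proof.
move=> ts; set c := complex.Re _.
have h : (fun n => \sum_(k < n) c) @ \oo --> c.
  have t0 : trivIset setT (fun _ : nat => set0 : set (borel X)).
    by apply/trivIsetP => i j _ _ _; rewrite setI0.
  by have := POVM_sigma ts (fun=> measurable0) t0; rewrite bigcup0.
have h1 : (fun n => \sum_(k < n.+1) c) @ \oo --> c.
  by rewrite (cvg_shiftS (fun n => \sum_(k < n) c)).
have := rcvgB h1 h; rewrite subrr => h0.
apply: (cvg_unique _ _ h0) => //; apply: eq_rcvg (rcvg_cst c) => n.
by rewrite big_ord_recr /= addrAC subrr add0r.
Qed.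

(** Ultraweak additivity of nu, tested on rho, is countable additivity of nu_rho. *)
Lemma nu_finite_measure rho : trace_class rho -> positive rho ->
  exists m : {finite_measure set (borel X) -> \bar R},
    forall E, measurable E -> nu_ nu rho E = m E.
Proof.
move=> ts pr; apply: finite_measure_of.
- move=> E mE; rewrite lee_fin.
  by have /ge0_complexP[] := tc_Tr_ge0 He pr ts (POVM_positive mE).
- exact: ltry.
- move=> F mF tF; rewrite [X in X @ _ --> _](_ : _ =
    (EFin \o fun n => \sum_(k < n) complex.Re (Tr (rho \o nu (F k))))).
    exact: (cvg_comp _ _ (POVM_sigma ts mF tF)).
  by apply/funext => n; rewrite /= sumEFin big_mkord.
- by rewrite /nu_ POVM_set0.
Qed.

(** For full-rank rho = c^* c, nu_rho(E) = 0 forces nu(E) c^* = 0, hence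
    rho nu(E) = 0, hence nu(E) = 0. *)
Lemma nu_null rho E : state rho -> full_rank rho -> measurable E ->
  nu_ nu rho E = 0%E -> nu E = 0.
Proof.
move=> [ts [pr _]] fr mE [h]; have pA := POVM_positive mE.
have bA := positive_bop pA; have lA := bop_lin bA.
have br := positive_bop pr; have lr := bop_lin br.
have [c hc rE] := tc_gram He pr ts; have bc := hs_bop hc.
have bc' := bop_adjoint He bc.
have be := pad_frame He.
pose t k := complex.Re '[nu E (adjoint c (pad I e k)), adjoint c (pad I e k)].
have t0 k : 0 <= t k by exact: positive_ge0.
have tl : (fun n => \sum_(k < n) t k) @ \oo --> (0 : R).
  have /ccvg_ReIm[+ _] := Tr_gram He hc bA be; rewrite -rE h.
  by apply: eq_rcvg => n; rewrite (big_morph (@complex.Re R) cReD (erefl _)).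
have tk k : t k = 0.
  apply/le_anti; rewrite t0 andbT -(cvg_lim _ tl)//.
  apply: le_trans (nondecreasing_cvgn_le _ _ k.+1).
  - by rewrite big_ord_recr lerDr sumr_ge0.
  - by apply/nondecreasing_seqP => n; rewrite big_ord_recr lerDl.
  - by apply/cvg_ex; eexists; exact: tl.
have Ac k : nu E (adjoint c (pad I e k)) = 0 by exact: positive_eq0 (tk k).
have Ac0 x : nu E (adjoint c x) = 0.
  have bT := bop_comp bA bc'.
  apply: (hcvg_unique (op_cvg bT (be x))).
  have := hcvg_cst (0 : H); congr (hcvg _ _); apply/funext => n.
  by rewrite (op_sum (bop_lin bT)) big1// => k _; rewrite (opZ (bop_lin bT)) /= Ac scaler0.
apply/funext => x; apply: fr; rewrite (op0 lr); apply: ip_ext => y.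
rewrite ip0l (positive_selfadj pr) (positive_selfadj pA).
by rewrite [rho y](_ : _ = adjoint c (c y)) ?Ac0 ?ip0r// rE.
Qed.

(** By full rank of rho', a nu_rho'-null set is nu-null, hence nu_rho-null. *)
Lemma nu_dominates rho rho' (m m' : {finite_measure set (borel X) -> \bar R}) :
  state rho' -> full_rank rho' ->
  (forall E, measurable E -> nu_ nu rho E = m E) ->
  (forall E, measurable E -> nu_ nu rho' E = m' E) -> trace_class rho ->
  m `<< m'.
Proof.
move=> sr fr mE mE' tr N hN A mA AN; rewrite -mE// /nu_ (nu_null sr fr mA).
  rewrite (_ : rho \o 0 = rho \o (\sum_(k < 0) (fun=> 0) k)) ?big_ord0//.
  rewrite (_ : Tr _ = 0)//; apply: (is_traceE He) => J f _.
  have := @ccvg_cst R 0; congr (ccvg _ _); apply/funext => n.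
  by rewrite big1// => k _; rewrite /= (op0 (bop_lin (tc_bop tr))) ip0l.
by rewrite mE'//; exact: hN.
Qed.

Lemma RN_derivativeP rho J f D (m : {finite_measure set (borel X) -> \bar R}) :
  (forall E, measurable E -> nu_ nu rho E = m E) ->
  RN_derivative nu rho J f D <-> (forall x, bounded_operator (D x)) /\
    forall i j, J i -> J j -> RN_pair m nu D (f j) (f i).
Proof.
move=> mE; have cE g : cintegrable (nu_ nu rho) setT g = cintegrable m setT g.
  exact: eq_cintegrable.
have iE E g : cintegral (nu_ nu rho) E g = cintegral m E g.
  exact: eq_cintegral.
split=> -[bD hD]; split=> // i j Ji Jj; have [h1 h2] := hD i j Ji Jj; split.
- by rewrite -cE.
- by move=> E mE'; rewrite -iE; exact: h2.
- by rewrite cE.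
- by move=> E mE'; rewrite iE; exact: h2.
Qed.

End OperatorMeasure.

(** * The integrand *)

Section Weighted.
Context {R : realType} {H : hilbertType R} {X : ptopologicalType}.
Variables (I : set nat) (e : nat -> H).
Hypothesis He : orthonormal_basis I e.
Implicit Types (D g : borel X -> H -> H) (s : H -> H).

Definition sandwich D g x := opsqrt (D x) \o g x \o opsqrt (D x).

Lemma bop_sandwich D g x : bounded_operator (g x) ->
  bounded_operator (sandwich D g x).
Proof.
move=> bg; have bS := positive_bop (opsqrt_positive (D x)).
have bgS := bop_comp bS bg.
by have := bop_comp bg bS; move/(bop_comp bS); rewrite /sandwich; apply.
Qed.

Lemma sandwich_positive D g x : positive (g x) -> positive (sandwich D g x).
Proof.
move=> pg; have pS := opsqrt_positive (D x).
exact: selfadj_comp_positive (positive_bop pS) (positive_selfadj pS) pg.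
Qed.

Lemma wmeas_sandwich D g : (forall x, bounded_operator (D x)) ->
  (forall x, bounded_operator (g x)) -> wmeas D -> wmeas g ->
  wmeas (sandwich D g).
Proof.
move=> bD bg mD mg; have mS := wmeas_opsqrt He bD mD.
have bS x : bounded_operator (opsqrt (D x)) by exact/positive_bop/opsqrt_positive.
apply: (wmeas_comp He) => //; first by move=> x; exact: bop_comp.
exact: (wmeas_comp He).
Qed.

(** The square root is homogeneous of degree 1/2 and occurs twice. *)
Lemma weighted_scale D D' g s (h : R) x : trace_class s ->
  bounded_operator (g x) -> 0 <= h -> D' x = h%:C *: D x ->
  weighted D' g s x = h%:C * weighted D g s x.
Proof.
move=> ts bg h0 DE; rewrite /weighted DE opsqrtZ//.
have bG := bop_sandwich D bg.
rewrite -(Tr_tcZ He _ ts bG); congr (Tr (_ \o _)); apply/funext => y.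
have lS := bop_lin (positive_bop (opsqrt_positive (D x))).
rewrite /sandwich /= !scaleopE /= (opZ (bop_lin bg)) (opZ lS) scalerA -rmorphM /=.
by rewrite -expr2 sqr_sqrtr.
Qed.

End Weighted.

(** * The integral of a quantum random variable *)

Section OperatorIntegral.
Context {R : realType} {H : hilbertType R} {X : ptopologicalType}.
Variables (I : set nat) (e : nat -> H).
Hypothesis He : orthonormal_basis I e.
Implicit Types (A B C s : H -> H) (f D : borel X -> H -> H).

Lemma Tr_tcB s A B : trace_class s -> bounded_operator A -> bounded_operator B ->
  Tr (s \o (A - B)) = Tr (s \o A) - Tr (s \o B).
Proof.
move=> ts bA bB; rewrite (Tr_tcD He)//; last exact: bopN.
congr (_ + _); rewrite -mulN1r -(Tr_tcZ He)//; congr (Tr (_ \o _)).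
by apply/funext => x; rewrite scaleopE scaleN1r.
Qed.

Lemma Tr_cartesian s A B C E : trace_class s -> bounded_operator A ->
  bounded_operator B -> bounded_operator C -> bounded_operator E ->
  Tr (s \o (A - B + 'i *: (C - E))) =
  Tr (s \o A) - Tr (s \o B) + 'i * (Tr (s \o C) - Tr (s \o E)).
Proof.
move=> ts bA bB bC bE; rewrite (Tr_tcD He)//.
- by rewrite (Tr_tcZ He)//; [rewrite !Tr_tcB|exact: bopB].
- exact: bopB.
- by apply: bopZ; exact: bopB.
Qed.

Lemma cartesian_parts A : A =
  (pos_part (Reop A) - neg_part (Reop A)) +
  'i *: (pos_part (Imop A) - neg_part (Imop A)).
Proof.
apply/funext => x.
by rewrite !(addopE, scaleopE, subopE) !pos_neg_parts Re_Im_parts.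
Qed.

Lemma parts_positive A : bounded_operator A ->
  [/\ positive (pos_part (Reop A)), positive (neg_part (Reop A)),
      positive (pos_part (Imop A)) & positive (neg_part (Imop A))].
Proof.
move=> bA; have bR := bop_Reop He bA; have bI := bop_Imop He bA.
have sR := Reop_selfadj He bA; have sI := Imop_selfadj He bA.
by split; [exact: (pos_part_positive He)|exact: (neg_part_positive He)|
           exact: (pos_part_positive He)|exact: (neg_part_positive He)].
Qed.

Lemma weighted_parts D f s x : trace_class s -> bounded_operator (f x) ->
  weighted D f s x =
  weighted D (fun x => pos_part (Reop (f x))) s x -
  weighted D (fun x => neg_part (Reop (f x))) s x +
  'i * (weighted D (fun x => pos_part (Imop (f x))) s x -
        weighted D (fun x => neg_part (Imop (f x))) s x).
Proof.
move=> ts bf; have [p1 p2 p3 p4] := parts_positive bf.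
have bS := bop_lin (positive_bop (opsqrt_positive (D x))).
have bs p : positive p ->
    bounded_operator ((opsqrt (D x) \o p) \o opsqrt (D x)).
  by move=> /positive_bop bp; exact: (bop_sandwich D (g := fun=> p) (x := x)).
rewrite -Tr_cartesian//; do ?[by exact: bs].
congr (Tr (_ \o _)); apply/funext => y.
rewrite !(addopE, scaleopE, subopE) /= [in LHS](cartesian_parts (f x)).
by rewrite !(addopE, scaleopE, subopE) (opD bS) (opZ bS) !(opB bS).
Qed.

Lemma cintegrable_cartesian d (T : measurableType d) (m : measure T R)
    (a b c k : T -> R[i]) :
  cintegrable m setT a -> cintegrable m setT b -> cintegrable m setT c ->
  cintegrable m setT k ->
  cintegrable m setT (fun x => a x - b x + 'i * (c x - k x)) /\
  cintegral m setT (fun x => a x - b x + 'i * (c x - k x)) =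
  cintegral m setT a - cintegral m setT b +
  'i * (cintegral m setT c - cintegral m setT k).
Proof.
move=> ia ib ic ik.
have N g : cintegrable m setT g -> cintegrable m setT (fun x => - g x).
  move=> ig; have := cintegrableZ (-1) (@measurableT _ T) ig.
  by under eq_fun do rewrite mulN1r.
have NE g : cintegrable m setT g ->
    cintegral m setT (fun x => - g x) = - cintegral m setT g.
  move=> ig; have := cintegralZ (-1) (@measurableT _ T) ig.
  by under eq_fun do rewrite mulN1r; rewrite mulN1r.
have ick := cintegrableD measurableT ic (N _ ik).
have iab := cintegrableD measurableT ia (N _ ib).
split; first by apply: cintegrableD => //; exact: cintegrableZ.
rewrite cintegralD//; last exact: cintegrableZ.
by rewrite cintegralZ// !cintegralD ?NE//; exact: N.
Qed.

Section Integral.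
Variables (m : {finite_measure set (borel X) -> \bar R}) (D f : borel X -> H -> H).
Hypothesis bf : forall x, bounded_operator (f x).

Let positive_part g : (forall x, positive (g x)) ->
  (forall s, state s -> cintegrable m setT (weighted D g s)) ->
  exists Q, bounded_operator Q /\ forall s, trace_class s ->
    cintegrable m setT (weighted D g s) /\
    Tr (s \o Q) = cintegral m setT (weighted D g s).
Proof.
move=> pg ig; have pG x := sandwich_positive D (pg x).
have [Q [bQ hQ]] := positive_integral He pG ig.
exists Q; split=> // s ts; split; last exact: hQ.
exact: (tc_integrable He pG ig ts).
Qed.

(** f = p1 - p2 + i (p3 - p4) with p_k positive, and both sides of the trace
    identity are linear in f. *)
Lemma operator_integral :
  (forall s, state s ->
    cintegrable m setT (weighted D (fun x => pos_part (Reop (f x))) s)) ->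
  (forall s, state s ->
    cintegrable m setT (weighted D (fun x => neg_part (Reop (f x))) s)) ->
  (forall s, state s ->
    cintegrable m setT (weighted D (fun x => pos_part (Imop (f x))) s)) ->
  (forall s, state s ->
    cintegrable m setT (weighted D (fun x => neg_part (Imop (f x))) s)) ->
  exists Q, bounded_operator Q /\ forall s, trace_class s ->
    cintegrable m setT (weighted D f s) /\
    Tr (s \o Q) = cintegral m setT (weighted D f s).
Proof.
have pp x := parts_positive (bf x).
have p1 x : positive (pos_part (Reop (f x))) by case: (pp x).
have p2 x : positive (neg_part (Reop (f x))) by case: (pp x).
have p3 x : positive (pos_part (Imop (f x))) by case: (pp x).
have p4 x : positive (neg_part (Imop (f x))) by case: (pp x).
move=> /(positive_part p1)[Q1 [b1 h1]] /(positive_part p2)[Q2 [b2 h2]].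
move=> /(positive_part p3)[Q3 [b3 h3]] /(positive_part p4)[Q4 [b4 h4]].
exists (Q1 - Q2 + 'i *: (Q3 - Q4)); split.
  by apply: bopD; [exact: bopB|apply: bopZ; exact: bopB].
move=> s ts; have [i1 e1] := h1 s ts; have [i2 e2] := h2 s ts.
have [i3 e3] := h3 s ts; have [i4 e4] := h4 s ts.
have -> : weighted D f s = fun x =>
    weighted D (fun x => pos_part (Reop (f x))) s x -
    weighted D (fun x => neg_part (Reop (f x))) s x +
    'i * (weighted D (fun x => pos_part (Imop (f x))) s x -
          weighted D (fun x => neg_part (Imop (f x))) s x).
  by apply/funext => x; exact: weighted_parts.
have [hi hE] := cintegrable_cartesian i1 i2 i3 i4; split=> //.
by rewrite hE Tr_cartesian// e1 e2 e3 e4.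
Qed.

End Integral.

(** Each A e_j is recovered from its coordinates, then A x from the expansion of x
    by continuity. *)
Lemma bop_matrix_ext A B : bounded_operator A -> bounded_operator B ->
  (forall i j, I i -> I j -> '[A (e j), e i] = '[B (e j), e i]) -> A = B.
Proof.
move=> bA bB AB; have fe := pad_frame He.
have pE u v : '[A (pad I e u), pad I e v] = '[B (pad I e u), pad I e v].
  rewrite /pad; case: ifPn => Iu; last by rewrite (op0 (bop_lin bA)) (op0 (bop_lin bB)).
  by case: ifPn => Iv; [apply: AB; exact/set_mem|rewrite !ip0r].
have E u : A (pad I e u) = B (pad I e u).
  apply: (hcvg_unique (fe _)); have := fe (B (pad I e u)).
  by congr (hcvg _ _); apply/funext => n; apply: eq_bigr => k _; rewrite pE.
apply/funext => x; apply: (hcvg_unique (op_cvg bA (fe x))).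
have := op_cvg bB (fe x); congr (hcvg _ _); apply/funext => n.
rewrite (op_sum (bop_lin bA)) (op_sum (bop_lin bB)); apply: eq_bigr => k _.
by rewrite (opZ (bop_lin bA)) (opZ (bop_lin bB)) E.
Qed.

Lemma qintegral_unique nu rho D f A : integral_matrix nu rho D I e f A ->
  qintegral nu rho D I e f = A.
Proof.
move=> hA; apply: xget_unique => //= B [bB hB]; have [bA hA'] := hA.
by apply: bop_matrix_ext => // i j Ii Ij; rewrite hA'// hB.
Qed.

(** The matrix units are trace class, with Tr (e_ji A) = <A e_j, e_i>. *)
Lemma trace_integral_matrix nu rho D f A : bounded_operator A ->
  (forall s, trace_class s ->
    Tr (s \o A) = cintegral (nu_ nu rho) setT (weighted D f s)) ->
  integral_matrix nu rho D I e f A.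
Proof.
move=> bA hA; split=> // i j _ _.
by rewrite -hA ?(Tr_rank_one He)//; exact: (rank_one_tc He).
Qed.

End OperatorIntegral.

(** * Change of the density operator and of the basis *)

Section Independence.
Context {R : realType} {H : hilbertType R} {X : ptopologicalType}.
Variables (I I' : set nat) (e e' : nat -> H).
Hypotheses (He : orthonormal_basis I e) (He' : orthonormal_basis I' e').
Variable nu : set (borel X) -> H -> H.
Hypothesis pnu : forall E, measurable E -> positive (nu E).
Variables m m' : {finite_measure set (borel X) -> \bar R}.
Hypothesis mm' : m `<< m'.
Variable D : borel X -> H -> H.
Hypothesis bD : forall x, bounded_operator (D x).
Hypothesis hD : forall i j, I i -> I j -> RN_pair m nu D (e j) (e i).

Let h := density m m'.

Lemma RN_pair_density u v :
  RN_pair m' nu (fun x => (h x)%:C *: D x) u v.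
Proof.
have [iD DE] := RN_extension He pnu bD hD u v.
have E : (fun x => '[((h x)%:C *: D x) u, v]) =
    fun x => (h x)%:C * '[D x u, v].
  by apply/funext => x; rewrite scaleopE ipZl.
split; first by rewrite E; exact: cintegrable_density.
by move=> F mF; rewrite E cintegral_density// DE.
Qed.

Variable D' : borel X -> H -> H.
Hypothesis bD' : forall x, bounded_operator (D' x).
Hypothesis hD' : forall i j, I' i -> I' j -> RN_pair m' nu D' (e' j) (e' i).

(** The chain rule d nu / d m' = (d m / d m') (d nu / d m): the countably many entries
    of both sides in the basis e' have the same integrals over all sets. *)
Lemma RN_chain : {ae m', forall x, D' x = (h x)%:C *: D x}.
Proof.
have : {ae m', forall x, forall i j,
    '[D' x (pad I' e' j), pad I' e' i] =
    '[((h x)%:C *: D x) (pad I' e' j), pad I' e' i]}.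
  apply: ae_foralln => i; apply: ae_foralln => j.
  have [i1 h1] := RN_extension He' pnu bD' hD' (pad I' e' j) (pad I' e' i).
  have [i2 h2] := RN_pair_density (pad I' e' j) (pad I' e' i).
  by apply: cintegral_ae_eq => // E mE; rewrite -h1// h2.
apply: filterS => x hx; apply: (bop_matrix_ext He') => //.
  exact: bopZ.
by move=> i j Ii Ij; have := hx i j; rewrite /pad !mem_set.
Qed.

Variable g : borel X -> H -> H.
Hypotheses (bg : forall x, bounded_operator (g x)) (mg : wmeas g).

(** By the chain rule the two integrands differ by the factor d m / d m', that is,
    by the change of variables from m' to m. *)
Lemma weighted_change s : trace_class s ->
  cintegrable m setT (weighted D g s) ->
  cintegrable m' setT (weighted D' g s) /\
  cintegral m' setT (weighted D' g s) = cintegral m setT (weighted D g s).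
Proof.
move=> ts ig; have aeE : {ae m', forall x,
    (h x)%:C * weighted D g s x = weighted D' g s x}.
  apply: filterS RN_chain => x DE.
  by rewrite (weighted_scale He (D := D) (D' := D') ts (bg x) _ DE)// density_ge0.
have mw : cmeas (weighted D' g s).
  apply: (cmeas_Tr He ts) => [x|]; first exact: bop_sandwich.
  exact: (wmeas_sandwich He) (RN_wmeas He' pnu bD' hD') mg.
have ih := cintegrable_density mm' ig.
split; first exact: ae_cintegrable aeE.
rewrite -(cintegral_density mm' measurableT ig); symmetry.
by apply: ae_cintegral aeE => //; exact: cmeas_cintegrable ih.
Qed.

End Independence.

Theorem theorem2p12 (R : realType) (H : hilbertType R) (X : ptopologicalType)
    (X_locally_compact : locally_compact [set: X])
    (X_hausdorff : hausdorff_space X)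
    (I : set nat) (e : nat -> H) (e_basis : orthonormal_basis I e)
    (nu : set (borel X) -> H -> H) (nu_POVM : POVM nu)
    (rho : H -> H) (rho_state : state rho) (rho_full : full_rank rho)
    (D : borel X -> H -> H) (D_RN : RN_derivative nu rho I e D)
    (f : borel X -> H -> H) (f_qrv : quantum_random_variable f)
    (f_int : nu_integrable nu rho D f) :
  let Q := qintegral nu rho D I e f in
  [/\ (* the formula defines an operator in B(H) *)
      integral_matrix nu rho D I e f Q,
      (* with the trace property *)
      forall s, trace_class s ->
        cintegrable (nu_ nu rho) setT (weighted D f s) /\
        Tr (s \o Q) = cintegral (nu_ nu rho) setT (weighted D f s),
      (* and it is the only such operator *)
      forall B, bounded_operator B ->
        (forall s, trace_class s ->
          Tr (s \o B) = cintegral (nu_ nu rho) setT (weighted D f s)) ->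
        B = Q &
      (* independence of the density operator and of the basis *)
      forall (rho' : H -> H) (I' : set nat) (e' : nat -> H),
        state rho' -> full_rank rho' -> orthonormal_basis I' e' ->
        (exists D', RN_derivative nu rho' I' e' D') /\
        forall D', RN_derivative nu rho' I' e' D' ->
          [/\ nu_integrable nu rho' D' f,
              integral_matrix nu rho' D' I' e' f Q &
              qintegral nu rho' D' I' e' f = Q]].
Proof.
move=> Q; have bf x : bounded_operator (f x) by case: f_qrv.
have [ts [ps _]] := rho_state.
have pnu E : measurable E -> positive (nu E) by move=> mE; exact: (POVM_positive nu_POVM).
have [m mE] := nu_finite_measure e_basis nu_POVM ts ps.
have [bD hD] := (RN_derivativeP I e D mE).1 D_RN.
have [f1 f2 f3 f4] := f_int.
have cE g : cintegrable (nu_ nu rho) setT g = cintegrable m setT g.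
  exact: eq_cintegrable.
have iE g : cintegral (nu_ nu rho) setT g = cintegral m setT g.
  exact: eq_cintegral.
have pm g : pos_nu_integrable nu rho D g ->
    forall s, state s -> cintegrable m setT (weighted D g s).
  by move=> ig s ss; rewrite -cE; exact: ig.
have [A [bA hA]] :=
  operator_integral e_basis bf (pm _ f1) (pm _ f2) (pm _ f3) (pm _ f4).
have trA s : trace_class s ->
    Tr (s \o A) = cintegral (nu_ nu rho) setT (weighted D f s).
  by move=> tcs; rewrite iE; case: (hA s tcs).
have mA := trace_integral_matrix e_basis bA trA.
have QA : Q = A by exact: (qintegral_unique e_basis).
rewrite QA; split=> //.
- by move=> s tcs; rewrite cE iE; exact: hA.
- move=> B bB hB; apply: (bop_matrix_ext e_basis) => // i j _ _.
  have tij := rank_one_tc e_basis (e j) (e i).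
  by rewrite -!(Tr_rank_one e_basis)// hB// trA.
move=> rho' I' e' sr fr He'; have [tr' [pr' _]] := sr.
have [m' mE'] := nu_finite_measure e_basis nu_POVM tr' pr'.
have mm' : m `<< m' by exact: (nu_dominates e_basis nu_POVM sr fr mE mE' ts).
split.
  exists (fun x => (density m m' x)%:C *: D x); apply/(RN_derivativeP _ _ _ mE').
  split; first by move=> x; exact: bopZ.
  by move=> i j _ _; exact: (RN_pair_density e_basis pnu mm' bD hD).
move=> D' /(RN_derivativeP _ _ _ mE')[bD' hD'].
have cE' g : cintegrable (nu_ nu rho') setT g = cintegrable m' setT g.
  exact: eq_cintegrable.
have iE' g : cintegral (nu_ nu rho') setT g = cintegral m' setT g.
  exact: eq_cintegral.
have mf : wmeas f.
  by apply: (wmeas_states e_basis bf) => s ss; case: f_qrv => _; apply.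
have mR := wmeas_Reop e_basis bf mf; have mI := wmeas_Imop e_basis bf mf.
have bR x := bop_Reop e_basis (bf x); have bI x := bop_Imop e_basis (bf x).
have pp x := parts_positive e_basis (bf x).
have change := weighted_change e_basis He' pnu mm' bD hD bD' hD'.
have part g : (forall x, positive (g x)) -> wmeas g ->
    pos_nu_integrable nu rho D g -> pos_nu_integrable nu rho' D' g.
  move=> pg mg ig s ss; rewrite cE'.
  have [tcs _] := ss; have := ig s ss; rewrite cE => igs.
  have bg x := positive_bop (pg x).
  by have [] := change g bg mg s tcs igs.
have mA' : integral_matrix nu rho' D' I' e' f A.
  apply: (trace_integral_matrix He') => // s tcs; have [is_ ->] := hA s tcs.
  by rewrite iE'; have [_ ->] := change f bf mf s tcs is_.
split=> //; last exact: (qintegral_unique He').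
by split; apply: part => //; do ?[by move=> x; case: (pp x)];
  first [exact: (wmeas_pos_part e_basis)|exact: (wmeas_neg_part e_basis)].
Qed.
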